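(* Let $f\in L^\infty(\mathbb{R})\cap C^0(\mathbb{R})$ be real-valued. If all level sets $f^{-1}(\mu)$, $\mu\in\mathbb{R}$, have empty interior, then $\Psi(\epsilon)\to\infty$ as $\epsilon\to0$. In the converse case (i.e. if some level set of $f$ has nonempty interior), $\Psi(\epsilon)$ is uniformly bounded for all $\epsilon>0$.
   Context: For $\epsilon>0$, $H_\epsilon=-\partial_x^2+x^2+\frac{i}{\epsilon}f(x)$ is the operator on $L^2(\mathbb{R})$ (complex-valued functions) with domain $\mathcal{D}=\{u\in H^2(\mathbb{R}) : x^2u\in L^2(\mathbb{R})\}$, and $$\Psi(\epsilon)=\Bigl(\sup_{\lambda\in\mathbb{R}}\|(H_\epsilon-i\lambda)^{-1}\|\Bigr)^{-1},$$ where $\|\cdot\|$ is the operator norm on $L^2(\mathbb{R})$. *)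

(* Defs.v *)
From HB Require Import structures.
From mathcomp Require Import all_boot all_order all_algebra.
From mathcomp Require Import complex.
From mathcomp Require Import all_classical all_reals all_analysis.

Set Implicit Arguments.
Unset Strict Implicit.
Unset Printing Implicit Defensive.

Import Order.TTheory GRing.Theory Num.Theory.
Import numFieldNormedType.Exports.

Local Open Scope classical_set_scope.
Local Open Scope ring_scope.
Local Open Scope complex_scope.

Section Defs.
Context {R : realType}.

Local Notation mu := (@lebesgue_measure R).

(* Elements of L^2(R; C) are handled through Borel representatives, up to
   equality almost everywhere for [mu]. *)
Implicit Types u v g : R -> R[i].

Definition L2norm u : \bar R := ('N[mu]_(2%:E) [ (fun x => (Normc.normc (u x))%:E) ])%E.

Definition L2 u : Prop :=
  [/\ measurable_fun [set: R] (fun x => complex.Re (u x)),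
      measurable_fun [set: R] (fun x => complex.Im (u x)) &
      (L2norm u < +oo)%E].

Definition Cintegral g : R[i] :=
  (\int[mu]_x complex.Re (g x))%R +i* (\int[mu]_x complex.Im (g x))%R.

Definition test_function (phi : R -> R) : Prop :=
  (forall n x, derivable (derive1n n phi) x 1) /\
  compact (closure [set x | phi x != 0]).

(* Real-valued test functions suffice, by linearity. *)
Definition weak_derivative u v : Prop :=
  forall phi : R -> R, test_function phi ->
    Cintegral (fun x => u x * (derive1 phi x)%:C) =
    - Cintegral (fun x => v x * (phi x)%:C).

Definition H2_with u u2 : Prop :=
  exists u1, [/\ L2 u, L2 u1, L2 u2, weak_derivative u u1
               & weak_derivative u1 u2].

Definition H2 u : Prop := exists u2, H2_with u u2.

Definition domainH u : Prop := H2 u /\ L2 (fun x => (x ^+ 2)%:C * u x).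

(* An unbounded operator on L^2 is given by its graph: [T u g] means that u is
   in the domain of T and T u = g, both u and g being representatives. *)
Definition operator := (R -> R[i]) -> (R -> R[i]) -> Prop.

Definition Heps (f : R -> R) (eps : R) : operator := fun u g =>
  domainH u /\ L2 g /\
  exists2 u2, H2_with u u2 &
    g = (fun x => - u2 x + (x ^+ 2)%:C * u x + 'i / eps%:C * (f x)%:C * u x)
      %[ae mu].

(* Graph of (T - z)^-1, as a possibly multivalued and partial relation. *)
Definition resolvent (T : operator) (z : R[i]) : operator := fun g u =>
  L2 g /\ exists2 h, T u h & g = (fun x => h x - z * u x) %[ae mu].

Definition opnorm (S : operator) : \bar R :=
  ereal_sup [set t | exists g u, [/\ S g u, (L2norm g <= 1)%E & t = L2norm u]].

Definition bounded_operator (S : operator) : Prop :=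
  [/\ forall g, L2 g -> exists u, S g u,
      forall g u v, S g u -> S g v -> u = v %[ae mu] &
      (opnorm S < +oo)%E].

(* The usual convention ||(T - z)^-1|| = +oo for z in the spectrum. *)
Definition resolvent_norm (T : operator) (z : R[i]) : \bar R :=
  if `[< bounded_operator (resolvent T z) >] then opnorm (resolvent T z)
  else +oo%E.

Definition Psi (f : R -> R) (eps : R) : \bar R :=
  let resolvent_norms := [set resolvent_norm (Heps f eps) ('i * lambda%:C)
                         | lambda in [set: R]] in
  (ereal_sup resolvent_norms)^-1%E.

End Defs.

(* Main.v *)
(* Write u = a + i b, so that (H_eps - i lam) u = g becomes a real system.

   If f is nowhere locally constant, suppose that |g| < M |u|.  The real part of
   <g, u> bounds |u'|^2 + |x u|^2 by M |u|^2, which confines half of the mass of u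
   to a bounded interval and makes u Hoelder continuous; hence |u| is bounded below
   on an interval of fixed length.  Inside it f - eps lam keeps its sign and exceeds
   a fixed eta on a subinterval (by compactness, with uniform constants), and the
   imaginary part of <g, chi u>, for a bump chi there, forces eps to be bounded
   below.  Thus |(H_eps - i lam)^-1| <= 1 / M for small eps, once H_eps - i lam is
   onto.  Surjectivity is obtained by continuation from - d^2 + x^2 + 1, which
   factors as (d + x) (- d + x), through - d^2 + x^2 + 1 + i t (f / eps - lam).

   If f = m on an interval, take lam = m / eps and a fixed bump u supported in this
   interval: (H_eps - i lam) u = - u'' + x^2 u does not depend on eps. *)

Require Import Defs.
From HB Require Import structures.
From mathcomp Require Import all_boot all_order all_algebra.
From mathcomp Require Import complex ring lra.
From mathcomp Require Import all_classical all_reals all_analysis.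
From mathcomp Require Import measurable_realfun ess_sup_inf.

Import Order.TTheory GRing.Theory Num.Theory.
Import numFieldNormedType.Exports.

Local Open Scope classical_set_scope.
Local Open Scope ring_scope.

Set Implicit Arguments.
Unset Strict Implicit.
Unset Printing Implicit Defensive.

(** * Primitives of locally integrable functions *)

(** The a priori estimate yields injectivity and a bound on the inverse, but [Psi] counts a
    resolvent that is not onto as having norm [+oo]; this is why existence must be proved as well.
    In the continuation, the shift by 1 makes the bound on the inverse equal to 1 whatever the size
    of [q], so finitely many equal steps reach [f / eps - lam]. The shift is then removed in one
    step, which the bound 1 would not permit: the estimate for nowhere locally constant [f] holds
    for every [p >= 0], hence also at [p = 1], with the smaller constant [1 / M].

    Integration by parts on the whole line would require decay that is not known beforehand. The
    energy estimates therefore compare primitives ([prim]) on bounded intervals, with weights that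
    vanish at the end points, and an integral over the line is replaced by a bound on the increments
    of a primitive. These bounds concern squared norms, hence [M ^+ 2] where the resolvent norm has
    [M]. Weak derivatives enter only when the operator is translated into the real system. *)

Lemma local_to_global (R : realType) (P : R -> R -> Prop) :
  (forall s m t, s <= m -> m <= t -> P s m -> P m t -> P s t) ->
  (forall x, exists2 d, 0 < d &
     forall s t, x - d < s -> s <= t -> t < x + d -> P s t) ->
  forall a b, a <= b -> P a b.
Proof.
move=> Ptrans Ploc a b ab.
(* Induction along the line: [P a] holds up to [sup S], and the local hypothesis at [sup S] would
   push it further if [sup S < b]. *)
pose S := [set t | a <= t <= b /\ P a t].
have Sa : S a.
  have [d d0 Pd] := Ploc a.
  by split; [rewrite lexx | apply: Pd; rewrite ?ltrBlDr ?ltrDl].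
have hS : has_sup S by split; [exists a | exists b => t [/andP[]]].
have ac : a <= sup S by apply: ub_le_sup => //; case: hS.
have cb : sup S <= b by apply: ge_sup; [exists a | move=> t [/andP[]]].
have [d d0 Pd] := Ploc (sup S).
have [t [/andP[at_ tb] Pat] tc] : exists2 t, S t & sup S - d < t.
  exact: sup_adherent.
have tS : t <= sup S by apply: ub_le_sup; [case: hS|split=> //; rewrite at_].
have Pc : P a (sup S) by apply: (Ptrans _ t) => //; apply: Pd; rewrite ?ltrDl.
have [<-//|ltcb] : sup S = b \/ sup S < b.
  by move: cb; rewrite le_eqVlt => /orP[/eqP|]; [left|right].
pose e := Num.min (b - sup S) (d / 2).
have e0 : 0 < e by rewrite lt_min subr_gt0 ltcb divr_gt0.
have ed : e < d by rewrite gt_min; apply/orP; right; lra.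
have eb : sup S + e <= b by rewrite addrC -lerBrDr ge_min lexx.
suff : S (sup S + e).
  move=> /(ub_le_sup hS.2); lra.
split; first by rewrite eb andbT; lra.
by apply: (Ptrans _ (sup S)) => //; [lra|apply: Pd; lra].
Qed.

#[local] Instance ae_lebesgue_filter (R : realType) :
  Filter (nbhs (almost_everywhere (@lebesgue_measure R))).
Proof. exact: ae_filter_ringOfSetsType. Qed.

Section Prim.
Context {R : realType}.
Local Notation mu := (@lebesgue_measure R).
Implicit Types (F G v w h : R -> R).

Definition loc v := forall s t, mu.-integrable `[s, t] (EFin \o v).

(* [F] is absolutely continuous with derivative [v]; [v] matters only up to
   almost everywhere equality. *)
Definition prim F v :=
  loc v /\ forall s t, s <= t -> \int[mu]_(x in `[s, t]) v x = F t - F s.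

Lemma loc_continuous v : continuous v -> loc v.
Proof.
move=> cv s t; apply: continuous_compact_integrable; first exact: segment_compact.
exact: continuous_subspaceT.
Qed.

Lemma locD v w : loc v -> loc w -> loc (fun x => v x + w x).
Proof. by move=> lv lw s t; exact: (integrableD _ (lv s t) (lw s t)). Qed.

Lemma locN v : loc v -> loc (fun x => - v x).
Proof. by move=> lv s t; exact: (integrableN (lv s t)). Qed.

Lemma locB v w : loc v -> loc w -> loc (fun x => v x - w x).
Proof. by move=> lv /locN; exact: locD. Qed.

Lemma loc_norm v : loc v -> loc (fun x => `|v x|).
Proof. by move=> lv s t; exact: (integrable_norm (lv s t)). Qed.

Lemma eq_loc v w : v =1 w -> loc v -> loc w.
Proof. by move=> /funext ->. Qed.

Lemma locM h v : continuous h -> loc v -> loc (fun x => h x * v x).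
Proof.
move=> ch lv s t.
apply: (@integrableMr _ _ _ mu `[s, t] _ h (EFin \o v)) => //.
  by apply: measurable_funTS; apply: continuous_measurable_fun.
have /compact_bounded[M [Mr HM]] : compact (h @` `[s, t]).
  apply: continuous_compact; last exact: segment_compact.
  exact: continuous_subspaceT.
exists M; split => // x /HM Hx y yst; apply: Hx.
by exists y.
Qed.

Lemma loc_measurable v : loc v -> measurable_fun [set: R] v.
Proof.
move=> lv.
have -> : [set: R] = \bigcup_n `[- n%:R, n%:R]%classic.
  apply/seteqP; split => // x _.
  exists (Num.truncn `|x|).+1 => //=; rewrite in_itv /= -ler_norml.
  by apply: ltW; exact: truncnS_gt.
apply/measurable_fun_bigcup => // n.
by apply/measurable_EFinP; exact: (measurable_int mu (lv _ _)).
Qed.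

Lemma le_loc v w : measurable_fun [set: R] v -> (forall x, `|v x| <= w x) ->
  loc w -> loc v.
Proof.
move=> mv vw lw s t; apply: (le_integrable _ _ _ (lw s t)) => //.
  by apply/measurable_EFinP; exact: measurable_funTS.
move=> x _ /=; rewrite lee_fin; apply: le_trans (vw x) _.
exact: ler_norm.
Qed.

Lemma ae_loc v w : measurable_fun [set: R] w ->
  (v = w %[ae mu]) -> loc v -> loc w.
Proof.
move=> mw vw lv s t; apply/integrableP; split.
  by apply/measurable_EFinP; exact: measurable_funTS.
have /integrableP[mv] := lv s t; apply: le_lt_trans.
rewrite le_eqVlt; apply/orP; left; apply/eqP.
apply: ge0_ae_eq_integral => //.
- by apply: measurableT_comp => //; apply/measurable_EFinP; exact: measurable_funTS.
- exact: measurableT_comp.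
- by move: vw; apply: filterS => x /= vw _; rewrite vw.
Qed.

Lemma ae_prim F v w : measurable_fun [set: R] w ->
  (v = w %[ae mu]) -> prim F v -> prim F w.
Proof.
move=> mw vw [lv Fv]; split; first exact: ae_loc vw lv.
move=> s t st; rewrite -(Fv s t st); congr fine.
apply: ae_eq_integral => //.
- by apply/measurable_EFinP; exact: measurable_funTS.
- exact: (measurable_int mu (lv s t)).
- by move: vw; apply: filterS => x /= vw _; rewrite vw.
Qed.

Lemma integral_itv_cat v s m t : loc v -> s <= m -> m <= t ->
  \int[mu]_(x in `[s, t]) v x =
  \int[mu]_(x in `[s, m]) v x + \int[mu]_(x in `[m, t]) v x.
Proof.
move=> lv sm mt.
have := Rintegral_itvB (lv s t); move/(_ m); rewrite !bnd_simp => /(_ sm mt).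
rewrite Rintegral_itv_obnd_cbnd => [<-|]; first by rewrite addrC subrK.
apply: integrableS (lv s t) => //; apply: subset_itvr; rewrite bnd_simp//.
Qed.

Lemma loc_prim v : loc v -> exists F, prim F v.
Proof.
move=> lv.
exists (fun x => if 0 <= x then \int[mu]_(y in `[0, x]) v y
                 else - \int[mu]_(y in `[x, 0]) v y).
split=> // s t st; case: ifPn => t0; case: ifPn => s0.
- by rewrite (integral_itv_cat lv s0 st) addrAC subrr add0r.
- move: s0; rewrite -ltNge => /ltW s0.
  by rewrite (integral_itv_cat lv s0 t0) opprK addrC.
- by move: t0; rewrite (le_trans s0 st).
- move: t0; rewrite -ltNge => /ltW t0.
  by rewrite (integral_itv_cat lv st t0) opprK addrC addrK.
Qed.

Lemma eq_prim F G v w : F =1 G -> v =1 w -> prim F v -> prim G w.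
Proof. by move=> /funext -> /funext ->. Qed.

Lemma primD F G v w : prim F v -> prim G w ->
  prim (fun x => F x + G x) (fun x => v x + w x).
Proof.
move=> [lv Fv] [lw Gw]; split; first exact: locD.
by move=> s t st; rewrite RintegralD// ?Fv// ?Gw//; ring.
Qed.

Lemma primB F G v w : prim F v -> prim G w ->
  prim (fun x => F x - G x) (fun x => v x - w x).
Proof.
move=> [lv Fv] [lw Gw]; split; first exact: locB.
by move=> s t st; rewrite RintegralB// ?Fv// ?Gw//; ring.
Qed.

Lemma prim_cst c : prim (fun=> c) (fun=> 0).
Proof.
split; first by apply: loc_continuous => x; exact: cvg_cst.
by move=> s t st; rewrite Rintegral_cst// mul0r subrr.
Qed.

Lemma prim_id : prim (fun x => x) (fun=> 1).
Proof.
split; first by apply: loc_continuous => x; exact: cvg_cst.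
move=> s t st; rewrite Rintegral_cst// mul1r.
transitivity (fine (mu `[s, t]%classic)) => //.
rewrite lebesgue_measure_itv /= lte_fin.
by case: ltP => // ts; rewrite (le_anti (_ : s <= t <= s)) ?subrr// st ts.
Qed.

Lemma primN F v : prim F v -> prim (fun x => - F x) (fun x => - v x).
Proof.
by move=> Fv; apply: eq_prim (primB (prim_cst 0) Fv) => x; rewrite sub0r.
Qed.

Lemma prim_le F G v w s t : prim F v -> prim G w -> s <= t ->
  (forall x, s <= x <= t -> v x <= w x) -> F t - F s <= G t - G s.
Proof.
move=> [lv Fv] [lw Gw] st vw; rewrite -Fv// -Gw//; exact: le_Rintegral.
Qed.

Lemma prim_ge0 G w s t : prim G w -> s <= t ->
  (forall x, s <= x <= t -> 0 <= w x) -> G s <= G t.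
Proof.
by move=> /(prim_le (prim_cst 0)) /[apply] /[apply]; rewrite subrr subr_ge0.
Qed.

Lemma prim_norm_le F G v w s t : prim F v -> prim G w -> s <= t ->
  (forall x, s <= x <= t -> `|v x| <= w x) -> `|F t - F s| <= G t - G s.
Proof.
move=> Fv Gw st vw; rewrite ler_norml lerNl.
rewrite (prim_le Fv Gw st) ?andbT; last first.
  by move=> x /vw; rewrite ler_norml => /andP[].
have -> : - (F t - F s) = - F t - - F s by ring.
by apply: (prim_le (primN Fv) Gw st) => x /vw; rewrite ler_norml lerNl => /andP[].
Qed.

Lemma prim_continuous F v : prim F v -> continuous F.
Proof.
move=> [lv Fv] x.
have ab : x - 1 < x + 1 by lra.
have := parameterized_integral_continuous (ltW ab) (lv _ _).
move=> /(continuous_within_itvP _ ab)[+ _ _] => /(_ x).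
rewrite in_itv /= => cI0.
have cI : {for x, continuous (fun y => \int[mu]_(z in `[x - 1, y]) v z)}.
  by apply: cI0; apply/andP; lra.
have : (fun y => (\int[mu]_(z in `[x - 1, y]) v z) + F (x - 1)) y @[y --> x]
    --> (\int[mu]_(z in `[x - 1, x]) v z) + F (x - 1).
  by apply: cvgD; [exact: cI|exact: cvg_cst].
rewrite Fv ?subrK; last lra.
apply: cvg_trans; apply: near_eq_cvg; near=> y.
rewrite Fv ?subrK//; apply/ltW.
near: y; apply: lt_nbhsr; lra.
Unshelve. all: by end_near. Qed.
Lemma continuous_eps F x (e : R) : {for x, continuous F} -> 0 < e ->
  exists2 d : R, 0 < d & forall y, `|x - y| < d -> `|F x - F y| < e.
Proof.
move=> cF e0; have /cvgrPdist_lt/(_ e e0)[d /= d0 Hd] := cF.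
by exists d.
Qed.

(* [(FG)(t) - (FG)(s) = F(s) (G(t) - G(s)) + G(t) (F(t) - F(s))], so on short
   intervals the defect is at most [e] times the integral of [|v| + |w|]; being
   additive, this bound propagates to all intervals. *)
Lemma primM F G v w : prim F v -> prim G w ->
  prim (fun x => F x * G x) (fun x => v x * G x + F x * w x).
Proof.
move=> Fv Gw; have cF := prim_continuous Fv; have cG := prim_continuous Gw.
have lH : loc (fun x => v x * G x + F x * w x).
  apply: locD; last exact: (locM cF Gw.1).
  by apply: eq_loc (locM cG Fv.1) => x; rewrite mulrC.
have [H Hh] := loc_prim lH.
have [V Vv] := loc_prim (locD (loc_norm Fv.1) (loc_norm Gw.1)).
split=> // s t st; rewrite (Hh.2 _ _ st).
suff E (e : R) : 0 < e ->
    `|(F t * G t - H t) - (F s * G s - H s)| <= e * V t - e * V s.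
  have -> : F t * G t - F s * G s = (F t * G t - H t) - (F s * G s - H s) + (H t - H s) by ring.
  apply/eqP; rewrite -subr_eq0 opprD addrA addrAC subrr sub0r oppr_eq0 -normr_le0.
  have V0 : V s <= V t.
    by apply: (prim_ge0 Vv st) => x _; rewrite addr_ge0.
  apply/ler_addgt0Pl => /= e e0; rewrite addr0.
  have d0 : 0 < V t - V s + 1 by lra.
  have /E : 0 < e / (V t - V s + 1) by rewrite divr_gt0.
  rewrite -mulrBr => /le_trans; apply; rewrite -mulrA ler_piMr ?(ltW e0)//.
  by rewrite mulrC ler_pdivrMr//; lra.
move=> e0; move: s t st; apply: local_to_global => [s m t _ _ H1 H2|x].
  have -> : F t * G t - H t - (F s * G s - H s) =
    (F t * G t - H t - (F m * G m - H m)) + (F m * G m - H m - (F s * G s - H s)) by ring.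
  by apply: le_trans (ler_normD _ _) (le_trans (lerD H2 H1) _); lra.
have e2 : 0 < e / 2 by rewrite divr_gt0.
have [d1 d10 Hd1] := continuous_eps (cF x) e2.
have [d2 d20 Hd2] := continuous_eps (cG x) e2.
exists (Num.min d1 d2); first by rewrite lt_min d10.
move=> s t xs st tx.
have near y : s <= y <= t -> `|F x - F y| < e / 2 /\ `|G x - G y| < e / 2.
  move=> /andP[sy yt].
  have : `|x - y| < Num.min d1 d2 by rewrite ltr_norml; lra.
  by rewrite lt_min => /andP[y1 y2]; split; [exact: Hd1|exact: Hd2].
have lZ c : prim (fun y => c) (fun=> 0) by exact: prim_cst.
pose K y := F s * G y + G t * F y - H y.
have PK : prim K (fun y => (F s - F y) * w y + (G t - G y) * v y).
  have cc (c : R) : continuous (fun _ : R => c) by move=> ?; exact: cvg_cst.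
  have pZ c F0 v0 : prim F0 v0 -> prim (fun y => c * F0 y) (fun y => c * v0 y).
    move=> [l p]; split; first exact: locM.
    by move=> a b ab; rewrite RintegralZl// p// mulrBr.
  apply: eq_prim (primB (primD (pZ (F s) _ _ Gw) (pZ (G t) _ _ Fv)) Hh) => //.
  by move=> y /=; ring.
have pE : prim (fun y => e * V y) (fun y => e * (`|v y| + `|w y|)).
  split; first by apply: locM Vv.1 => ?; exact: cvg_cst.
  by move=> a b ab; rewrite RintegralZl// ?(Vv.2 _ _ ab) ?mulrBr//; exact: Vv.1.
have -> : (F t * G t - H t) - (F s * G s - H s) = K t - K s by rewrite /K; ring.
apply: (prim_norm_le PK pE st) => y yst.
have [Fy Gy] := near y yst.
have [Fs _] : `|F x - F s| < e / 2 /\ `|G x - G s| < e / 2.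
  by apply: near; rewrite lexx.
have [_ Gt] : `|F x - F t| < e / 2 /\ `|G x - G t| < e / 2.
  by apply: near; rewrite lexx andbT.
apply: le_trans (ler_normD _ _) _; rewrite !normrM mulrDr addrC.
apply: lerD; apply: ler_wpM2r => //; rewrite ler_norml.
  by move: Gy Gt; rewrite !ltr_norml => /andP[? ?] /andP[? ?]; lra.
by move: Fy Fs; rewrite !ltr_norml => /andP[? ?] /andP[? ?]; lra.
Qed.

Lemma primZ c F v : prim F v -> prim (fun x => c * F x) (fun x => c * v x).
Proof.
move=> /(primM (prim_cst c)); apply: eq_prim => // x /=.
by rewrite mul0r add0r.
Qed.

Lemma prim_derive F v : (forall x, is_derive x (1 : R) F (v x)) ->
  continuous v -> prim F v.
Proof.
move=> dF cv; split; first exact: loc_continuous.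
move=> s t; rewrite le_eqVlt => /orP[/eqP <-|st].
  by rewrite set_itv1 Rintegral_set1 subrr.
have cF x : {for x, continuous F}.
  by apply/differentiable_continuous/derivable1_diffP; case: (dF x).
rewrite /Rintegral (@continuous_FTC2 _ v F)//.
- exact: continuous_subspaceT.
- split; first by move=> x _; case: (dF x).
  + exact/cvg_at_right_filter/cF.
  + exact/cvg_at_left_filter/cF.
- by move=> x _; rewrite derive1E; case: (dF x).
Qed.

Lemma prim_opp F v : continuous v -> prim F v ->
  prim (fun x => - F (- x)) (fun x => v (- x)).
Proof.
move=> cv Fv; split.
  apply: loc_continuous => x.
  by apply: (@continuous_comp _ _ _ -%R v); [exact: opp_continuous|exact: cv].
move=> s t st; rewrite -[LHS]/(fine _).
rewrite -(@integration_by_substitution_oppr _ v)//; last exact: continuous_subspaceT.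
by rewrite -[LHS]/(\int[mu]_(x in `[- t, - s]) v x) Fv.2 ?lerN2//; ring.
Qed.

(** Expand the integral of [(v - m)^2 >= 0], where [m] is the mean of [v] over [[s, t]]. *)
Lemma prim_cauchy_schwarz F V v s t : prim F v -> prim V (fun x => v x ^+ 2) ->
  s <= t -> (F t - F s) ^+ 2 <= (t - s) * (V t - V s).
Proof.
move=> Fv Vv; rewrite le_eqVlt => /orP[/eqP <-|st].
  by rewrite !subrr expr0n mul0r.
pose m := (F t - F s) / (t - s).
have ts : 0 < t - s by rewrite subr_gt0.
have P := primD (primB Vv (primZ (2 * m) Fv)) (primZ (m ^+ 2) prim_id).
have : V s - 2 * m * F s + m ^+ 2 * s <= V t - 2 * m * F t + m ^+ 2 * t.
  apply: (prim_ge0 P (ltW st)) => x _.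
  by rewrite (_ : _ + _ = (v x - m) ^+ 2) ?sqr_ge0//; ring.
have E : F t - F s = m * (t - s) by rewrite /m divfK ?gt_eqF.
have -> : (F t - F s) ^+ 2 = (t - s) * (m * (F t - F s)) by rewrite E; ring.
rewrite ler_pM2l// => H; have : m * (F t - F s) = m ^+ 2 * (t - s) by rewrite E; ring.
lra.
Qed.

Lemma prim_eq0 H h : prim H h -> continuous h -> (forall x, 0 <= h x) ->
  (forall s t, s <= t -> H t <= H s) -> forall x, h x = 0.
Proof.
move=> Hh ch h0 dH x; apply/eqP; rewrite eq_le h0 andbT leNgt; apply/negP => hx.
have hx2 : 0 < h x / 2 by rewrite divr_gt0.
have [d d0 Hd] := continuous_eps (ch x) hx2.
have xd : x <= x + d / 2 by lra.
have := prim_le (primZ (h x / 2) prim_id) Hh xd.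
have D := dH _ _ xd => E.
have : h x / 2 * (x + d / 2) - h x / 2 * x <= H (x + d / 2) - H x.
  apply: E => y yx; have : `|h x - h y| < h x / 2.
    by apply: Hd; rewrite ltr_norml; lra.
  by rewrite ltr_norml; lra.
have : 0 < h x / 2 * (d / 2) by rewrite mulr_gt0// divr_gt0.
lra.
Qed.

(** The approximating pair may change with the interval and the precision. This is how the equation
    passes to the limit in the iteration. *)
Lemma prim_limit F v : measurable_fun [set: R] v ->
  (forall s t e, 0 < e -> exists G w, [/\ prim G w, `|F s - G s| <= e,
     `|F t - G t| <= e & forall x, s <= x <= t -> `|v x - w x| <= e]) ->
  prim F v.
Proof.
move=> mv FGw.
have lv : loc v.
  move=> s t; have [G [w [Gw _ _ vw]]] := FGw s t 1 ltr01.
  have lw : loc (fun x => `|w x| + 1).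
    apply: locD; first exact: (loc_norm Gw.1).
    by apply: loc_continuous => ?; exact: cvg_cst.
  apply: (le_integrable _ _ _ (lw s t)) => //.
    by apply/measurable_EFinP; exact: measurable_funTS.
  move=> x /=; rewrite in_itv /= lee_fin => /vw vwx.
  rewrite [leRHS]ger0_norm ?addr_ge0//.
  by rewrite -{1}(subrK (w x) (v x)) addrC (le_trans (ler_normD _ _))// lerD.
split=> // s t st.
apply/eqP; rewrite -subr_eq0 -normr_le0; apply/ler_addgt0Pl => /= e e0; rewrite addr0.
(* The error [e / k] is paid once at each end point and [t - s] times through the integral. *)
pose k := t - s + 2; have k0 : 0 < k by rewrite /k; lra.
have [|G [w [Gw Gs Gt vw]]] := FGw s t (e / k); first by rewrite divr_gt0.
have [V Vv] := loc_prim lv.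
have cI : prim (fun x => e / k * x) (fun=> e / k).
  by apply: eq_prim (primZ (e / k) prim_id) => // x; rewrite mulr1.
have := prim_norm_le (primB Vv Gw) cI st vw.
rewrite Vv.2// -mulrBr => H.
have E : e = e / k * (t - s) + e / k + e / k.
  have -> : e / k * (t - s) + e / k + e / k = e / k * k by rewrite [in RHS]/k; ring.
  by rewrite divfK// gt_eqF.
rewrite [leRHS]E.
have -> : V t - V s - (F t - F s) =
  (V t - G t - (V s - G s)) + (G t - F t) + (F s - G s) by ring.
apply: le_trans (ler_normD _ _) (lerD (le_trans (ler_normD _ _) (lerD H _)) _) => //.
by rewrite distrC.
Qed.
End Prim.

(** * Energy estimates *)

Section Energy.
Context {R : realType}.
Implicit Types (F G U V : R -> R).

Lemma continuousD_fun F G : continuous F -> continuous G ->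
  continuous (fun x => F x + G x).
Proof. by move=> cF cG x; apply: cvgD; [exact: cF|exact: cG]. Qed.

Lemma continuousN_fun F : continuous F -> continuous (fun x => - F x).
Proof. by move=> cF x; apply: cvgN; exact: cF. Qed.

Lemma continuousM_fun F G : continuous F -> continuous G ->
  continuous (fun x => F x * G x).
Proof. by move=> cF cG x; apply: cvgM; [exact: cF|exact: cG]. Qed.

Lemma continuousX_fun F n : continuous F -> continuous (fun x => F x ^+ n).
Proof.
move=> cF; elim: n => [|n ih].
  by under eq_fun do rewrite expr0; move=> x; exact: cvg_cst.
by under eq_fun do rewrite exprS; exact: continuousM_fun.
Qed.

Lemma continuous_id_fun : continuous (fun x : R => x).
Proof. by move=> x; exact: cvg_id. Qed.

Lemma continuous_cst_fun (c : R) : continuous (fun _ : R => c).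
Proof. by move=> x; exact: cvg_cst. Qed.

End Energy.

Ltac cont := lazymatch goal with
  | |- continuous (fun _ => _ + _) => apply: continuousD_fun; cont
  | |- continuous (fun _ => - _) => apply: continuousN_fun; cont
  | |- continuous (fun _ => _ * _) => apply: continuousM_fun; cont
  | |- continuous (fun _ => _ ^+ _) => apply: continuousX_fun; cont
  | |- continuous (fun x => x) => exact: continuous_id_fun
  | |- continuous (fun _ => ?c) => exact: continuous_cst_fun
  | |- _ => first [assumption | exact: continuous_cst_fun]
  end.

Ltac nonneg := repeat first
  [ assumption | exact: normr_ge0 | apply: sqr_ge0 | apply: addr_ge0
  | apply: mulr_ge0 | by rewrite invr_ge0 ltW | exact: ltW].

Section Energy2.
Context {R : realType}.
Implicit Types (F G U V a b : R -> R).

Lemma continuous_prim v : continuous v -> exists F : R -> R, prim F v.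
Proof. by move=> /loc_continuous/loc_prim. Qed.

Definition growth_le U (A : R) := forall s t, s <= t -> U t - U s <= A.

(* [|a + i b|_(L^2)^2 <= A], expressed on bounded intervals. *)
Definition mass_le a b (A : R) :=
  exists2 U, prim U (fun x => a x ^+ 2 + b x ^+ 2) & growth_le U A.

Lemma growth_le_ge0 U A : growth_le U A -> 0 <= A.
Proof. by move=> /(_ 0 0 (lexx _)); rewrite subrr. Qed.

Lemma growth_le_sym U u A : prim U u -> (forall x, 0 <= u x) ->
  (forall S : R, 1 <= S -> U S - U (- S) <= A) -> growth_le U A.
Proof.
move=> Uu u0 UA s t st; pose S := 1 + `|s| + `|t|.
have sS := ler_norm (- s); rewrite normrN in sS.
have tS := ler_norm t; have s0 := normr_ge0 s; have t0 := normr_ge0 t.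
have US : U t <= U S by apply: (prim_ge0 Uu) => //; rewrite /S; lra.
have Us : U (- S) <= U s by apply: (prim_ge0 Uu) => //; rewrite /S; lra.
have S1 : 1 <= S by rewrite /S; lra.
by have := UA S S1; lra.
Qed.

(* Real form of [- u'' + (x^2 + p + i q) u = g] for [u = a + i b] and
   [g = g1 + i g2]. *)
Definition system (p : R) (q g1 g2 a a1 b b1 : R -> R) :=
  [/\ prim a a1, prim b b1,
      prim a1 (fun x => (x ^+ 2 + p) * a x - q x * b x - g1 x) &
      prim b1 (fun x => (x ^+ 2 + p) * b x + q x * a x - g2 x)].

(** With [k = T^-2] the weight vanishes at both ends of [[- T, T]], so no boundary term survives. It
    is squared so that its derivative still carries a factor [1 - k x^2], to be paired with the
    derivative of the unknown in Young's inequality. *)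
Lemma prim_cutoff (k : R) :
  prim (fun x : R => (1 - k * x ^+ 2) ^+ 2)
       (fun x => - (4 * k * x * (1 - k * x ^+ 2))).
Proof.
have H := primB (prim_cst (1 : R)) (primZ k (primM (@prim_id R) (@prim_id R))).
by apply: eq_prim (primM H H) => x; ring.
Qed.

Lemma cutoff_range (x T : R) : 0 < T -> - T <= x <= T ->
  [/\ -1 <= T^-1 * x <= 1 & 0 <= 1 - (T^-1) ^+ 2 * x ^+ 2 <= 1].
Proof.
move=> T0 /andP[x1 x2].
have H : -1 <= T^-1 * x <= 1 by rewrite mulrC ler_pdivlMr// ler_pdivrMr//; lra.
split => //; rewrite -exprMn; move: H => /andP[z1 z2]; nra.
Qed.

Lemma weighted_young (th g a : R) : 0 < th ->
  `|g * a| <= 2^-1 * (th * g ^+ 2 + th^-1 * a ^+ 2).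
Proof.
move=> th0; pose r := Num.sqrt th.
have r0 : 0 < r by rewrite sqrtr_gt0.
have <- : r ^+ 2 = th by rewrite sqr_sqrtr// ltW.
have E : g * a = (r * g) * (r^-1 * a) by field; rewrite gt_eqF.
rewrite E -exprVn -!exprMn; set u := r * g; set v := r^-1 * a.
by rewrite ler_norml; have := sqr_ge0 (u - v); have := sqr_ge0 (u + v); lra.
Qed.

(** The right-hand side is the derivative of [Y^2 (a a1 + b b1)] plus error terms; [i] stands for
    [1 / T], not for the imaginary unit. The [q] terms cancel, this being the real part of the
    equation. The derivative of the weight is absorbed by [2 i (Y a1 - i x a)^2 >= 0] and its
    analogue for [b], since [(i x)^2 = 1 - Y <= 1]; the data are absorbed by Young's inequality with
    parameter [th]. *)
Lemma energy_pointwise (i x p q a a1 b b1 g1 g2 th Y : R) :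
  0 < i -> 0 <= p -> 0 < th -> Y = 1 - i ^+ 2 * x ^+ 2 -> 0 <= Y <= 1 ->
  (1 - 2 * i) * (Y ^+ 2 * (a1 ^+ 2 + b1 ^+ 2 + (x ^+ 2 + p) * (a ^+ 2 + b ^+ 2)))
  <= - (4 * i ^+ 2 * x * Y) * (a * a1 + b * b1) +
     Y ^+ 2 * (a1 * a1 + a * ((x ^+ 2 + p) * a - q * b - g1) +
     (b1 * b1 + b * ((x ^+ 2 + p) * b + q * a - g2))) +
     ((2 * i + 2^-1 * th^-1) * (a ^+ 2 + b ^+ 2) +
      2^-1 * th * (g1 ^+ 2 + g2 ^+ 2)).
Proof.
move=> i0 p0 th0 YE /andP[Y0 Y1].
pose z := i * x; have i0' := ltW i0.
pose Q := 2^-1 * (th * (g1 ^+ 2 + g2 ^+ 2) + th^-1 * (a ^+ 2 + b ^+ 2)).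
have W : Y ^+ 2 * (g1 * a + g2 * b) <= Q.
  have := weighted_young g1 a th0; have := weighted_young g2 b th0.
  rewrite !ler_norml => /andP[_ H2] /andP[_ H1].
  have H : g1 * a + g2 * b <= Q by rewrite /Q; lra.
  have Q0 : 0 <= Q.
    by rewrite /Q; nonneg.
  have Y2 : Y ^+ 2 <= 1 by rewrite expr_le1.
  have := ler_wpM2l (sqr_ge0 Y) H; have := ler_wpM2r Q0 Y2.
  lra.
have z1 : z ^+ 2 = 1 - Y by rewrite YE /z; ring.
have S1 : 0 <= i * (Y * a1 - z * a) ^+ 2 by nonneg.
have S2 : 0 <= i * (Y * b1 - z * b) ^+ 2 by nonneg.
have S3 : 0 <= i * (Y ^+ 2 * ((x ^+ 2 + p) * (a ^+ 2 + b ^+ 2))).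
  by nonneg.
have S4 : 0 <= i * (Y * (a ^+ 2 + b ^+ 2)).
  by nonneg.
have E1 : i * (Y * a1 - z * a) ^+ 2 =
   i * (Y ^+ 2 * a1 ^+ 2) - 2 * (i ^+ 2 * x * Y * (a * a1)) + i * (1 - Y) * a ^+ 2.
  by rewrite -z1 /z; ring.
have E2 : i * (Y * b1 - z * b) ^+ 2 =
   i * (Y ^+ 2 * b1 ^+ 2) - 2 * (i ^+ 2 * x * Y * (b * b1)) + i * (1 - Y) * b ^+ 2.
  by rewrite -z1 /z; ring.
by rewrite E1 in S1; rewrite E2 in S2; rewrite /Q in W; clear -S1 S2 S3 S4 W; lra.
Qed.

(** Here the weight is [Y^2 x^2], whose derivative is [c x Y] with [c = 2 Y - 4 (1 - Y)] and
    [|c| <= 4]. Completing the square [(x Y a1 + c a / 2)^2] costs at most [4 a^2], and the term in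
    [g1] takes half of [Y^2 x^4 a^2], whence the factor [2^-1] on the left. *)
Lemma regularity_pointwise (i x p q a a1 b b1 g1 g2 Y : R) :
  0 <= p -> Y = 1 - i ^+ 2 * x ^+ 2 -> 0 <= Y <= 1 ->
  2^-1 * (Y ^+ 2 * (x ^+ 4 * (a ^+ 2 + b ^+ 2)))
  <= (- (4 * i ^+ 2 * x * Y) * (x * x) + Y ^+ 2 * (1 * x + x * 1)) *
       (a * a1 + b * b1) +
     Y ^+ 2 * (x * x) * (a1 * a1 + a * ((x ^+ 2 + p) * a - q * b - g1) +
     (b1 * b1 + b * ((x ^+ 2 + p) * b + q * a - g2))) +
     (4 * (a ^+ 2 + b ^+ 2) + 2^-1 * (g1 ^+ 2 + g2 ^+ 2)).
Proof.
move=> p0 YE /andP[Y0 Y1].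
pose c := 2 * Y - 4 * (1 - Y).
have c2 : c ^+ 2 <= 16.
  have : 0 <= (4 - c) * (4 + c) by apply: mulr_ge0; rewrite /c; lra.
  lra.
have iE : i ^+ 2 * x ^+ 2 = 1 - Y by rewrite YE; ring.
have -> : - (4 * i ^+ 2 * x * Y) * (x * x) + Y ^+ 2 * (1 * x + x * 1) = c * (x * Y).
  have -> : - (4 * i ^+ 2 * x * Y) * (x * x) = - 4 * (i ^+ 2 * x ^+ 2) * (x * Y) by ring.
  by rewrite iE /c; ring.
have S1 := sqr_ge0 (x * Y * a1 + 2^-1 * c * a).
have S2 := sqr_ge0 (x * Y * b1 + 2^-1 * c * b).
have C1 := ler_wpM2r (sqr_ge0 a) c2.
have C2 := ler_wpM2r (sqr_ge0 b) c2.
have S3 := sqr_ge0 (Y * x ^+ 2 * a - Y * g1).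
have S4 := sqr_ge0 (Y * x ^+ 2 * b - Y * g2).
have S5 : 0 <= p * ((Y * x) ^+ 2 * (a ^+ 2 + b ^+ 2)) by nonneg.
have Y2 : Y ^+ 2 <= 1 by rewrite expr_le1.
have G1 := ler_wpM2r (sqr_ge0 g1) Y2.
have G2 := ler_wpM2r (sqr_ge0 g2) Y2.
clear -S1 S2 C1 C2 S3 S4 S5 G1 G2; clearbody c; lra.
Qed.

(* The real part of the equation is tested against [(1 - x^2 / T^2)^2 u] on
   [[-T, T]], and [T] tends to infinity. *)
Lemma energy_le (p th A B : R) q g1 g2 a a1 b b1 E :
  system p q g1 g2 a a1 b b1 -> 0 <= p -> 0 < th ->
  mass_le a b A -> mass_le g1 g2 B ->
  prim E (fun x => a1 x ^+ 2 + b1 x ^+ 2 +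
                   (x ^+ 2 + p) * (a x ^+ 2 + b x ^+ 2)) ->
  growth_le E (2^-1 * (th * B + th^-1 * A)).
Proof.
move=> [aa bb aa1 bb1] p0 th0 [U Uu UA] [G Gg GB] Ee.
have ca := prim_continuous aa; have cb := prim_continuous bb.
have ca1 := prim_continuous aa1; have cb1 := prim_continuous bb1.
have A0 := growth_le_ge0 UA.
set K := 2^-1 * _.
have e0 x : 0 <= a1 x ^+ 2 + b1 x ^+ 2 + (x ^+ 2 + p) * (a x ^+ 2 + b x ^+ 2).
  by nonneg.
apply: (growth_le_sym Ee e0) => S S1.
pose X := E S - E (- S).
have X0 : 0 <= X by rewrite subr_ge0; apply: (prim_ge0 Ee) => //; lra.
(* [X] is the energy on a fixed [[- S, S]], while the cutoff lives on [[- T, T]]; the errors are of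
   order [1 / T]. *)
have main (T : R) : S <= T -> 2 <= T ->
    (1 - 2 * T^-1 - 2 * S * T^-1) * X <= K + 2 * T^-1 * A.
  move=> ST T2; have T0 : 0 < T by lra.
  pose i := T^-1; have i0 : 0 < i by rewrite invr_gt0.
  have Si : S * i <= 1; first by rewrite ler_pdivrMr// mul1r.
  pose y (x : R) := 1 - i ^+ 2 * x ^+ 2.
  have [Y Yy] : exists Y, prim Y (fun x => y x ^+ 2 * (a1 x ^+ 2 + b1 x ^+ 2 +
                   (x ^+ 2 + p) * (a x ^+ 2 + b x ^+ 2))).
    by apply: continuous_prim; rewrite /y; cont.
  have PF := primM (prim_cutoff (i ^+ 2)) (primD (primM aa aa1) (primM bb bb1)).
  have PR := primD PF (primD (primZ (2 * i + 2^-1 * th^-1) Uu)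
    (primZ (2^-1 * th) Gg)).
  have TT : - T <= T by lra.
  have := prim_le (primZ (1 - 2 * i) Yy) PR TT.
  have -> : 1 - i ^+ 2 * T ^+ 2 = 0 by rewrite -exprMn mulVf ?gt_eqF// expr1n subrr.
  have -> : 1 - i ^+ 2 * (- T) ^+ 2 = 0.
    by rewrite sqrrN -exprMn mulVf ?gt_eqF// expr1n subrr.
  rewrite !expr0n /= !mul0r !add0r => H.
  have {}H : (1 - 2 * i) * (Y T - Y (- T)) <= 2 * i * A + K.
    have -> : (1 - 2 * i) * (Y T - Y (- T)) =
      (1 - 2 * i) * Y T - (1 - 2 * i) * Y (- T) by ring.
    apply: le_trans (H _) _.
      move=> x xT; have [zI yI] := cutoff_range T0 xT.
      exact: energy_pointwise.
    have H1 := UA _ _ TT; have H2 := GB _ _ TT.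
    have th1 : 0 < th^-1 by rewrite invr_gt0.
    have C1 : 0 <= 2 * i + 2^-1 * th^-1 by lra.
    have C2 : 0 <= 2^-1 * th by lra.
    have := ler_wpM2l C1 H1; have := ler_wpM2l C2 H2; rewrite /K; lra.
  (* On [[- S, S]] the weight is at least [1 - 2 x^2 / T^2 >= 1 - 2 S / T], as [S <= T]. *)
  have YX : (1 - 2 * (S * i)) * X <= Y T - Y (- T).
    have SS : - S <= S by lra.
    have H1 : Y S <= Y T.
      by apply: (prim_ge0 Yy) => // x _; nonneg.
    have H2 : Y (- T) <= Y (- S).
      apply: (prim_ge0 Yy); first lra.
      by move=> x _; nonneg.
    have := prim_le (primZ (1 - 2 * (S * i)) Ee) Yy SS.
    rewrite -mulrBr => H3; apply: le_trans (H3 _) _; last by lra.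
    move=> x xS; apply: ler_wpM2r => //.
    have x2 : x ^+ 2 <= S ^+ 2.
      by rewrite -(real_normK (num_real x)) lerXn2r ?nnegrE ?normr_ge0 ?ler_norml//; lra.
    have I2 : i ^+ 2 * x ^+ 2 <= S * i.
      apply: le_trans (ler_wpM2l (sqr_ge0 i) x2) _.
      by rewrite -exprMn (mulrC i S) expr2 ler_piMr//; nonneg; lra.
    by have := sqr_ge0 (i ^+ 2 * x ^+ 2); rewrite /y; lra.
  have C : 0 <= 1 - 2 * i.
    by rewrite subr_ge0 -ler_pdivlMl// mulr1 lef_pV2 ?posrE; lra.
  have := ler_wpM2l C YX; rewrite -/i.
  have : 0 <= (4 * (i * (S * i))) * X by nonneg; lra.
  lra.
apply/ler_addgt0Pr => /= d d0.
(* The errors add up to less than [L / T]; taking [T >= L / d] brings them below [d]. *)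
pose L := 2 * A + (2 + 2 * S) * X + 1.
have SX : 0 <= S * X by nonneg; lra.
have L1 : 1 <= L by rewrite /L; lra.
pose T := S + 2 + L / d.
have Ld : 0 < L / d by rewrite divr_gt0//; lra.
have T0 : 0 < T by rewrite /T; lra.
have TL : T^-1 * L <= d.
  by rewrite ler_pdivrMl// -ler_pdivrMr// /T; lra.
have ST : S <= T by rewrite /T; lra.
have T2 : 2 <= T by rewrite /T; lra.
have := main T ST T2; move: TL; rewrite /L.
have T0' : 0 < T^-1 by rewrite invr_gt0.
rewrite -/X; lra.
Qed.

(* The real part of the equation is tested against [(1 - x^2 / T^2)^2 x^2 u]. *)
Lemma regularity (p A B : R) q g1 g2 a a1 b b1 M :
  system p q g1 g2 a a1 b b1 -> 0 <= p ->
  mass_le a b A -> mass_le g1 g2 B ->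
  prim M (fun x => x ^+ 4 * (a x ^+ 2 + b x ^+ 2)) ->
  growth_le M (16 * A + 2 * B).
Proof.
move=> [aa bb aa1 bb1] p0 [U Uu UA] [G Gg GB] Mm.
have ca := prim_continuous aa; have cb := prim_continuous bb.
have ca1 := prim_continuous aa1; have cb1 := prim_continuous bb1.
have x4 (x : R) : 0 <= x ^+ 4 by rewrite (exprM x 2 2) sqr_ge0.
have m0 x : 0 <= x ^+ 4 * (a x ^+ 2 + b x ^+ 2).
  by apply: mulr_ge0 => //; nonneg.
apply: (growth_le_sym Mm m0) => S S1.
(* A fixed ratio is enough, as the constant may be lossy here: on [[- S, S]] the weight is at least
   [(3 / 4)^2 >= 1 / 2]. *)
pose T := 2 * S; have T0 : 0 < T by rewrite /T; lra.
pose i := T^-1; have i0 : 0 < i by rewrite invr_gt0.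
pose y (x : R) := 1 - i ^+ 2 * x ^+ 2.
have [Y Yy] : exists Y, prim Y (fun x => y x ^+ 2 * (x ^+ 4 * (a x ^+ 2 + b x ^+ 2))).
  by apply: continuous_prim; rewrite /y; cont.
have PF := primM (primM (prim_cutoff (i ^+ 2)) (primM (@prim_id R) (@prim_id R)))
  (primD (primM aa aa1) (primM bb bb1)).
have PR := primD PF (primD (primZ 4 Uu) (primZ 2^-1 Gg)).
have TT : - T <= T by lra.
have := prim_le (primZ 2^-1 Yy) PR TT.
have -> : 1 - i ^+ 2 * T ^+ 2 = 0 by rewrite -exprMn mulVf ?gt_eqF// expr1n subrr.
have -> : 1 - i ^+ 2 * (- T) ^+ 2 = 0.
  by rewrite sqrrN -exprMn mulVf ?gt_eqF// expr1n subrr.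
rewrite !expr0n /= !mul0r !add0r => H.
have {}H : 2^-1 * (Y T - Y (- T)) <= 4 * A + 2^-1 * B.
  rewrite mulrBr; apply: le_trans (H _) _; last first.
    by have := UA _ _ TT; have := GB _ _ TT; lra.
  move=> x xT; have [_ yI] := cutoff_range T0 xT.
  exact: regularity_pointwise.
have SS : - S <= S by lra.
have H1 : Y S <= Y T.
  by apply: (prim_ge0 Yy) => [|x _]; [rewrite /T; lra|apply: mulr_ge0 => //; nonneg].
have H2 : Y (- T) <= Y (- S).
  by apply: (prim_ge0 Yy) => [|x _]; [rewrite /T; lra|apply: mulr_ge0 => //; nonneg].
have H3 : 2^-1 * M S - 2^-1 * M (- S) <= Y S - Y (- S).
  apply: (prim_le (primZ 2^-1 Mm) Yy SS) => x xS; apply: ler_wpM2r => //.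
  have x2 : x ^+ 2 <= S ^+ 2.
    by rewrite -(real_normK (num_real x)) lerXn2r ?nnegrE ?normr_ge0 ?ler_norml//; lra.
  have I2 : i ^+ 2 * x ^+ 2 <= 2^-1 ^+ 2.
    apply: le_trans (ler_wpM2l (sqr_ge0 i) x2) _.
    rewrite -exprMn (_ : i * S = 2^-1)// /i /T invfM mulfVK//; last by rewrite gt_eqF//; lra.
  rewrite /y; set I := i ^+ 2 * x ^+ 2 in I2 *.
  have I0 : 0 <= I by rewrite /I; nonneg.
  have : 0 <= (3 / 4 - I + (1 - I)) * (1/4 - I) by apply: mulr_ge0; lra.
  lra.
lra.
Qed.
End Energy2.

(** * Oscillation of f *)

Section Oscillation.
Context {R : realType}.
Implicit Types f : R -> R.

(** [c] is the centre and [l] the half-length of a subinterval of [[s, t]]. Since [eta] and [l] are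
    fixed before [m], taking [m = lam * eps] gives bounds uniform in the spectral parameter. *)
Definition oscillates f (eta l s t : R) := forall m : R, exists c : R,
  [/\ s <= c - l, c + l <= t &
   (forall x, c - l <= x <= c + l -> eta <= f x - m) \/
   (forall x, c - l <= x <= c + l -> eta <= m - f x)].

Lemma oscillates_le f (eta eta' l l' s t s' t' : R) :
  eta' <= eta -> l' <= l -> s' <= s -> t <= t' ->
  oscillates f eta l s t -> oscillates f eta' l' s' t'.
Proof.
move=> ee ll ss tt osc m; have [c [sc ct H]] := osc m.
exists c; split; [lra|lra|].
by case: H => H; [left|right] => x xc; apply: le_trans ee _; apply: H; lra.
Qed.

(** Near [y] the function takes two distinct values [f y] and [f z]; any [m] is at distance at least
    half of their gap from one of them. With [eta] a quarter of the gap, continuity leaves [eta] on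
    a neighbourhood of that point. *)
Lemma oscillates_local f (y d : R) : continuous f ->
  (forall m, (f @^-1` [set m])° = set0) -> 0 < d ->
  exists eta l : R, [/\ 0 < eta, 0 < l & oscillates f eta l (y - d) (y + d)].
Proof.
move=> cf f0 d0.
have [z yz fz] : exists2 z, `|y - z| < d & f z != f y.
  apply: contrapT => H; have : (f @^-1` [set f y])° y.
    exists d => //= z /= yz; apply: contrapT => fz; apply: H.
    by exists z => //; apply/eqP.
  by rewrite f0.
pose eta := `|f z - f y| / 4.
have eta0 : 0 < eta by rewrite divr_gt0// normr_gt0 subr_eq0.
have [dy dy0 Hy] := continuous_eps (cf y) eta0.
have [dz dz0 Hz] := continuous_eps (cf z) eta0.
pose e := d - `|y - z|; have e0 : 0 < e by rewrite subr_gt0.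
pose l := Num.min (Num.min dy dz) e / 2.
have l0 : 0 < l by rewrite divr_gt0// !lt_min dy0 dz0.
have ly : l < dy by rewrite /l; case: (leP dy dz) => ?; case: (leP _ e); lra.
have lz : l < dz by rewrite /l; case: (leP dy dz) => ?; case: (leP _ e); lra.
have le : l < e by rewrite /l; case: (leP dy dz) => ?; case: (leP _ e); lra.
exists eta, l; split=> // m.
have near w dw : l < dw -> (forall x, `|w - x| < dw -> `|f w - f x| < eta) ->
    2 * eta <= `|f w - m| ->
    (forall x, w - l <= x <= w + l -> eta <= f x - m) \/
    (forall x, w - l <= x <= w + l -> eta <= m - f x).
  move=> lw Hw; rewrite ler_normr => /orP[fw|fw]; [left|right] => x xw;
  have : `|f w - f x| < eta by apply: Hw; rewrite ltr_norml; lra.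
    by rewrite ltr_norml; lra.
  by rewrite ltr_norml; lra.
have [Hm|Hm] : 2 * eta <= `|f y - m| \/ 2 * eta <= `|f z - m|.
  have : `|f z - f y| <= `|f z - m| + `|f y - m|.
    by rewrite (distrC (f y) m) (le_trans _ (ler_normD _ _))// addrA subrK.
  have : `|f z - f y| = 4 * eta by rewrite /eta; field.
  by case: (leP (2 * eta) `|f y - m|); [left|right; lra].
- by exists y; split; [rewrite /e in le; have := normr_ge0 (y - z); lra..|exact: near Hy Hm].
- have := ler_norm (y - z); have := ler_norm (z - y); rewrite distrC /e in le *.
  by exists z; split; [lra..|exact: near Hz Hm].
Qed.

Lemma oscillates_uniform f (r d : R) : continuous f ->
  (forall m, (f @^-1` [set m])° = set0) -> 0 < r -> 0 < d ->
  exists eta l : R, [/\ 0 < eta, 0 < l &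
    forall x, - r <= x <= r -> oscillates f eta l (x - d) (x + d)].
Proof.
move=> cf f0 r0 d0; have : - r <= r by lra.
apply: (local_to_global (P := fun s t => exists eta l : R, [/\ 0 < eta, 0 < l &
    forall x, s <= x <= t -> oscillates f eta l (x - d) (x + d)])) => [s m t sm mt|x].
  move=> [e1 [l1 [e10 l10 H1]]] [e2 [l2 [e20 l20 H2]]].
  exists (Num.min e1 e2), (Num.min l1 l2); split; rewrite ?lt_min ?e10 ?l10// => x.
  move=> /andP[sx xt]; have [xm|mx] := leP x m.
    by apply: oscillates_le (H1 x _); rewrite ?ge_min ?lexx ?sx.
  by apply: oscillates_le (H2 x _); rewrite ?ge_min ?lexx ?orbT ?(ltW mx).
(* The constants found at [x] with radius [d / 2] serve all centres within [d / 2] of [x], whose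
   windows of radius [d] contain that smaller window. *)
have d2 : 0 < d / 2 by rewrite divr_gt0.
have [eta [l [eta0 l0 H]]] := oscillates_local x cf f0 d2.
exists (d / 2) => // s t xs st tx; exists eta, l; split=> // y yst.
by apply: oscillates_le H => //; lra.
Qed.

End Oscillation.

(** * Least mass, coercivity and the bump weight *)

Section Apriori.
Context {R : realType}.
Implicit Types (f q a b g U V : R -> R) (A B M p : R).

Lemma mass_leW a b A B : A <= B -> mass_le a b A -> mass_le a b B.
Proof.
by move=> AB [U Uu UA]; exists U => // s t /UA /le_trans; apply.
Qed.

Lemma prim_increment U V u s t : prim U u -> prim V u -> s <= t ->
  U t - U s = V t - V s.
Proof. by move=> Uu Vu st; rewrite -Uu.2// -Vu.2. Qed.

Lemma mass_le_prim a b A U : prim U (fun x => a x ^+ 2 + b x ^+ 2) ->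
  mass_le a b A -> growth_le U A.
Proof.
by move=> Uu [V Vv VA] s t st; rewrite (prim_increment Uu Vv st); exact: VA.
Qed.

(** The least bound is the squared norm itself, as the supremum of the increments. It allows
    absorption: the mass can be moved from one side of an inequality to the other. *)
Lemma mass_least a b A : mass_le a b A ->
  exists2 A0, mass_le a b A0 & forall B, mass_le a b B -> A0 <= B.
Proof.
move=> [U Uu UA].
pose D := [set U z.2 - U z.1 | z in [set z : R * R | z.1 <= z.2]].
have hD : has_sup D.
  split; first by exists (U 0 - U 0), (0, 0) => //=.
  by exists A => _ [[s t] /= st <-]; exact: UA.
exists (sup D).
  exists U => // s t st; apply: ub_le_sup; first by case: hD.
  by exists (s, t).
move=> B /(mass_le_prim Uu) UB; apply: ge_sup; first by case: hD.
by move=> _ [[s t] /= st <-]; exact: UB.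
Qed.

Lemma system_energy p q g1 g2 a a1 b b1 : system p q g1 g2 a a1 b b1 ->
  exists E, prim E (fun x => a1 x ^+ 2 + b1 x ^+ 2 +
                   (x ^+ 2 + p) * (a x ^+ 2 + b x ^+ 2)).
Proof.
move=> [aa bb aa1 bb1]; apply: continuous_prim.
have ca := prim_continuous aa; have cb := prim_continuous bb.
have ca1 := prim_continuous aa1; have cb1 := prim_continuous bb1.
cont.
Qed.

(** With [p = 1] and [th = 1] the energy estimate reads [A0 <= (A0 + B) / 2] for the least mass
    [A0]. The constant does not depend on [q], because the [q] terms drop out of the real part. *)
Lemma coercivity q g1 g2 a a1 b b1 A B : system 1 q g1 g2 a a1 b b1 ->
  mass_le a b A -> mass_le g1 g2 B -> mass_le a b B.
Proof.
move=> sys /mass_least[A0 mA0 A0min] mB.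
have [E Ee] := system_energy sys.
have EK := energy_le sys ler01 ltr01 mA0 mB Ee.
suff : A0 <= B by move=> /mass_leW; exact.
suff : A0 <= 2^-1 * (1 * B + 1^-1 * A0) by lra.
apply: A0min; have [U Uu _] := mA0; exists U => // s t st.
apply: le_trans (EK s t st); apply: (prim_le Uu Ee st) => x _.
have : 0 <= a1 x ^+ 2 + b1 x ^+ 2 + x ^+ 2 * (a x ^+ 2 + b x ^+ 2) by nonneg.
lra.
Qed.

Lemma energy_derivative p q g1 g2 a a1 b b1 A B : system p q g1 g2 a a1 b b1 ->
  0 <= p -> mass_le a b A -> mass_le g1 g2 B -> mass_le a1 b1 (A + B).
Proof.
move=> sys p0 mA mB; have [E Ee] := system_energy sys.
have EK := energy_le sys p0 ltr01 mA mB Ee.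
have [_ _ aa1 bb1] := sys.
have ca1 := prim_continuous aa1; have cb1 := prim_continuous bb1.
have [V Vv] : exists V, prim V (fun x => a1 x ^+ 2 + b1 x ^+ 2).
  by apply: continuous_prim; cont.
have A0 : 0 <= A by have [U _ /growth_le_ge0] := mA.
have B0 : 0 <= B by have [U _ /growth_le_ge0] := mB.
exists V => // s t st; apply: le_trans (prim_le Vv Ee st _) (le_trans (EK s t st) _).
  by move=> x _; rewrite lerDl; nonneg.
by rewrite invr1; lra.
Qed.

(** Its increment over [[c - l, c + l]], namely [16 / 15 l^5], is the weight of the bump in the
    resolvent estimate. *)
Lemma prim_cubic_bump (c l : R) :
  prim (fun x : R => l ^+ 4 * (x - c) - 2 / 3 * l ^+ 2 * (x - c) ^+ 3 + (x - c) ^+ 5 / 5)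
       (fun x => (l ^+ 2 - (x - c) ^+ 2) ^+ 2).
Proof.
have S := primB (@prim_id R) (prim_cst c).
have S2 := primM S S; have S3 := primM S2 S; have S5 := primM S2 S3.
have := primD (primB (primZ (l ^+ 4) S) (primZ (2 / 3 * l ^+ 2) S3)) (primZ 5^-1 S5).
by apply: eq_prim => x; field.
Qed.

Lemma prim_bump (c l : R) :
  prim (fun x : R => (l ^+ 2 - (x - c) ^+ 2) ^+ 2)
       (fun x => - (4 * (x - c) * (l ^+ 2 - (x - c) ^+ 2))).
Proof.
have S := primB (@prim_id R) (prim_cst c).
have S2 := primB (prim_cst (l ^+ 2)) (primM S S).
by apply: eq_prim (primM S2 S2) => x; ring.
Qed.

(** The imaginary part of the equation: the bracket multiplied by [sg] is the derivative of
    [y^2 (b1 a - a1 b)] with [s = x - c] and [y = l^2 - s^2]. On the support [|s y| <= l^3] and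
    [y^2 <= l^4], and the products are split by [2 |u v| <= u^2 + v^2]. [sg] will be the sign of [q]
    there. *)
Lemma bump_pointwise (s l a a1 b b1 g1 g2 q k sg : R) :
  sg ^+ 2 = 1 -> 0 <= l -> - l <= s <= l -> k <= sg * q * (a ^+ 2 + b ^+ 2) ->
  k * (l ^+ 2 - s ^+ 2) ^+ 2 <=
  sg * (- (4 * s * (l ^+ 2 - s ^+ 2)) * (b1 * a - a1 * b) +
    (l ^+ 2 - s ^+ 2) ^+ 2 * (q * (a ^+ 2 + b ^+ 2) - g2 * a + g1 * b)) +
  (2 * l ^+ 3 * (a1 ^+ 2 + b1 ^+ 2 + (a ^+ 2 + b ^+ 2)) +
   2^-1 * l ^+ 4 * (g1 ^+ 2 + g2 ^+ 2 + (a ^+ 2 + b ^+ 2))).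
Proof.
move=> sg2 l0 sl kq; set y := l ^+ 2 - s ^+ 2.
have sl1 : s ^+ 2 <= l ^+ 2.
  by rewrite -(real_normK (num_real s)) lerXn2r ?nnegrE ?normr_ge0 ?ler_norml.
have y0 : 0 <= y by rewrite /y; lra.
have yl : y <= l ^+ 2 by rewrite /y; have := sqr_ge0 s; lra.
have y2 : y ^+ 2 <= l ^+ 4 by rewrite (exprM l 2 2) lerXn2r ?nnegrE ?sqr_ge0.
have syl : `|sg * s * y| <= l ^+ 3.
  rewrite !normrM (ger0_norm y0) exprSr mulrC.
  have -> : `|sg| = 1 by apply/eqP; rewrite -(@eqrXn2 _ 2)// expr1n real_normK ?num_real// sg2.
  by rewrite mul1r ler_pM ?normr_ge0// ler_norml.
have m1 : `|b1 * a - a1 * b| <= 2^-1 * (a1 ^+ 2 + b1 ^+ 2 + (a ^+ 2 + b ^+ 2)).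
  rewrite ler_norml; have := sqr_ge0 (b1 - a); have := sqr_ge0 (b1 + a).
  by have := sqr_ge0 (a1 - b); have := sqr_ge0 (a1 + b); lra.
have m2 : `|g1 * b - g2 * a| <= 2^-1 * (g1 ^+ 2 + g2 ^+ 2 + (a ^+ 2 + b ^+ 2)).
  rewrite ler_norml; have := sqr_ge0 (g1 - b); have := sqr_ge0 (g1 + b).
  by have := sqr_ge0 (g2 - a); have := sqr_ge0 (g2 + a); lra.
have H1 : 4 * (sg * s * y) * (b1 * a - a1 * b) <=
    4 * (l ^+ 3 * (2^-1 * (a1 ^+ 2 + b1 ^+ 2 + (a ^+ 2 + b ^+ 2)))).
  rewrite -mulrA ler_wpM2l//; apply: le_trans (ler_norm _) _.
  by rewrite normrM ler_pM ?normr_ge0.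
have H2 : - (sg * y ^+ 2 * (g1 * b - g2 * a)) <=
    l ^+ 4 * (2^-1 * (g1 ^+ 2 + g2 ^+ 2 + (a ^+ 2 + b ^+ 2))).
  apply: le_trans (ler_norm _) _; rewrite normrN normrM.
  rewrite ler_pM ?normr_ge0// normrM (ger0_norm (sqr_ge0 y)).
  have -> : `|sg| = 1 by apply/eqP; rewrite -(@eqrXn2 _ 2)// expr1n real_normK ?num_real// sg2.
  by rewrite mul1r.
have H3 := ler_wpM2r (sqr_ge0 y) kq.
lra.
Qed.

End Apriori.

(** * The resolvent estimate *)

Section Concentration.
Context {R : realType}.
Implicit Types (f q a b g U V : R -> R) (A B M p : R).

Lemma prim_cst_bound U u (k s t : R) : prim U u -> s <= t ->
  (forall x, s <= x <= t -> u x <= k) -> U t - U s <= k * (t - s).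
Proof.
move=> Uu st uk; rewrite mulrBr.
by apply: (prim_le Uu (primZ k (@prim_id R)) st) => x /uk; rewrite mulr1.
Qed.

(** Otherwise the mass in [[- 2 M, 2 M]], of length [4 M], is at most [A / 2]. Outside,
    [x^2 >= 4 M^2 >= 4 M], so the energy bound [M A] leaves at most [A / 4]. The total [3 / 4 A]
    contradicts the minimality of [A]. *)
Lemma concentration_point p a a1 b b1 A M E U :
  0 <= p -> 1 <= M -> 0 < A ->
  prim E (fun x => a1 x ^+ 2 + b1 x ^+ 2 +
                   (x ^+ 2 + p) * (a x ^+ 2 + b x ^+ 2)) ->
  growth_le E (M * A) ->
  prim U (fun x => a x ^+ 2 + b x ^+ 2) ->
  (forall B, growth_le U B -> A <= B) ->
  exists2 x, - (2 * M) <= x <= 2 * M & A / (8 * M) <= a x ^+ 2 + b x ^+ 2.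
Proof.
move=> p0 M1 A0 Ee EA Uu Amin; apply: contrapT => noX.
pose r := 2 * M; have r0 : 0 < r by rewrite /r; lra.
have r2 : 4 * M <= r ^+ 2 by rewrite /r expr2; nra.
have small x : - r <= x <= r -> a x ^+ 2 + b x ^+ 2 <= A / (8 * M).
  by move=> xr; rewrite leNgt; apply/negP => H; apply: noX; exists x => //; exact: ltW.
have rr : - r <= r by lra.
have H1 : U r - U (- r) <= A / 2.
  apply: le_trans (prim_cst_bound Uu rr small) _.
  by rewrite le_eqVlt; apply/orP; left; apply/eqP; rewrite /r; field; lra.
suff /Amin : growth_le U (3 / 4 * A) by lra.
have U0 x : 0 <= a x ^+ 2 + b x ^+ 2 by nonneg.
have E0 x : 0 <= a1 x ^+ 2 + b1 x ^+ 2 + (x ^+ 2 + p) * (a x ^+ 2 + b x ^+ 2).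
  by nonneg.
apply: (growth_le_sym Uu) => // S S1.
have out s t : s <= t -> (forall x, s <= x <= t -> r ^+ 2 <= x ^+ 2) ->
    4 * M * (U t - U s) <= E t - E s.
  move=> st sx; rewrite mulrBr; apply: (prim_le (primZ (4 * M) Uu) Ee st) => x /sx rx.
  have : 0 <= (x ^+ 2 - 4 * M) * (a x ^+ 2 + b x ^+ 2).
    by apply: mulr_ge0 => //; lra.
  have : 0 <= a1 x ^+ 2 + b1 x ^+ 2 + p * (a x ^+ 2 + b x ^+ 2) by nonneg.
  lra.
have [Sr|rS] := leP S r.
  have : U S <= U r by apply: (prim_ge0 Uu).
  have : U (- r) <= U (- S) by apply: (prim_ge0 Uu) => //; lra.
  lra.
have O1 : 4 * M * (U S - U r) <= E S - E r.
  apply: out => [|x /andP[rx _]]; first lra.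
  by rewrite lerXn2r ?nnegrE; lra.
have O2 : 4 * M * (U (- r) - U (- S)) <= E (- r) - E (- S).
  apply: out => [|x /andP[_ rx]]; first lra.
  by rewrite -(sqrrN x) lerXn2r ?nnegrE; lra.
have E1 : E (- r) <= E r by apply: (prim_ge0 Ee).
have E2 : E S - E (- S) <= M * A by apply: EA; lra.
have : 4 * M * (U S - U r + (U (- r) - U (- S))) <= M * A by lra.
have -> : 4 * M * (U S - U r + (U (- r) - U (- S))) =
  M * (4 * (U S - U r + (U (- r) - U (- S)))) by ring.
rewrite ler_pM2l; lra.
Qed.

(** By Cauchy-Schwarz [|u(x) - u(y)|^2 <= |x - y| M A], which is at most [A / (32 M)] at this range,
    while [|u(x)|^2] is at least four times as large: [u] keeps at least half of its modulus. *)
Lemma concentration_interval a a1 b b1 A M E p x y :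
  prim a a1 -> prim b b1 -> 0 <= p -> 1 <= M -> 0 < A ->
  prim E (fun x => a1 x ^+ 2 + b1 x ^+ 2 +
                   (x ^+ 2 + p) * (a x ^+ 2 + b x ^+ 2)) ->
  growth_le E (M * A) -> continuous a1 -> continuous b1 ->
  A / (8 * M) <= a x ^+ 2 + b x ^+ 2 ->
  x - (32 * M ^+ 2)^-1 <= y <= x + (32 * M ^+ 2)^-1 ->
  A / (32 * M) <= a y ^+ 2 + b y ^+ 2.
Proof.
move=> aa bb p0 M1 A0 Ee EA ca1 cb1 Hx xy.
have [V Vv] : exists V, prim V (fun x => a1 x ^+ 2) by apply: continuous_prim; cont.
have [W Ww] : exists V, prim V (fun x => b1 x ^+ 2) by apply: continuous_prim; cont.
have key s t : s <= t -> t - s <= (32 * M ^+ 2)^-1 ->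
    (a t - a s) ^+ 2 + (b t - b s) ^+ 2 <= A / (32 * M).
  move=> st ts.
  apply: le_trans (lerD (prim_cauchy_schwarz aa Vv st) (prim_cauchy_schwarz bb Ww st)) _.
  rewrite -mulrDr.
  have VE : V t - V s + (W t - W s) <= M * A.
    apply: le_trans (EA s t st).
    rewrite addrACA -opprD; apply: (prim_le (primD Vv Ww) Ee st) => z _.
    by rewrite lerDl; nonneg.
  have VW0 : 0 <= V t - V s + (W t - W s).
    have := prim_ge0 Vv st; have := prim_ge0 Ww st.
    by move=> H1 H2; rewrite addr_ge0 ?subr_ge0 ?H1 ?H2// => z _; nonneg.
  have -> : A / (32 * M) = (32 * M ^+ 2)^-1 * (M * A) by field; lra.
  by rewrite ler_pM// subr_ge0.
have {key} : (a x - a y) ^+ 2 + (b x - b y) ^+ 2 <= A / (32 * M).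
  have [yx|yx] := leP y x; first by apply: key => //; lra.
  rewrite -(sqrrN (a x - a y)) -(sqrrN (b x - b y)) !opprB.
  by apply: key; lra.
have E1 : A / (8 * M) = 4 * (A / (32 * M)) by field; lra.
rewrite E1 in Hx.
have := sqr_ge0 (2 * a y - a x); have := sqr_ge0 (2 * b y - b x).
lra.
Qed.

(* If [|g| < M |u|], then the energy bound makes [|u|^2] bounded below on an
   interval of fixed length, hence on one of the finitely many intervals where
   [f - eps lam] keeps its sign and stays away from zero.  Testing the imaginary
   part of the equation there against a bump bounds [eps] from below. *)
Lemma resolvent_estimate f M : continuous f ->
  (forall m, (f @^-1` [set m])° = set0) -> 1 <= M ->
  exists2 eps0 : R, 0 < eps0 & forall eps lam p g1 g2 a a1 b b1 A B,
    0 < eps -> eps < eps0 -> 0 <= p ->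
    system p (fun x => f x / eps - lam) g1 g2 a a1 b b1 ->
    mass_le a b A -> mass_le g1 g2 B -> mass_le a b (B / M ^+ 2).
Proof.
move=> cf f0 M1.
have d0 : 0 < (32 * M ^+ 2)^-1 by rewrite invr_gt0; nra.
have r0 : 0 < 2 * M by lra.
have [eta [l [eta0 l0 osc]]] := oscillates_uniform cf f0 r0 d0.
(* [A * Z] will bound the error terms of [bump_pointwise]: the energy contributes at most [M A], the
   mass [A] and the data [A M^2]. *)
pose Z := 2 * l ^+ 3 * (M + 1) + 2^-1 * l ^+ 4 * (M ^+ 2 + 1).
have Z0 : 0 < Z.
  rewrite /Z; have l3 : 0 < l ^+ 3 by rewrite exprn_gt0.
  have l4 : 0 < l ^+ 4 by rewrite exprn_gt0.
  by have := sqr_ge0 M => M2; rewrite addr_gt0// !mulr_gt0//; lra.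
(* Below this threshold the main term [A eta l^5 / (30 M eps)] exceeds [A Z]; the 30 is
   [32 * 15 / 16]. *)
exists (eta * l ^+ 5 / (30 * M * Z)); first by rewrite divr_gt0 ?mulr_gt0 ?exprn_gt0//; lra.
move=> eps lam p g1 g2 a a1 b b1 A' B e0 ee0 p0 sys /mass_least[A mA Amin] mB.
suff : A <= B / M ^+ 2 by move=> /mass_leW; exact.
have M2 : 0 < M ^+ 2 by rewrite exprn_gt0//; lra.
rewrite ler_pdivlMr// leNgt; apply/negP => BA.
have B0 : 0 <= B by have [? _ /growth_le_ge0] := mB.
have A0 : 0 < A by rewrite -(pmulr_lgt0 _ M2); lra.
have [E Ee] := system_energy sys.
have M0 : 0 < M by lra.
have Mi0 : 0 < M^-1 by rewrite invr_gt0.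
(* The Young parameter [M^-1] balances both terms: [B / M] is below [M A] as [B < A M^2]. *)
have EA : growth_le E (M * A).
  move=> s t st; apply: le_trans (energy_le sys p0 Mi0 mA mB Ee st) _.
  rewrite invrK.
  have : M^-1 * B <= M^-1 * (A * M ^+ 2) by rewrite ler_wpM2l ?ltW.
  have -> : M^-1 * (A * M ^+ 2) = M * A by field; lra.
  lra.
have [U Uu UA] := mA.
have Umin C : growth_le U C -> A <= C by move=> UC; apply: Amin; exists U.
have [x0 x0M Hx0] := concentration_point p0 M1 A0 Ee EA Uu Umin.
have [aa bb aa1 bb1] := sys.
have ca1 := prim_continuous aa1; have cb1 := prim_continuous bb1.
have conc := concentration_interval aa bb p0 M1 A0 Ee EA ca1 cb1 Hx0.
have [c [c1 c2 Hc]] := osc x0 x0M (lam * eps).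
have [sg [sg2 Hsg]] : exists sg : R, sg ^+ 2 = 1 /\ forall x, c - l <= x <= c + l ->
    eta <= sg * (f x - lam * eps).
  case: Hc => Hc; [exists 1|exists (-1)]; (split; first by ring) => x /Hc; lra.
pose k := eta / eps * (A / (32 * M)).
have kq x : c - l <= x <= c + l ->
    k <= sg * (f x / eps - lam) * (a x ^+ 2 + b x ^+ 2).
  move=> xc.
  have -> : sg * (f x / eps - lam) = sg * (f x - lam * eps) / eps by field; lra.
  rewrite /k; apply: ler_pM.
  - by rewrite divr_ge0// ltW.
  - by rewrite divr_ge0 ?ltW// mulr_gt0.
  - by rewrite ler_pM2r ?invr_gt0//; exact: Hsg.
  - by apply: conc; lra.
have [G Gg GB] := mB.
have PF := primM (prim_bump c l) (primB (primM bb1 aa) (primM aa1 bb)).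
have PR := primD (primZ sg PF) (primD (primZ (2 * l ^+ 3) (primD Ee Uu))
   (primZ (2^-1 * l ^+ 4) (primD Gg Uu))).
have cc : c - l <= c + l by lra.
have := prim_le (primZ k (prim_cubic_bump c l)) PR cc.
rewrite (_ : c + l - c = l); last by ring.
rewrite (_ : c - l - c = - l); last by ring.
rewrite sqrrN subrr expr0n /= !mul0r mulr0 !add0r => H.
have l3 : 0 < l ^+ 3 by rewrite exprn_gt0.
have l4 : 0 < l ^+ 4 by rewrite exprn_gt0.
have : k * (16 / 15 * l ^+ 5) <= A * Z.
  apply: le_trans (le_trans (H _) _).
  - by rewrite le_eqVlt; apply/orP; left; apply/eqP; field.
  - move=> x xc; rewrite -[x - c]/(x - c).
    have xcl : - l <= x - c <= l by lra.
    apply: le_trans (bump_pointwise (a1 x) (b1 x) (g1 x) (g2 x) sg2 (ltW l0) xcl (kq x xc)) _.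
    rewrite -subr_ge0 (_ : _ - _ = 2 * l ^+ 3 * ((x ^+ 2 + p) * (a x ^+ 2 + b x ^+ 2))).
      by nonneg.
    ring.
  - have H1 := EA _ _ cc; have H2 := UA _ _ cc; have H3 := GB _ _ cc.
    have K1 : 2 * l ^+ 3 * (E (c + l) - E (c - l) + (U (c + l) - U (c - l))) <=
       2 * l ^+ 3 * (M * A + A) by rewrite ler_pM2l; lra.
    have K2 : 2^-1 * l ^+ 4 * (G (c + l) - G (c - l) + (U (c + l) - U (c - l))) <=
       2^-1 * l ^+ 4 * (A * M ^+ 2 + A) by rewrite ler_pM2l; lra.
    by rewrite /Z; lra.
have -> : k * (16 / 15 * l ^+ 5) = A * (eta * l ^+ 5 / (30 * M * eps)).
  by rewrite /k; field; lra.
rewrite ler_pM2l// leNgt => /negP; apply.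
rewrite ltr_pdivlMr; last by rewrite !mulr_gt0.
have : eps * (30 * M * Z) < eta * l ^+ 5 by rewrite -ltr_pdivlMr// !mulr_gt0.
lra.
Qed.

End Concentration.

(** * The equation - u'' + (x^2 + 1) u = g *)

Section Base.
Context {R : realType}.
Implicit Types (f q a b g w U V Y : R -> R) (A B K : R).

(** It spans the kernel of the factor [d + x]; its inverse [antigauss] spans the kernel of
    [- d + x]. *)
Definition gauss (x : R) : R := expR (- (x ^+ 2 / 2)).
Definition antigauss (x : R) : R := expR (x ^+ 2 / 2).

Lemma gauss_antigauss x : antigauss x * gauss x = 1.
Proof. by rewrite /antigauss /gauss -expRD subrr expR0. Qed.

Lemma gauss_gt0 x : 0 < gauss x. Proof. exact: expR_gt0. Qed.
Lemma antigauss_gt0 x : 0 < antigauss x. Proof. exact: expR_gt0. Qed.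

Lemma gauss_le x y : 0 <= x -> x <= y -> gauss y <= gauss x.
Proof.
move=> x0 xy; rewrite ler_expR lerN2 ler_pM2r ?invr_gt0//.
by rewrite lerXn2r ?nnegrE//; lra.
Qed.

Lemma gaussN x : gauss (- x) = gauss x.
Proof. by rewrite /gauss sqrrN. Qed.

Lemma continuous_expR_comp U : continuous U -> continuous (fun x => expR (U x)).
Proof.
by move=> cU x; apply: (@continuous_comp _ _ _ U expR); [exact: cU|exact: continuous_expR].
Qed.

Lemma prim_gauss : prim gauss (fun x => - (x * gauss x)).
Proof.
apply: prim_derive; last first.
  by apply: continuousN_fun; apply: continuousM_fun; [cont|apply: continuous_expR_comp; cont].
move=> x; rewrite /gauss; apply: is_derive_eq.
by rewrite /GRing.scale /=; field.
Qed.

Lemma prim_antigauss : prim antigauss (fun x => x * antigauss x).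
Proof.
apply: prim_derive; last first.
  by apply: continuousM_fun; [cont|apply: continuous_expR_comp; cont].
move=> x; rewrite /antigauss; apply: is_derive_eq.
by rewrite /GRing.scale /=; field.
Qed.

(* The supremum is the limit of [Y] at infinity. *)
Lemma tail_limit Y K (e : R -> R) : 0 <= K -> (forall x, 0 <= e x) ->
  (forall x t, 1 <= x -> x <= t -> `|Y t - Y x| <= K * e x) ->
  exists L, forall x, 1 <= x -> `|L - Y x| <= K * e x.
Proof.
move=> K0 e0 H.
pose D := [set Y x - K * e x | x in [set x : R | 1 <= x]].
have ub t : 1 <= t -> ubound D (Y t + K * e t).
  move=> t1 _ [x /= x1 <-].
  have Kx : 0 <= K * e x by rewrite mulr_ge0.
  have Kt : 0 <= K * e t by rewrite mulr_ge0.
  have [xt|/ltW tx] := leP x t.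
    by have := H _ _ x1 xt; rewrite ler_norml; lra.
  by have := H _ _ t1 tx; rewrite ler_norml; lra.
have D1 : has_sup D.
  split; first by exists (Y 1 - K * e 1), 1 => /=.
  by exists (Y 1 + K * e 1); apply: ub.
exists (sup D) => x x1.
have : Y x - K * e x <= sup D by apply: ub_le_sup; [case: D1|exists x].
have : sup D <= Y x + K * e x by apply: ge_sup; [case: D1|exact: ub].
by rewrite ler_norml; lra.
Qed.

(** Young's inequality with parameter [gauss x] splits [gauss y * w y]; for [y >= 1] the square
    [gauss y ^+ 2] is at most [y * gauss y ^+ 2], an exact derivative up to a factor. The tail is
    thus of order [gauss x], just what a later multiplication by [antigauss] tolerates. *)
Lemma gauss_tail w W Y A x t : prim W (fun x => w x ^+ 2) -> growth_le W A ->
  prim Y (fun x => gauss x * w x) -> 1 <= x -> x <= t ->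
  `|Y t - Y x| <= 2^-1 * (2^-1 + A) * gauss x.
Proof.
move=> Ww WA Yy x1 xt.
have GG := primM prim_gauss prim_gauss.
have PR := primD (primZ (- (4^-1 * antigauss x)) GG) (primZ (2^-1 * gauss x) Ww).
apply: le_trans (prim_norm_le Yy PR xt _) _.
  move=> y /andP[xy yt].
  have := @weighted_young R (gauss x) (w y) (gauss y) (gauss_gt0 x).
  have -> : (gauss x)^-1 = antigauss x.
    by apply: (mulIf (lt0r_neq0 (gauss_gt0 x))); rewrite mulVf ?gauss_antigauss// gt_eqF// gauss_gt0.
  rewrite mulrC => /le_trans; apply.
  have : 0 <= (y - 1) * (antigauss x * gauss y ^+ 2).
    apply: mulr_ge0; first lra.
    by apply: mulr_ge0; [exact: ltW (antigauss_gt0 x)|exact: sqr_ge0].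
  lra.
have WA' := WA _ _ xt; have gx := gauss_gt0 x.
have : gauss x * (W t - W x) <= gauss x * A by rewrite ler_pM2l.
have : antigauss x * (gauss x * gauss x) = gauss x by rewrite mulrA gauss_antigauss mul1r.
have : 0 <= antigauss x * (gauss t * gauss t).
  apply: mulr_ge0; first exact: ltW (antigauss_gt0 x).
  by apply: mulr_ge0; exact: ltW (gauss_gt0 t).
lra.
Qed.

Lemma gauss_limits w W Y A : continuous w -> prim W (fun x => w x ^+ 2) ->
  growth_le W A -> prim Y (fun x => gauss x * w x) ->
  exists Lm Lp, forall x, 1 <= x ->
    `|Lp - Y x| <= 2^-1 * (2^-1 + A) * gauss x /\
    `|Lm - Y (- x)| <= 2^-1 * (2^-1 + A) * gauss x.
Proof.
move=> cw Ww WA Yy; have A0 := growth_le_ge0 WA.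
have K0 : 0 <= 2^-1 * (2^-1 + A) by lra.
have g0 x := ltW (gauss_gt0 x).
have [Lp HLp] := tail_limit K0 g0 (fun x t => gauss_tail Ww WA Yy (x:=x) (t:=t)).
have cgw : continuous (fun x => gauss x * w x).
  by apply: continuousM_fun => //; apply: prim_continuous prim_gauss.
have Yy' : prim (fun x => - Y (- x)) (fun x => gauss x * w (- x)).
  by apply: eq_prim (prim_opp cgw Yy) => // x; rewrite gaussN.
have Ww' : prim (fun x => - W (- x)) (fun x => w (- x) ^+ 2).
  by apply: prim_opp Ww; cont.
have WA' : growth_le (fun x => - W (- x)) A.
  by move=> s t st; rewrite opprK addrC; apply: WA; rewrite lerN2.
have [Lm HLm] := tail_limit K0 g0 (fun x t => gauss_tail Ww' WA' Yy' (x:=x) (t:=t)).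
exists (- Lm), Lp => x x1; split; first exact: HLp.
have -> : - Lm - Y (- x) = - (Lm - - Y (- x)) by ring.
by rewrite normrN; exact: HLm.
Qed.

(** From [w' + x w = g] follows [(x^2 - 1) w^2 = g^2 - (x w^2)' - (g - x w)^2], and the boundary
    terms of [x w^2] have the good sign. Outside [[- 2, 2]] the factor is at least 1; inside, the
    mass is some finite number, and only finiteness matters. *)
Lemma first_order_mass w W g G B : prim w (fun x => g x - x * w x) ->
  prim G (fun x => g x ^+ 2) -> growth_le G B ->
  prim W (fun x => w x ^+ 2) -> exists A, growth_le W A.
Proof.
move=> wP Gg GB Ww; have cw := prim_continuous wP.
exists (B + 2 * (W 2 - W (- 2))).
have w0 x : 0 <= w x ^+ 2 by exact: sqr_ge0.
have B0 := growth_le_ge0 GB.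
have mono s t : s <= t -> W s <= W t by move=> st; exact: (prim_ge0 Ww).
have W2 : W (- 2) <= W 2 by apply: mono; lra.
apply: (growth_le_sym Ww w0) => S S1.
have [S2|/ltW S2] := leP S 2.
  have := mono S 2 S2; have : W (- 2) <= W (- S) by apply: mono; lra.
  lra.
have [D Dd] : exists D, prim D (fun x => (x ^+ 2 - 1) * w x ^+ 2).
  by apply: continuous_prim; cont.
have SS : - S <= S by lra.
have PR := primB Gg (primM (@prim_id R) (primM wP wP)).
have := prim_le Dd PR SS => H.
have {}H : D S - D (- S) <= B.
  apply: le_trans (H _) _.
    by move=> x _; have := sqr_ge0 (g x - x * w x); lra.
  have := GB _ _ SS.
  have : 0 <= S * (w S * w S) by rewrite mulr_ge0 -?expr2 ?sqr_ge0//; lra.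
  have : 0 <= S * (w (- S) * w (- S)) by rewrite mulr_ge0 -?expr2 ?sqr_ge0//; lra.
  lra.
have out s t : s <= t -> (forall x, s <= x <= t -> 2 ^+ 2 <= x ^+ 2) ->
    W t - W s <= D t - D s.
  move=> st sx; apply: (prim_le Ww Dd st) => x /sx x2.
  by rewrite ler_peMl//; lra.
have O1 := out 2 S S2; have O2 := out (- S) (- 2).
have I1 : - (W 2 - W (- 2)) <= D 2 - D (- 2).
  rewrite opprD; apply: (prim_le (primN Ww) Dd); first lra.
  move=> x _; have : 0 <= x ^+ 2 * w x ^+ 2 by nonneg.
  lra.
have {}O1 : W S - W 2 <= D S - D 2.
  by apply: O1 => x /andP[x2 _]; rewrite lerXn2r ?nnegrE; lra.
have {}O2 : W (- 2) - W (- S) <= D (- 2) - D (- S).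
  apply: O2; first lra.
  by move=> x /andP[_ x2]; rewrite -(sqrrN x) lerXn2r ?nnegrE; lra.
lra.
Qed.

(** Adding [C * gauss] to [w] preserves the first-order equation and adds [C * Z] to [Y]. The limits
    of [Z] at both ends differ, so some [C] makes the two limits of [Y + C * Z] agree; otherwise
    [antigauss * (L - Y)] would blow up at one end. *)
Lemma gauss_limit_adjust w W Y A : continuous w -> prim W (fun x => w x ^+ 2) ->
  growth_le W A -> prim Y (fun x => gauss x * w x) ->
  exists C L K Z, [/\ prim Z (fun x => gauss x * gauss x), 0 <= K &
    forall x, 1 <= x -> `|L - (Y x + C * Z x)| <= K * gauss x /\
    `|L - (Y (- x) + C * Z (- x))| <= K * gauss x].
Proof.
move=> cw Ww WA Yy.
have cg : continuous gauss := prim_continuous prim_gauss.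
have [Z Zz] : exists Z, prim Z (fun x => gauss x * gauss x).
  by apply: continuous_prim; apply: continuousM_fun.
have Zz2 : prim Z (fun x => gauss x ^+ 2) by apply: eq_prim Zz.
have [D ZD] : exists D, growth_le Z D.
  apply: (@first_order_mass gauss Z (fun=> 0) (fun=> 0) 0) => //.
  - by apply: eq_prim prim_gauss => // x; rewrite sub0r.
  - by apply: eq_prim (prim_cst 0) => // x; rewrite expr0n.
have [Lm [Lp HL]] := gauss_limits cw Ww WA Yy.
have [Zm [Zp HZ]] := gauss_limits cg Zz2 ZD Zz.
set Kw := 2^-1 * (2^-1 + A) in HL; set Kz := 2^-1 * (2^-1 + D) in HZ.
have Kw0 : 0 <= Kw by have := growth_le_ge0 WA; rewrite /Kw; lra.
have Kz0 : 0 <= Kz by have := growth_le_ge0 ZD; rewrite /Kz; lra.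
have gg0 x : 0 <= gauss x * gauss x by apply: mulr_ge0; exact: ltW (gauss_gt0 x).
have Zlt : Zm < Zp.
  pose c := gauss 1 ^+ 2; have c0 : 0 < c by rewrite exprn_gt0// gauss_gt0.
  have Z01 : c <= Z 1 - Z 0.
    have := prim_le (primZ c (@prim_id R)) Zz2 (ler01 : 0 <= 1); rewrite mulr1 mulr0 subr0.
    apply=> x /andP[x0 x1]; rewrite lerXn2r ?nnegrE ?(ltW (gauss_gt0 _))//.
    exact: gauss_le.
  (* [t] is so large that the two tails, at most [Kz * gauss t] each, cannot make up for the gain
     [c] on [[0, 1]]; the only decay used is [t * gauss t <= 1]. *)
  pose t := 1 + 2 * Kz / c.
  have t1 : 1 <= t by rewrite lerDl; apply: divr_ge0; [apply: mulr_ge0|exact: ltW].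
  have gt : gauss t * t <= 1.
    rewrite -(gauss_antigauss t) mulrC ler_pM2r ?gauss_gt0//.
    apply: le_trans (expR_ge1Dx _); have := sqr_ge0 (t - 1); lra.
  have Kg : 2 * Kz * gauss t < c.
    have : c * (gauss t * t) <= c by rewrite ler_piMr// ltW.
    have -> : c * (gauss t * t) = c * gauss t + 2 * Kz * gauss t by rewrite /t; field; lra.
    have : 0 < c * gauss t by rewrite mulr_gt0// gauss_gt0.
    lra.
  have [H1 H2] := HZ t t1; move: H1 H2; rewrite !ler_norml.
  have : Z 1 <= Z t by apply: (prim_ge0 Zz).
  have : Z (- t) <= Z 0 by apply: (prim_ge0 Zz) => //; lra.
  lra.
pose C := (Lm - Lp) / (Zp - Zm).
exists C, (Lp + C * Zp), (Kw + `|C| * Kz), Z; split => //.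
  by rewrite addr_ge0// mulr_ge0.
have bound P Q y z k : `|P - y| <= Kw * k -> `|Q - z| <= Kz * k ->
    `|P + C * Q - (y + C * z)| <= (Kw + `|C| * Kz) * k.
  move=> HP HQ; have -> : P + C * Q - (y + C * z) = (P - y) + C * (Q - z) by ring.
  apply: le_trans (ler_normD _ _) _; rewrite normrM mulrDl lerD// -mulrA.
  by rewrite ler_wpM2l.
move=> x x1; have [H1 H2] := HL x x1; have [H3 H4] := HZ x x1.
split; first exact: bound.
have -> : Lp + C * Zp = Lm + C * Zm by rewrite /C; field; lra.
exact: bound.
Qed.

(* [- d^2 + x^2 + 1 = (d + x) (- d + x)]: the equation [w' + x w = g] is solved
   first, with the constant that makes [u = exp (x^2 / 2) (L - Y)], where
   [Y' = exp (- x^2 / 2) w], decay at both ends. *)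
Lemma base_solvable g G B : loc g -> prim G (fun x => g x ^+ 2) -> growth_le G B ->
  exists a a1 U A, [/\ prim a a1, prim a1 (fun x => (x ^+ 2 + 1) * a x - g x),
    prim U (fun x => a x ^+ 2) & growth_le U A].
Proof.
move=> lg Gg GB.
have [P Pp] : exists P, prim P (fun x => antigauss x * g x).
  by apply: loc_prim; apply: locM => //; exact: prim_continuous prim_antigauss.
have wC C : prim (fun x => gauss x * (C + P x))
                 (fun x => g x - x * (gauss x * (C + P x))).
  apply: eq_prim (primM prim_gauss (primD (prim_cst C) Pp)) => // x.
  have := gauss_antigauss x; rewrite mulrC => E.
  have -> : gauss x * (0 + antigauss x * g x) = (gauss x * antigauss x) * g x by ring.
  by rewrite E; ring.
have sq (v : R -> R) : continuous v -> exists V, prim V (fun x => v x ^+ 2).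
  by move=> cv; apply: continuous_prim; cont.
have cw C := prim_continuous (wC C).
have cg : continuous gauss := prim_continuous prim_gauss.
have [W0 Ww0] := sq _ (cw 0).
have [A0 WA0] := first_order_mass (wC 0) Gg GB Ww0.
have [Y Yy] : exists Y, prim Y (fun x => gauss x * (gauss x * (0 + P x))).
  by apply: continuous_prim; apply: continuousM_fun.
have [C [L [K [Z [Zz K0 HL]]]]] := gauss_limit_adjust (cw 0) Ww0 WA0 Yy.
pose w x := gauss x * (C + P x).
have [W Ww] := sq _ (cw C).
have [A WA] := first_order_mass (wC C) Gg GB Ww.
have YZ : prim (fun x => Y x + C * Z x) (fun x => gauss x * w x).
  by apply: eq_prim (primD Yy (primZ C Zz)) => // x; rewrite /w; ring.
pose u x := antigauss x * (L - (Y x + C * Z x)).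
have uP : prim u (fun x => x * u x - w x).
  apply: eq_prim (primM prim_antigauss (primB (prim_cst L) YZ)) => // x.
  have := gauss_antigauss x => E; rewrite /u.
  have -> : antigauss x * (0 - gauss x * w x) = - ((antigauss x * gauss x) * w x) by ring.
  by rewrite E; ring.
have [U Uu] := sq u (prim_continuous uP).
(* The decay of [L - (Y + C Z)] cancels the growth of [antigauss], hence [|u| <= K] at distance at
   least 1 from the origin. *)
have ub x : 1 <= x -> u x ^+ 2 <= K ^+ 2 /\ u (- x) ^+ 2 <= K ^+ 2.
  move=> /HL[H1 H2].
  have ub1 y : antigauss x * `|y| <= antigauss x * (K * gauss x) ->
      (antigauss x * y) ^+ 2 <= K ^+ 2.
    rewrite mulrCA gauss_antigauss mulr1 => H.
    rewrite -(real_normK (num_real (_ * y))) normrM (gtr0_norm (antigauss_gt0 x)).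
    by rewrite lerXn2r ?nnegrE// mulr_ge0// ltW// antigauss_gt0.
  split; rewrite /u.
    by apply: ub1; rewrite ler_pM2l// antigauss_gt0.
  rewrite (_ : antigauss (- x) = antigauss x); last by rewrite /antigauss sqrrN.
  by apply: ub1; rewrite ler_pM2l// antigauss_gt0.
have A0' := growth_le_ge0 WA.
exists u, (fun x => x * u x - w x), U, (2 * (K ^+ 2 + A) + (U 1 - U (- 1))); split => //.
  apply: eq_prim (primB (primM (@prim_id R) uP) (wC C)) => // x.
  by rewrite -/(w x); ring.
have u0 x : 0 <= u x ^+ 2 by exact: sqr_ge0.
apply: (growth_le_sym Uu u0) => S S1.
have uu := primM uP uP.
(* For [x >= 1] one has [(u^2)' + w^2 = (u - w)^2 + (2 x - 1) u^2 >= u^2], so the mass of [u] is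
   controlled by its boundary values and the mass of [w]. *)
have R1 : U S - U 1 <= K ^+ 2 + A.
  have := prim_le Uu (primD uu Ww) S1 => H; apply: le_trans (H _) _.
    move=> x /andP[x1 _]; have := sqr_ge0 (u x - w x).
    have : 0 <= (x - 1) * u x ^+ 2 by rewrite mulr_ge0//; lra.
    by rewrite -/(w x); lra.
  have := WA _ _ S1; have [Hu _] := ub S S1; have := sqr_ge0 (u 1); lra.
have mS : - S <= - 1 by lra.
have R2 : U (- 1) - U (- S) <= K ^+ 2 + A.
  have := prim_le Uu (primB Ww uu) mS => H; apply: le_trans (H _) _.
    move=> x /andP[_ x1]; have := sqr_ge0 (u x + w x).
    have : 0 <= (- 1 - x) * u x ^+ 2 by rewrite mulr_ge0//; lra.
    by rewrite -/(w x); lra.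
  have := WA _ _ mS; have [_ Hu] := ub S S1; have := sqr_ge0 (u (- 1)); lra.
lra.
Qed.

End Base.

(** * Perturbation of solvable equations *)

Section Perturbation.
Context {R : realType}.
Implicit Types (f q a b g w u v U V Y F G : R -> R) (A B C K p e : R).

Lemma system_sub p q g1 g2 a a1 b b1 h1 h2 c c1 d d1 :
  system p q g1 g2 a a1 b b1 -> system p q h1 h2 c c1 d d1 ->
  system p q (fun x => g1 x - h1 x) (fun x => g2 x - h2 x)
    (fun x => a x - c x) (fun x => a1 x - c1 x)
    (fun x => b x - d x) (fun x => b1 x - d1 x).
Proof.
move=> [aa bb aa1 bb1] [cc dd cc1 dd1]; split; [exact: primB|exact: primB| |].
  by apply: eq_prim (primB aa1 cc1) => // x; ring.
by apply: eq_prim (primB bb1 dd1) => // x; ring.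
Qed.

Lemma eq_system p q g1 g2 h1 h2 a a1 b b1 : g1 =1 h1 -> g2 =1 h2 ->
  system p q g1 g2 a a1 b b1 -> system p q h1 h2 a a1 b b1.
Proof. by move=> /funext -> /funext ->. Qed.

Lemma mass_le_dom a b c d A B k l : mass_le a b A -> mass_le c d B ->
  0 <= k -> 0 <= l ->
  forall g1 g2, measurable_fun [set: R] g1 -> measurable_fun [set: R] g2 ->
  (forall x, g1 x ^+ 2 + g2 x ^+ 2 <=
    k * (a x ^+ 2 + b x ^+ 2) + l * (c x ^+ 2 + d x ^+ 2)) ->
  mass_le g1 g2 (k * A + l * B).
Proof.
move=> [U Uu UA] [V Vv VB] k0 l0 g1 g2 mg1 mg2 H.
have UV := primD (primZ k Uu) (primZ l Vv).
have [W Ww] : exists W, prim W (fun x => g1 x ^+ 2 + g2 x ^+ 2).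
  apply: loc_prim; apply: le_loc UV.1.
    by apply: measurable_funD; exact: measurable_funX.
  by move=> x; rewrite ger0_norm ?H//; nonneg.
exists W => // s t st; apply: le_trans (prim_le Ww UV st _) _; first by move=> x _; exact: H.
have := ler_wpM2l k0 (UA s t st); have := ler_wpM2l l0 (VB s t st); lra.
Qed.

Lemma prim_measurable F v : prim F v -> measurable_fun [set: R] F.
Proof. by move=> /prim_continuous; exact: continuous_measurable_fun. Qed.

(** One-dimensional Sobolev bound: average [|u(x)|^2 <= 2 |u(y)|^2 + 2 |u(y) - u(x)|^2] over [y] in
    [[x, x + 1]], the last term being bounded by Cauchy-Schwarz. *)
Lemma sup_le_mass a a1 b b1 A B x : prim a a1 -> prim b b1 ->
  mass_le a b A -> continuous a1 -> continuous b1 -> mass_le a1 b1 B ->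
  a x ^+ 2 + b x ^+ 2 <= 2 * (A + B).
Proof.
move=> aa bb [U Uu UA] ca1 cb1 [V Vv VB].
have [V1 Vv1] : exists V, prim V (fun x => a1 x ^+ 2) by apply: continuous_prim; cont.
have [V2 Vv2] : exists V, prim V (fun x => b1 x ^+ 2) by apply: continuous_prim; cont.
have xx : x <= x + 1 by lra.
pose k := a x ^+ 2 + b x ^+ 2 - 2 * B.
suff : k * (x + 1) - k * x <= 2 * U (x + 1) - 2 * U x.
  have := UA _ _ xx; rewrite /k; lra.
apply: (prim_le (primZ k (@prim_id R)) (primZ 2 Uu) xx) => y /andP[xy yx].
have V1le := prim_cauchy_schwarz aa Vv1 xy.
have V2le := prim_cauchy_schwarz bb Vv2 xy.
have VE : V1 y - V1 x + (V2 y - V2 x) <= B.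
  rewrite addrACA -opprD; apply: le_trans (VB x y xy).
  by apply: (prim_le (primD Vv1 Vv2) Vv xy).
have V10 : V1 x <= V1 y by apply: (prim_ge0 Vv1) => // z _; nonneg.
have V20 : V2 x <= V2 y by apply: (prim_ge0 Vv2) => // z _; nonneg.
have yx1 : 0 <= (1 - (y - x)) * (V1 y - V1 x + (V2 y - V2 x)).
  by apply: mulr_ge0; lra.
have := sqr_ge0 (a x - 2 * a y); have := sqr_ge0 (b x - 2 * b y).
rewrite /k; lra.
Qed.

Lemma half_pow_small C e : 0 < e -> exists n, C * 2^-1 ^+ n <= e.
Proof.
move=> e0; exists (Num.truncn (`|C| / e)).+1.
have H := truncnS_gt (`|C| / e); set n := (Num.truncn _).+1 in H *.
have n2 : n%:R <= 2 ^+ n :> R by rewrite -natrX ler_nat ltnW// ltn_expl.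
rewrite exprVn ler_pdivrMr ?exprn_gt0// mulrC -ler_pdivrMr//.
apply: le_trans (ler_norm _) _; rewrite normrM normfV (gtr0_norm e0).
by apply: le_trans (ltW H) n2.
Qed.

(** The limit is the supremum of the lower bounds [s n - 2 C 2^-n], each of which lies below every
    [s m + 2 C 2^-m]; the rate comes with it. *)
Lemma geometric_limit C (s : nat -> R) :
  (forall n, `|s n.+1 - s n| <= C * 2^-1 ^+ n) ->
  exists l, forall n, `|l - s n| <= 2 * C * 2^-1 ^+ n.
Proof.
move=> H.
have C0 n : 0 <= C * 2^-1 ^+ n by apply: le_trans (H n).
have tele n k : `|s (n + k)%N - s n| <= 2 * C * 2^-1 ^+ n - 2 * C * 2^-1 ^+ (n + k).
  elim: k => [|k ih]; first by rewrite addn0 !subrr normr0.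
  rewrite addnS; have := H (n + k)%N; have := C0 (n + k)%N; rewrite exprS.
  by move: ih; rewrite !ler_norml; lra.
pose D := range (fun n => s n - 2 * C * 2^-1 ^+ n).
have ub n : ubound D (s n + 2 * C * 2^-1 ^+ n).
  move=> _ [m _ <-]; have Cm := C0 m; have Cn := C0 n.
  have [mn|/ltnW nm] := leqP m n.
    by have := tele m (n - m)%N; rewrite subnKC// ler_norml; lra.
  by have := tele n (m - n)%N; rewrite subnKC// ler_norml; lra.
have hD : has_sup D.
  by split; [exists (s 0%N - 2 * C * 2^-1 ^+ 0), 0%N|exists (s 0%N + 2 * C * 2^-1 ^+ 0); exact: ub].
exists (sup D) => n.
have : s n - 2 * C * 2^-1 ^+ n <= sup D by apply: ub_le_sup; [case: hD|exists n].
have : sup D <= s n + 2 * C * 2^-1 ^+ n by apply: ge_sup; [case: hD|exact: ub].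
by rewrite ler_norml; lra.
Qed.

Lemma uniform_limit_continuous F :
  (forall e, 0 < e -> exists2 G, continuous G & forall x, `|F x - G x| <= e) ->
  continuous F.
Proof.
move=> FG x; apply/cvgrPdist_lt => /= e e0.
have e4 : 0 < e / 4 by rewrite divr_gt0.
have [G cG FGe] := FG _ e4.
have [d d0 Hd] := continuous_eps (cG x) e4.
exists d => //= y /= xy.
have := Hd y xy; have := FGe x; have := FGe y.
by rewrite !ler_norml !ltr_norml; lra.
Qed.

(** No bound on [A] is asked: the a priori estimates provide one as soon as the mass is finite. *)
Definition solvable p q := forall g1 g2 B, loc g1 -> loc g2 -> mass_le g1 g2 B ->
  exists a a1 b b1 A, system p q g1 g2 a a1 b b1 /\ mass_le a b A.

Lemma solvable_harmonic : solvable 1 (fun=> 0).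
Proof.
move=> g1 g2 B lg1 lg2 [G Gg GB].
have sq g : loc g -> (forall x, g x ^+ 2 <= g1 x ^+ 2 + g2 x ^+ 2) ->
    exists2 H, prim H (fun x => g x ^+ 2) & growth_le H B.
  move=> lg gG; have [H Hg] : exists H, prim H (fun x => g x ^+ 2).
    apply: loc_prim; apply: le_loc Gg.1.
      by apply: measurable_funX; exact: loc_measurable.
    by move=> x; rewrite ger0_norm ?sqr_ge0// gG.
  by exists H => // s t st; apply: le_trans (GB s t st); exact: (prim_le Hg Gg).
have [|H1 Hg1 HB1] := sq g1 lg1; first by move=> x; rewrite lerDl sqr_ge0.
have [|H2 Hg2 HB2] := sq g2 lg2; first by move=> x; rewrite lerDr sqr_ge0.
have [a [a1 [U [A [aa aa1 Uu UA]]]]] := base_solvable lg1 Hg1 HB1.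
have [b [b1 [V [A' [bb bb1 Vv VA]]]]] := base_solvable lg2 Hg2 HB2.
exists a, a1, b, b1, (A + A'); split.
  split=> //; first by apply: eq_prim aa1 => // x; rewrite mul0r subr0.
  by apply: eq_prim bb1 => // x; rewrite mul0r addr0.
exists (fun x => U x + V x); first exact: primD.
by move=> s t st; have := UA s t st; have := VA s t st; lra.
Qed.

Lemma coefficient_bound (x S p p' q q' Q Q' al be ga de k : R) :
  `|x| <= S -> 0 <= p -> `|q| <= Q -> `|q'| <= Q' ->
  `|al| <= k -> `|be| <= k -> `|ga| <= k -> `|de| <= k ->
  `|(x ^+ 2 + p) * al - q * be + (p' * ga - q' * de)| <=
    (S ^+ 2 + p + Q + `|p'| + Q') * k.
Proof.
move=> xS p0 qQ qQ' ak bk ck dk.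
have x2 : `|x ^+ 2 + p| <= S ^+ 2 + p.
  rewrite ger0_norm ?addr_ge0 ?sqr_ge0// lerD2r -(real_normK (num_real x)).
  by rewrite lerXn2r ?nnegrE ?normr_ge0// (le_trans _ xS).
have T (y z : R) : `|y - z| <= `|y| + `|z| by exact: ler_normB.
apply: le_trans (ler_normD _ _) _; apply: le_trans (lerD (T _ _) (T _ _)) _.
rewrite !normrM.
have M (y z y' : R) : `|y| <= y' -> `|z| <= k -> `|y| * `|z| <= y' * k.
  by move=> ? ?; apply: ler_pM.
have := M _ _ _ x2 ak; have := M _ _ _ qQ bk; have := M _ _ _ (lexx `|p'|) ck.
have := M _ _ _ qQ' dk; lra.
Qed.

(** One real component of the system; the other is the same statement with the components exchanged
    and the signs of [q] and [q'] reversed. Convergence is assumed for the functions and recovered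
    for the derivatives from the equation, only locally uniformly because of the coefficient
    [x^2]. *)
Lemma limit_system p p' q q' C Q Q' g1 (a a1 b : nat -> R -> R) al bl :
  0 <= p -> continuous q -> continuous q' ->
  (forall x, `|q x| <= Q) -> (forall x, `|q' x| <= Q') -> loc g1 ->
  (forall n, prim (a n) (a1 n)) -> (forall n, continuous (b n)) ->
  (forall n, prim (a1 n.+1) (fun x => (x ^+ 2 + p) * a n.+1 x - q x * b n.+1 x -
    (g1 x - (p' * a n x - q' x * b n x)))) ->
  (forall n x, `|a n.+1 x - a n x| <= C * 2^-1 ^+ n) ->
  (forall n x, `|b n.+1 x - b n x| <= C * 2^-1 ^+ n) ->
  (forall n x, `|al x - a n x| <= 2 * C * 2^-1 ^+ n) ->
  (forall n x, `|bl x - b n x| <= 2 * C * 2^-1 ^+ n) ->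
  exists al1, prim al al1 /\
    prim al1 (fun x => (x ^+ 2 + p) * al x - q x * bl x -
      (g1 x - (p' * al x - q' x * bl x))).
Proof.
move=> p0 cq cq' qQ qQ' lg aa cb aa1 aC bC alC blC.
pose L S := S ^+ 2 + p + Q + `|p'| + Q'.
have Q0 : 0 <= Q by apply: le_trans (qQ 0).
have Q0' : 0 <= Q' by apply: le_trans (qQ' 0).
have L0 S : 0 <= L S by rewrite /L; nonneg.
have C0 : 0 <= C by have := aC 0%N 0; rewrite expr0 mulr1 => /(le_trans (normr_ge0 _)).
have i0 n : 0 <= 2^-1 ^+ n :> R by rewrite exprn_ge0// invr_ge0.
have half n : C * 2^-1 ^+ n.+1 <= C * 2^-1 ^+ n.
  by rewrite exprS; have := mulr_ge0 C0 (i0 n); lra.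
(* The difference quotient over [[x, x + 1]] differs from the derivative at [x] by
     at most the supremum of the second derivative. *)
have a1C n x : `|a1 n.+2 x - a1 n.+1 x| <= (2 + L (`|x| + 1)) * C * 2^-1 ^+ n.
  have da := primB (aa n.+2) (aa n.+1).
  have da1 := primB (aa1 n.+1) (aa1 n).
  pose k := L (`|x| + 1) * (C * 2^-1 ^+ n).
  have near y : x <= y <= x + 1 ->
      `|(a1 n.+2 y - a1 n.+1 y) - (a1 n.+2 x - a1 n.+1 x)| <= k.
    move=> /andP[xy yx].
    apply: le_trans (prim_norm_le da1 (primZ k (@prim_id R)) xy _) _.
      move=> z /andP[xz zy]; rewrite mulr1.
      have -> : (z ^+ 2 + p) * a n.+2 z - q z * b n.+2 z -
          (g1 z - (p' * a n.+1 z - q' z * b n.+1 z)) -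
          ((z ^+ 2 + p) * a n.+1 z - q z * b n.+1 z -
          (g1 z - (p' * a n z - q' z * b n z))) =
        (z ^+ 2 + p) * (a n.+2 z - a n.+1 z) - q z * (b n.+2 z - b n.+1 z) +
        (p' * (a n.+1 z - a n z) - q' z * (b n.+1 z - b n z)) by ring.
      apply: coefficient_bound => //; try by apply: le_trans (half n).
      have -> : z = x + (z - x) by ring.
      by apply: le_trans (ler_normD _ _) _; rewrite lerD2l ger0_norm; lra.
    have : 0 <= k by rewrite /k; nonneg.
    have : 0 <= y - x by lra.
    rewrite -mulrBr => ? ?; rewrite ler_piMr//; lra.
  set d := a1 n.+2 x - a1 n.+1 x in near *.
  have xx : x <= x + 1 by lra.
  have up := prim_le da (primZ (d + k) (@prim_id R)) xx.
  have lo := prim_le (primZ (d - k) (@prim_id R)) da xx.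
  have {}up : a n.+2 (x + 1) - a n.+1 (x + 1) - (a n.+2 x - a n.+1 x) <= d + k.
    apply: le_trans (up _) _; last lra.
    by move=> y /near; rewrite mulr1 ler_norml; lra.
  have {}lo : d - k <= a n.+2 (x + 1) - a n.+1 (x + 1) - (a n.+2 x - a n.+1 x).
    apply: (le_trans _ (lo _)); first lra.
    by move=> y /near; rewrite mulr1 ler_norml; lra.
  have A1 := le_trans (aC n.+1 (x + 1)) (half n).
  have A2 := le_trans (aC n.+1 x) (half n).
  have -> : (2 + L (`|x| + 1)) * C * 2^-1 ^+ n = 2 * (C * 2^-1 ^+ n) + k.
    by rewrite /k; ring.
  by move: A1 A2; rewrite !ler_norml; lra.
have [al1 al1C] : exists al1 : R -> R, forall x n,
    `|al1 x - a1 n.+1 x| <= 2 * ((2 + L (`|x| + 1)) * C) * 2^-1 ^+ n.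
  have := choice (fun x => geometric_limit (a1C^~ x)).
  by move=> [al1 H]; exists al1.
have small D e : 0 < e -> exists n, D * 2^-1 ^+ n <= e by exact: half_pow_small.
have unif (h : R -> R) (s : nat -> R -> R) : (forall n, continuous (s n)) ->
    (forall n x, `|h x - s n x| <= 2 * C * 2^-1 ^+ n) -> continuous h.
  move=> cs H; apply: uniform_limit_continuous => e e0.
  have [n Hn] := small (2 * C) e e0.
  by exists (s n) => // x; apply: le_trans (H n x) Hn.
have ca : continuous al by apply: unif alC => n; exact: prim_continuous (aa n).
have cbl : continuous bl by apply: unif blC.
have lv : loc (fun x => (x ^+ 2 + p) * al x - q x * bl x -
      (g1 x - (p' * al x - q' x * bl x))).
  by apply: locB; [|apply: locB => //]; apply: loc_continuous; cont.
have P1 : prim al1 (fun x => (x ^+ 2 + p) * al x - q x * bl x -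
      (g1 x - (p' * al x - q' x * bl x))).
  apply: prim_limit; first exact: loc_measurable.
  move=> s t e e0; pose S := `|s| + `|t|.
  pose D := 2 * ((2 + L (`|s| + 1)) * C) + 2 * ((2 + L (`|t| + 1)) * C) + L S * (2 * C).
  have [n Hn] := small D e e0.
  have D1 : 0 <= 2 * ((2 + L (`|s| + 1)) * C) * 2^-1 ^+ n.
    by have := L0 (`|s| + 1) => ?; nonneg.
  have D2 : 0 <= 2 * ((2 + L (`|t| + 1)) * C) * 2^-1 ^+ n.
    by have := L0 (`|t| + 1) => ?; nonneg.
  have D3 : 0 <= L S * (2 * C) * 2^-1 ^+ n by have := L0 S => ?; nonneg.
  have {}Hn : 2 * ((2 + L (`|s| + 1)) * C) * 2^-1 ^+ n +
      2 * ((2 + L (`|t| + 1)) * C) * 2^-1 ^+ n + L S * (2 * C) * 2^-1 ^+ n <= e.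
    by apply: le_trans Hn; rewrite /D !(mulrDl _ _ (2^-1 ^+ n)).
  exists (a1 n.+1), (fun x => (x ^+ 2 + p) * a n.+1 x - q x * b n.+1 x -
    (g1 x - (p' * a n x - q' x * b n x))); split => //.
  - by apply: le_trans (al1C s n) _; lra.
  - by apply: le_trans (al1C t n) _; lra.
  move=> x /andP[sx xt].
  have -> : (x ^+ 2 + p) * al x - q x * bl x - (g1 x - (p' * al x - q' x * bl x)) -
    ((x ^+ 2 + p) * a n.+1 x - q x * b n.+1 x - (g1 x - (p' * a n x - q' x * b n x))) =
    (x ^+ 2 + p) * (al x - a n.+1 x) - q x * (bl x - b n.+1 x) +
    (p' * (al x - a n x) - q' x * (bl x - b n x)) by ring.
  have xS : `|x| <= S.
    rewrite /S ler_norml; have := ler_norm (- s); have := ler_norm t.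
    by rewrite normrN; have := normr_ge0 s; have := normr_ge0 t; lra.
  have h2 : 2 * C * 2^-1 ^+ n.+1 <= 2 * C * 2^-1 ^+ n by have := half n; lra.
  have k1 := le_trans (alC n.+1 x) h2; have k2 := le_trans (blC n.+1 x) h2.
  have := coefficient_bound p' xS p0 (qQ x) (qQ' x) k1 k2 (alC n x) (blC n x).
  by rewrite -/(L S); lra.
exists al1; split=> //.
apply: prim_limit; first exact: prim_measurable P1.
move=> s t e e0; pose S := `|s| + `|t|.
pose D := 2 * ((2 + L (S + 1)) * C) + 2 * C.
have [n Hn] := small D e e0.
have D1 : 0 <= 2 * ((2 + L (S + 1)) * C) * 2^-1 ^+ n.
  by have := L0 (S + 1) => ?; nonneg.
have D2 : 0 <= 2 * C * 2^-1 ^+ n by nonneg.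
have {}Hn : 2 * ((2 + L (S + 1)) * C) * 2^-1 ^+ n + 2 * C * 2^-1 ^+ n <= e.
  by apply: le_trans Hn; rewrite /D (mulrDl _ _ (2^-1 ^+ n)).
exists (a n.+1), (a1 n.+1); have hh := half n; split => //.
- by apply: le_trans (alC _ _) _; lra.
- by apply: le_trans (alC _ _) _; lra.
move=> x /andP[sx xt]; apply: le_trans (al1C x n) _.
have xS : `|x| <= S.
  rewrite /S ler_norml; have := ler_norm (- s); have := ler_norm t.
  by rewrite normrN; have := normr_ge0 s; have := normr_ge0 t; lra.
have LL : L (`|x| + 1) <= L (S + 1).
  have x0 := normr_ge0 x; rewrite /L !lerD2r lerXn2r ?nnegrE; lra.
have : (L (S + 1) - L (`|x| + 1)) * (C * 2^-1 ^+ n) >= 0.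
  by apply: mulr_ge0; [rewrite subr_ge0|nonneg].
lra.
Qed.

End Perturbation.

(** * Existence by continuation in the coefficients *)

Section Continuation.
Context {R : realType}.
Implicit Types (f q a b g w u v U V Y F G : R -> R) (A B C K p e : R).

Lemma mass_le_zero K : 0 <= K -> mass_le (fun _ : R => 0) (fun=> 0) K.
Proof.
move=> K0; exists (fun=> 0); last by move=> s t _; rewrite subrr.
by apply: eq_prim (prim_cst 0) => // x; rewrite expr0n addr0.
Qed.

Lemma mass_le_scale a b A k g1 g2 : mass_le a b A -> 0 <= k ->
  measurable_fun [set: R] g1 -> measurable_fun [set: R] g2 ->
  (forall x, g1 x ^+ 2 + g2 x ^+ 2 <= k * (a x ^+ 2 + b x ^+ 2)) ->
  mass_le g1 g2 (k * A).
Proof.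
move=> mA k0 mg1 mg2 H; rewrite -[_ * A]addr0 -[X in _ + X](mul0r A).
by apply: (mass_le_dom mA mA k0 (lexx 0)) => // x; rewrite mul0r addr0.
Qed.

(** Each iterate solves the unperturbed system, with the perturbation of the previous one moved to
    the data. The bound [4 kap B] is stable: the data have mass at most
    [2 B + 2 r (4 kap B) <= 4 B], as [kap r <= 1 / 4]. *)
Lemma iterates (p : R) q (p' : R) q' (kap r : R) g1 g2 B :
  solvable p q -> continuous q' ->
  (forall h1 h2 a a1 b b1 A D, system p q h1 h2 a a1 b b1 -> mass_le a b A ->
     mass_le h1 h2 D -> mass_le a b (kap * D)) ->
  0 <= kap -> 0 <= r -> kap * r <= 4^-1 ->
  (forall x, p' ^+ 2 + q' x ^+ 2 <= r) ->
  loc g1 -> loc g2 -> mass_le g1 g2 B ->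
  exists a a1 b b1 : nat -> R -> R, forall n,
    [/\ continuous (a n), continuous (b n), mass_le (a n) (b n) (4 * kap * B) &
    system p q (fun x => g1 x - (p' * a n x - q' x * b n x))
               (fun x => g2 x - (p' * b n x + q' x * a n x))
               (a n.+1) (a1 n.+1) (b n.+1) (b1 n.+1)].
Proof.
move=> slv cq' bd kap0 r0 kr pr lg1 lg2 mB.
have B0 : 0 <= B by have [? _ /growth_le_ge0] := mB.
pose T := ((R -> R) * (R -> R) * (R -> R) * (R -> R))%type.
pose Inv (s : T) := [/\ continuous s.1.1.1, continuous s.1.2 &
   mass_le s.1.1.1 s.1.2 (4 * kap * B)].
pose Next (s t : T) := Inv t /\
   system p q (fun x => g1 x - (p' * s.1.1.1 x - q' x * s.1.2 x))
              (fun x => g2 x - (p' * s.1.2 x + q' x * s.1.1.1 x))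
              t.1.1.1 t.1.1.2 t.1.2 t.2.
(* The invariant is put inside the existential, which makes the step total, so that [choice] yields
   a map to be iterated. *)
have step s : exists t, Inv s -> Next s t.
  have [Is|nIs] := pselect (Inv s); last by exists s.
  have [ca cb mK] := Is.
  have l1 : loc (fun x => g1 x - (p' * s.1.1.1 x - q' x * s.1.2 x)).
    by apply: locB => //; apply: loc_continuous; cont.
  have l2 : loc (fun x => g2 x - (p' * s.1.2 x + q' x * s.1.1.1 x)).
    by apply: locB => //; apply: loc_continuous; cont.
  have mh : mass_le (fun x => g1 x - (p' * s.1.1.1 x - q' x * s.1.2 x))
      (fun x => g2 x - (p' * s.1.2 x + q' x * s.1.1.1 x))
      (2 * B + 2 * r * (4 * kap * B)).
    apply: (mass_le_dom mB mK) => //; first by rewrite mulr_ge0.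
    - exact: loc_measurable.
    - exact: loc_measurable.
    move=> x; set al := s.1.1.1 x; set be := s.1.2 x.
    have := ler_wpM2r (addr_ge0 (sqr_ge0 al) (sqr_ge0 be)) (pr x).
    have := sqr_ge0 (g1 x + (p' * al - q' x * be)).
    have := sqr_ge0 (g2 x + (p' * be + q' x * al)).
    lra.
  have [a [a1 [b [b1 [A [sys mA]]]]]] := slv _ _ _ l1 l2 mh.
  exists (a, a1, b, b1) => _; split => //=.
  have [aa bb _ _] := sys.
  split; [exact: prim_continuous aa|exact: prim_continuous bb|].
  apply: mass_leW (bd _ _ _ _ _ _ _ _ sys mA mh).
  have := ler_wpM2r (mulr_ge0 kap0 B0) kr; lra.
have [F HF] := choice step.
pose s0 : T := (fun=> 0, fun=> 0, fun=> 0, fun=> 0).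
have I0 : Inv s0.
  split; [by cont|by cont|apply: mass_le_zero].
  by rewrite !mulr_ge0.
have In n : Inv (iter n F s0).
  by elim: n => //= n /HF[].
exists (fun n => (iter n F s0).1.1.1), (fun n => (iter n F s0).1.1.2),
  (fun n => (iter n F s0).1.2), (fun n => (iter n F s0).2) => n.
by have [ca cb mK] := In n; have [_ sys] := HF _ (In n); split.
Qed.

(* Fixed-point iteration: the masses of the increments decrease by a factor 4, and
   the energy bound turns this into geometric uniform convergence. *)
Lemma solvable_perturb (p : R) q (p' : R) q' (kap r Q Q' : R) :
  solvable p q -> 0 <= p -> continuous q -> continuous q' ->
  (forall x, `|q x| <= Q) -> (forall x, `|q' x| <= Q') ->
  (forall h1 h2 a a1 b b1 A D, system p q h1 h2 a a1 b b1 -> mass_le a b A ->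
     mass_le h1 h2 D -> mass_le a b (kap * D)) ->
  0 <= kap -> 0 <= r -> kap * r <= 4^-1 ->
  (forall x, p' ^+ 2 + q' x ^+ 2 <= r) ->
  solvable (p + p') (fun x => q x + q' x).
Proof.
move=> slv p0 cq cq' qQ qQ' bd kap0 r0 kr pr g1 g2 B lg1 lg2 mB.
have B0 : 0 <= B by have [? _ /growth_le_ge0] := mB.
have [a [a1 [b [b1 it]]]] := iterates slv cq' bd kap0 r0 kr pr lg1 lg2 mB.
pose K := 4 * kap * B; have K0 : 0 <= K by rewrite !mulr_ge0.
have ca n : continuous (a n) by have [] := it n.
have cb n : continuous (b n) by have [] := it n.
have mu n : mass_le (a n) (b n) K by have [] := it n.
have aa n : prim (a n.+1) (a1 n.+1) by have [_ _ _ []] := it n.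
have bb n : prim (b n.+1) (b1 n.+1) by have [_ _ _ []] := it n.
have dsys n : system p q
    (fun x => - (p' * (a n.+1 x - a n x) - q' x * (b n.+1 x - b n x)))
    (fun x => - (p' * (b n.+1 x - b n x) + q' x * (a n.+1 x - a n x)))
    (fun x => a n.+2 x - a n.+1 x) (fun x => a1 n.+2 x - a1 n.+1 x)
    (fun x => b n.+2 x - b n.+1 x) (fun x => b1 n.+2 x - b1 n.+1 x).
  have [_ _ _ s1] := it n; have [_ _ _ s2] := it n.+1.
  by apply: eq_system (system_sub s2 s1) => x; ring.
have mP n A : mass_le (fun x => a n.+1 x - a n x) (fun x => b n.+1 x - b n x) A ->
    mass_le (fun x => - (p' * (a n.+1 x - a n x) - q' x * (b n.+1 x - b n x)))
    (fun x => - (p' * (b n.+1 x - b n x) + q' x * (a n.+1 x - a n x))) (r * A).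
  move=> mA; apply: (mass_le_scale mA r0).
  - by apply: continuous_measurable_fun; have ? := ca n; have ? := cb n;
      have ? := ca n.+1; have ? := cb n.+1; cont.
  - by apply: continuous_measurable_fun; have ? := ca n; have ? := cb n;
      have ? := ca n.+1; have ? := cb n.+1; cont.
  move=> x; set al := a n.+1 x - a n x; set be := b n.+1 x - b n x.
  have := ler_wpM2r (addr_ge0 (sqr_ge0 al) (sqr_ge0 be)) (pr x).
  lra.
have md n : mass_le (fun x => a n.+1 x - a n x) (fun x => b n.+1 x - b n x)
    (4 * K * 4^-1 ^+ n).
  elim: n => [|n ih].
    have -> : 4 * K * 4^-1 ^+ 0 = 2 * K + 2 * K by rewrite expr0; ring.
    apply: (mass_le_dom (mu 1%N) (mu 0%N)) => //.
    - by apply: continuous_measurable_fun; have ? := ca 1%N; have ? := ca 0%N; cont.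
    - by apply: continuous_measurable_fun; have ? := cb 1%N; have ? := cb 0%N; cont.
    move=> x; have := sqr_ge0 (a 1%N x + a 0%N x).
    by have := sqr_ge0 (b 1%N x + b 0%N x); lra.
  have [D mD] : exists D, mass_le (fun x => a n.+2 x - a n.+1 x) (fun x => b n.+2 x - b n.+1 x) D.
    exists (2 * K + 2 * K); apply: (mass_le_dom (mu n.+2) (mu n.+1)) => //.
    - exact: prim_measurable (primB (aa n.+1) (aa n)).
    - exact: prim_measurable (primB (bb n.+1) (bb n)).
    move=> x; have := sqr_ge0 (a n.+2 x + a n.+1 x).
    by have := sqr_ge0 (b n.+2 x + b n.+1 x); lra.
  apply: mass_leW (bd _ _ _ _ _ _ _ _ (dsys n) mD (mP n _ ih)).
  rewrite exprS; have F0 : 0 <= 4 * K * 4^-1 ^+ n.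
    by rewrite !mulr_ge0// exprn_ge0// invr_ge0.
  have := ler_wpM2r F0 kr; lra.
(* [sup_le_mass] bounds the squared increments by [c2 * 4^-n]; [1 + c2] dominates the square root of
   [c2]. *)
pose c2 := 2 * (4 * K * (2^-1 + r)); pose C := 1 + c2.
have c20 : 0 <= c2 by rewrite /c2 !mulr_ge0// addr_ge0// invr_ge0.
have dC n x : `|a n.+2 x - a n.+1 x| <= C * 2^-1 ^+ n /\
              `|b n.+2 x - b n.+1 x| <= C * 2^-1 ^+ n.
  have md1 := energy_derivative (dsys n) p0 (md n.+1) (mP n _ (md n)).
  have [da db da1 db1] := dsys n.
  have := sup_le_mass x da db (md n.+1) (prim_continuous da1) (prim_continuous db1) md1.
  have -> : 2 * (4 * K * 4^-1 ^+ n.+1 + (4 * K * 4^-1 ^+ n.+1 + r * (4 * K * 4^-1 ^+ n))) =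
     c2 * (2^-1 ^+ n) ^+ 2.
    rewrite -exprM mulnC exprM (_ : 2^-1 ^+ 2 = 4^-1); last by field.
    by rewrite exprS /c2; field.
  move=> H; have i0 : 0 <= 2^-1 ^+ n :> R by rewrite exprn_ge0// invr_ge0.
  have H2 : c2 * (2^-1 ^+ n) ^+ 2 <= (C * 2^-1 ^+ n) ^+ 2.
    by rewrite exprMn ler_wpM2r ?sqr_ge0// /C; have := sqr_ge0 c2; lra.
  have C0 : 0 <= C * 2^-1 ^+ n by rewrite mulr_ge0// /C; lra.
  have N (y : R) : y ^+ 2 <= (C * 2^-1 ^+ n) ^+ 2 -> `|y| <= C * 2^-1 ^+ n.
    by move=> yC; rewrite -(@ler_sqr _ `|y|) ?nnegrE ?normr_ge0 ?C0// real_normK ?num_real.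
  split; apply: N; apply: le_trans H2; apply: le_trans H.
    by rewrite lerDl sqr_ge0.
  by rewrite lerDr sqr_ge0.
have [al alC] := choice (fun x => geometric_limit (fun n => (dC n x).1)).
have [bl blC] := choice (fun x => geometric_limit (fun n => (dC n x).2)).
have [al1 [Pal Pal1]] : exists al1, prim al al1 /\
    prim al1 (fun x => (x ^+ 2 + p) * al x - q x * bl x -
      (g1 x - (p' * al x - q' x * bl x))).
  (* Indices are shifted by one: [it] gives the derivative of an iterate only from index 1 on. *)
  apply: (@limit_system _ p p' q q' C Q Q' g1 (fun n => a n.+1) (fun n => a1 n.+1) (fun n => b n.+1)) => //.
  - by move=> n; have [_ _ _ []] := it n.+1.
  - by move=> n x; have [] := dC n x.
  - by move=> n x; have [] := dC n x.
have [bl1 [Pbl Pbl1]] : exists bl1, prim bl bl1 /\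
    prim bl1 (fun x => (x ^+ 2 + p) * bl x - - q x * al x -
      (g2 x - (p' * bl x - - q' x * al x))).
  apply: (@limit_system _ p p' (fun x => - q x) (fun x => - q' x) C Q Q' g2
    (fun n => b n.+1) (fun n => b1 n.+1) (fun n => a n.+1)) => //.
  - by cont.
  - by cont.
  - by move=> x; rewrite normrN.
  - by move=> x; rewrite normrN.
  - move=> n; have [_ _ _ [_ _ _ S]] := it n.+1.
    by apply: eq_prim S => // x; ring.
  - by move=> n x; have [] := dC n x.
  - by move=> n x; have [] := dC n x.
exists al, al1, bl, bl1, (2 * K + 1); split.
  split => //; first by apply: eq_prim Pal1 => // x; ring.
  by apply: eq_prim Pbl1 => // x; ring.
have [U Uu] : exists U, prim U (fun x => al x ^+ 2 + bl x ^+ 2).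
  have := prim_continuous Pal; have := prim_continuous Pbl => ? ?.
  by apply: continuous_prim; cont.
exists U => // s t st.
(* An iterate within [e] of the limit is chosen; the discrepancy adds at most [4 e^2 (t - s) <= 1]
   to [2 K], whatever the interval. *)
pose e := (4 * (t - s + 1))^-1.
have ts : 0 < 4 * (t - s + 1) by lra.
have e0 : 0 < e by rewrite invr_gt0.
have e1 : e <= 1 by rewrite invf_le1//; lra.
have et : 4 * e * (t - s + 1) = 1 by rewrite /e; field; lra.
have [n Hn] := half_pow_small (2 * C) e0.
have [V Vv VK] := mu n.+1.
have H := prim_le Uu (primD (primZ 2 Vv) (primZ (4 * e ^+ 2) (@prim_id R))) st.
apply: le_trans (H _) _; last first.
  have := VK s t st; have e2 : e ^+ 2 <= e by rewrite expr2 ler_piMl// ltW.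
  have : 0 <= (e - e ^+ 2) * (t - s) by apply: mulr_ge0; lra.
  lra.
move=> x _; have A1 := le_trans (alC x n) Hn; have B1 := le_trans (blC x n) Hn.
have sq y : `|y| <= e -> y ^+ 2 <= e ^+ 2.
  by rewrite -(real_normK (num_real y)) => ye; rewrite lerXn2r ?nnegrE ?(ltW e0).
have := sq _ A1; have := sq _ B1.
have := sqr_ge0 (al x - 2 * a n.+1 x); have := sqr_ge0 (bl x - 2 * b n.+1 x).
lra.
Qed.

(** [q] is reached in [N > 2 Q] equal steps. Each has size below [1 / 2], so [r = 1 / 4] is
    admissible with the constant [kap = 1] of [coercivity], the same at every stage. *)
Lemma solvable_coercive q Q : continuous q -> (forall x, `|q x| <= Q) ->
  solvable 1 q.
Proof.
move=> cq qQ; have Q0 : 0 <= Q := le_trans (normr_ge0 _) (qQ 0).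
pose N := (Num.truncn (2 * Q)).+1; have N0 : 0 < N%:R :> R by rewrite ltr0n.
have NQ : 2 * Q < N%:R by exact: truncnS_gt.
suff H k : (k <= N)%N -> solvable 1 (fun x => k%:R / N%:R * q x).
  have := H N (leqnn _); rewrite divff ?gt_eqF//.
  by rewrite (_ : (fun x => 1 * q x) = q)//; apply/funext => x; rewrite mul1r.
elim: k => [_|k ih kN].
  have := solvable_harmonic (R := R).
  by congr solvable; apply/funext => x; rewrite !mul0r.
have -> : (fun x => k.+1%:R / N%:R * q x) = (fun x => k%:R / N%:R * q x + N%:R^-1 * q x).
  by apply/funext => x; rewrite -natr1; ring.
rewrite -[X in solvable X](addr0 1).
have qb (c : R) x : 0 <= c -> `|c * q x| <= c * Q.
  by move=> c0; rewrite normrM ger0_norm// ler_wpM2l.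
apply: (@solvable_perturb 1 _ 0 _ 1 4^-1 (k%:R / N%:R * Q) (N%:R^-1 * Q)) => //.
- by apply: ih; exact: ltnW.
- by cont.
- by cont.
- by move=> x; apply: qb; rewrite divr_ge0.
- by move=> x; apply: qb; rewrite invr_ge0.
- by move=> h1 h2 a a1 b b1 A D sys mA mD; rewrite mul1r; exact: coercivity sys mA mD.
- by rewrite mul1r.
move=> x; rewrite expr0n add0r -(real_normK (num_real _)) (_ : 4^-1 = 2^-1 ^+ 2); last by field.
rewrite lerXn2r ?nnegrE ?invr_ge0//; apply: le_trans (qb _ _ _) _; first by rewrite invr_ge0.
by rewrite ler_pdivrMl//; lra.
Qed.

(** A single step [p' = -1], [q' = 0] removes the shift. Here [r = 1], so [kap = M^-2] must be at
    most [1 / 4]: this is where [2 <= M] comes from. *)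
Lemma solvable_resolvent f (M eps lam F : R) : continuous f -> (forall x, `|f x| <= F) ->
  2 <= M -> 0 < eps ->
  (forall h1 h2 a a1 b b1 A D,
    system 1 (fun x => f x / eps - lam) h1 h2 a a1 b b1 -> mass_le a b A ->
    mass_le h1 h2 D -> mass_le a b (D / M ^+ 2)) ->
  solvable 0 (fun x => f x / eps - lam).
Proof.
move=> cf fF M2 e0 bd.
have qQ x : `|f x / eps - lam| <= F / eps + `|lam|.
  apply: le_trans (ler_normB _ _) _; rewrite lerD2r normrM normfV (gtr0_norm e0).
  by rewrite ler_pM2r ?invr_gt0.
have cq : continuous (fun x => f x / eps - lam) by cont.
have := @solvable_perturb 1 _ (-1) (fun=> 0) ((M ^+ 2)^-1) 1 _ 0
  (solvable_coercive cq qQ) ler01 cq (@continuous_cst_fun R 0) qQ.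
rewrite subrr (_ : (fun x => f x / eps - lam + 0) = (fun x => f x / eps - lam)); last first.
  by apply/funext => x; rewrite addr0.
have M4 : 4 <= M ^+ 2 by have := sqr_ge0 (M - 2); lra.
apply => //.
- by move=> x; rewrite normr0.
- by move=> h1 h2 a a1 b b1 A D sys mA mD; rewrite mulrC; exact: bd sys mA mD.
- by rewrite invr_ge0 sqr_ge0.
- by rewrite mulr1 lef_pV2 ?posrE//; lra.
- by move=> x; rewrite expr0n addr0 sqrrN expr1n.
Qed.

End Continuation.

(** * Square integrable functions *)

Section Norm.
Context {R : realType}.
Local Notation mu := (@lebesgue_measure R).
Implicit Types (f q a b g w U V Y F G : R -> R) (A B C K p e : R).
Implicit Types (u v : R -> R[i]).

(** Monotone convergence along [[- n, n]]. With its converse below, it translates bounds on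
    increments into bounds on the squared [L2norm]. *)
Lemma mass_le_integral a b A : mass_le a b A ->
  (\int[mu]_x (a x ^+ 2 + b x ^+ 2)%:E <= A%:E)%E.
Proof.
move=> [U Uu UA].
have mU := loc_measurable Uu.1.
pose D (n : nat) : set R := `[- n%:R, n%:R]%classic.
have -> : [set: R] = \bigcup_n D n.
  apply/seteqP; split => // x _.
  exists (Num.truncn `|x|).+1 => //=; rewrite /D /= in_itv /= -ler_norml.
  by apply: ltW; exact: truncnS_gt.
have H : (\int[mu]_(x in D n) (a x ^+ 2 + b x ^+ 2)%:E)%E @[n --> \oo]
  --> (\int[mu]_(x in \bigcup_n D n) (a x ^+ 2 + b x ^+ 2)%:E)%E.
  apply: ge0_nondecreasing_set_cvg_integral.
  - move=> n m nm; apply/subsetPset; apply: subset_itv; rewrite bnd_simp ?lerN2 ler_nat//.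
  - by move=> n; rewrite /D.
  - by move=> n; apply/measurable_EFinP; exact: measurable_funTS.
  - by move=> n x _; rewrite lee_fin addr_ge0// sqr_ge0.
rewrite -(cvg_lim _ H)//; apply: lime_le; first by apply/cvg_ex; eexists; exact: H.
apply: nearW => n.
have nn : - n%:R <= n%:R :> R by rewrite lerNl (le_trans _ (ler0n _ _))// oppr_le0.
have E : fine (\int[mu]_(x in D n) (a x ^+ 2 + b x ^+ 2)%:E)%E <= A.
  by rewrite -[leLHS]/(\int[mu]_(x in D n) (a x ^+ 2 + b x ^+ 2)) Uu.2//; exact: UA.
rewrite -lee_fin in E; apply: le_trans E; rewrite fineK//.
exact: (integrable_fin_num _ (Uu.1 _ _)).
Qed.

Lemma integral_mass_le a b A : measurable_fun [set: R] a -> measurable_fun [set: R] b ->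
  (\int[mu]_x (a x ^+ 2 + b x ^+ 2)%:E <= A%:E)%E -> mass_le a b A.
Proof.
move=> ma mb IA.
have mh : measurable_fun [set: R] (fun x => a x ^+ 2 + b x ^+ 2).
  by apply: measurable_funD; exact: measurable_funX.
have h0 x : (0 <= (a x ^+ 2 + b x ^+ 2)%:E)%E by rewrite lee_fin addr_ge0// sqr_ge0.
have sub s t : (\int[mu]_(x in `[s, t]) (a x ^+ 2 + b x ^+ 2)%:E <= A%:E)%E.
  apply: le_trans IA; apply: ge0_subset_integral => //.
  exact/measurable_EFinP.
have lh : loc (fun x => a x ^+ 2 + b x ^+ 2).
  move=> s t; apply/integrableP; split.
    by apply/measurable_EFinP; exact: measurable_funTS.
  apply: le_lt_trans (le_lt_trans (sub s t) (ltry A)).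
  rewrite le_eqVlt; apply/orP; left; apply/eqP; apply: eq_integral => x _.
  by rewrite gee0_abs// h0.
have [U Uu] := loc_prim lh; exists U => // s t st.
rewrite -Uu.2// -lee_fin; apply: le_trans (sub s t); rewrite fineK//.
exact: (integrable_fin_num _ (lh _ _)).
Qed.

Lemma L2norm_integral u : L2norm u =
  ((\int[mu]_x (complex.Re (u x) ^+ 2 + complex.Im (u x) ^+ 2)%:E) `^ 2^-1)%E.
Proof.
rewrite /L2norm Lnorm.unlock; congr (_ `^ _)%E; apply: eq_integral => x _ /=.
case: (u x) => y z /=; congr EFin.
rewrite ger0_norm ?sqrtr_ge0// powR_mulrn ?sqrtr_ge0//.
by rewrite sqr_sqrtr// addr_ge0 ?sqr_ge0.
Qed.

Lemma mass_le_L2norm u (c : R) : 0 <= c ->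
  mass_le (fun x => complex.Re (u x)) (fun x => complex.Im (u x)) (c ^+ 2) -> (L2norm u <= c%:E)%E.
Proof.
move=> c0 /mass_le_integral H; rewrite L2norm_integral.
have -> : c%:E = ((c ^+ 2)%:E `^ 2^-1)%E.
  by rewrite poweR_EFin -powR_mulrn// -powRrM divff// powRr1.
apply: gt0_ler_poweR => //.
  by rewrite in_itv /= leey andbT; apply: integral_ge0 => x _; rewrite lee_fin addr_ge0// sqr_ge0.
by rewrite in_itv /= leey andbT lee_fin sqr_ge0.
Qed.

Lemma L2norm_mass_le u (c : R) :
  measurable_fun [set: R] (fun x => complex.Re (u x)) -> measurable_fun [set: R] (fun x => complex.Im (u x)) ->
  (L2norm u <= c%:E)%E -> mass_le (fun x => complex.Re (u x)) (fun x => complex.Im (u x)) (c ^+ 2).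
Proof.
move=> mr mi uc; apply: integral_mass_le => //.
set I := (X in (X <= _)%E).
have I0 : (0 <= I)%E by apply: integral_ge0 => x _; rewrite lee_fin addr_ge0// sqr_ge0.
have N0 : (0 <= L2norm u)%E by rewrite L2norm_integral poweR_ge0.
have c0 : 0 <= c by rewrite -lee_fin (le_trans N0).
have -> : I = (L2norm u `^ 2)%E.
  by rewrite L2norm_integral -poweRrM mulVf// poweRe1.
have -> : (c ^+ 2)%:E = (c%:E `^ 2)%E by rewrite poweR_EFin powR_mulrn.
by apply: gt0_ler_poweR => //; rewrite in_itv /= leey andbT.
Qed.

Lemma L2_mass_le u : L2 u -> exists A, mass_le (fun x => complex.Re (u x)) (fun x => complex.Im (u x)) A.
Proof.
move=> [mr mi uoo]; exists (fine (L2norm u) ^+ 2); apply: L2norm_mass_le => //.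
by rewrite fineK// ge0_fin_numE// L2norm_integral poweR_ge0.
Qed.

Lemma mass_le_L2 u A : measurable_fun [set: R] (fun x => complex.Re (u x)) ->
  measurable_fun [set: R] (fun x => complex.Im (u x)) ->
  mass_le (fun x => complex.Re (u x)) (fun x => complex.Im (u x)) A -> L2 u.
Proof.
move=> mr mi mA; have A0 : 0 <= A by have [? _ /growth_le_ge0] := mA.
split=> //; apply: (@le_lt_trans _ _ (Num.sqrt A)%:E); last by rewrite ltry.
by apply: mass_le_L2norm; [exact: sqrtr_ge0|rewrite sqr_sqrtr].
Qed.

Lemma mass_le_components a b A :
  measurable_fun [set: R] a -> measurable_fun [set: R] b ->
  mass_le a b A -> loc a /\ loc b.
Proof.
move=> ma mb [U Uu _].
have l1 : loc (fun x => 1 + (a x ^+ 2 + b x ^+ 2)).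
  by apply: locD Uu.1; apply: loc_continuous; exact: continuous_cst_fun.
have n1 (y : R) : `|y| <= 1 + y ^+ 2.
  by rewrite ler_norml; have := sqr_ge0 (y - 1); have := sqr_ge0 (y + 1); have := sqr_ge0 y; lra.
split; apply: le_loc l1 => // x.
  by have := n1 (a x); have := sqr_ge0 (b x); lra.
by have := n1 (b x); have := sqr_ge0 (a x); lra.
Qed.

End Norm.

(** * Smooth bump functions *)

Section Smooth.
Context {R : realType}.
Implicit Types (f h F v : R -> R) (x c : R).

Lemma prim_is_derive F v x : prim F v -> continuous v -> is_derive x 1 F (v x).
Proof.
move=> Fv cv.
have xu : x < x + 1 by lra.
have xa : x - 1 < x by lra.
have [dG Gx] := continuous_FTC1_closed xu (Fv.1 (x - 1) (x + 1)) xa (cv x).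
set G := (fun y => _) in dG Gx.
have FG : \forall y \near x, F y = G y + F (x - 1).
  near=> y; rewrite /G Fv.2 ?subrK//; apply/ltW; near: y; exact: lt_nbhsr.
have dGc : is_derive x (1 : R) (fun y => G y + F (x - 1)) (v x).
  apply: is_derive_eq; first (by apply: is_deriveD; apply: DeriveDef; [exact: dG|rewrite -derive1E]).
  by rewrite addr0 Gx.
apply: near_eq_is_derive dGc; near=> y; apply/esym; near: y; exact: FG.
Unshelve. all: by end_near. Qed.

Definition smooth h := forall n x, derivable (derive1n n h) x 1.

(** Stability of a class under one derivation replaces an explicit formula for the higher
    derivatives. *)
Lemma smooth_class (S : set (R -> R)) h :
  (forall h, S h -> (forall x, derivable h x 1) /\ S (derive1 h)) ->
  S h -> smooth h.
Proof.
move=> HS Sh n; suff : S (derive1n n h) by move=> /HS[].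
by elim: n => // n /HS[_]; rewrite derive1nS.
Qed.

Lemma smooth_derivable h x : smooth h -> derivable h x 1.
Proof. by move=> /(_ 0%N x). Qed.

Lemma smooth_derive1 h : smooth h -> smooth (derive1 h).
Proof. by move=> sh n x; rewrite -derive1Sn; exact: sh n.+1 x. Qed.

Lemma smooth_continuous h : smooth h -> continuous h.
Proof.
by move=> sh x; apply/differentiable_continuous/derivable1_diffP/smooth_derivable.
Qed.

Lemma smooth_prim h : smooth h -> prim h (derive1 h).
Proof.
move=> sh; apply: prim_derive; last by apply/smooth_continuous/smooth_derive1.
by move=> x; apply: DeriveDef; [exact: smooth_derivable|rewrite derive1E].
Qed.

Lemma smoothB g h : smooth g -> smooth h -> smooth (fun x => g x - h x).
Proof.
move=> sg sh; pose S := [set k | exists g h, [/\ smooth g, smooth h & k = fun x => g x - h x]].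
apply: (@smooth_class S); last by exists g, h.
move=> _ [{sg}g [{sh}h [sg sh ->]]].
have dgh x : is_derive x (1 : R) (fun x => g x - h x) (derive1 g x - derive1 h x).
  by apply: is_deriveB; apply: DeriveDef; rewrite ?derive1E//; exact: smooth_derivable.
split; first by move=> x; case: (dgh x).
exists (derive1 g), (derive1 h); split; [exact: smooth_derive1|exact: smooth_derive1|].
by apply/funext => x; rewrite derive1E; case: (dgh x).
Qed.

Lemma is_derive_affine h (c k s x dh : R) : is_derive (k * (x - s)) 1 h dh ->
  is_derive x 1 (fun x => c * h (k * (x - s))) (c * k * dh).
Proof.
move=> D1.
have D2 : is_derive x (1 : R) (fun x => k * (x - s)) k.
  by apply: is_derive_eq; rewrite /GRing.scale /=; ring.
have D3 : is_derive x (1 : R) (fun x => h (k * (x - s))) (dh * k).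
  exact: (@is_derive1_comp R h (fun x => k * (x - s)) x _ _ D1 D2).
by apply: is_derive_eq; rewrite /GRing.scale /=; ring.
Qed.

Lemma smooth_affine h (c k s : R) : smooth h -> smooth (fun x => c * h (k * (x - s))).
Proof.
move=> sh; pose S := [set g | exists c h, smooth h /\ g = fun x => c * h (k * (x - s))].
apply: (@smooth_class S); last by exists c, h.
move=> _ [{}c [{sh}h [sh ->]]].
have dh x : is_derive x (1 : R) (fun x => c * h (k * (x - s))) (c * k * derive1 h (k * (x - s))).
  by apply: is_derive_affine; apply: DeriveDef; rewrite ?derive1E//; exact: smooth_derivable.
split; first by move=> x; case: (dh x).
exists (c * k), (derive1 h); split; first exact: smooth_derive1.
by apply/funext => x; rewrite derive1E; case: (dh x).
Qed.

Lemma prim_smooth F v : prim F v -> smooth v -> smooth F.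
Proof.
move=> Fv sv [|n] x.
  by have [] := prim_is_derive x Fv (smooth_continuous sv).
rewrite derive1Sn (_ : derive1 F = v); first exact: sv.
apply/funext => y; rewrite derive1E.
by have [] := prim_is_derive y Fv (smooth_continuous sv).
Qed.

End Smooth.

(** * The bump exp(-1/(x(1-x))) and its primitive *)

Section Bump.
Context {R : realType}.
Implicit Types (f h F v : R -> R) (x c : R) (p : {poly R}).

Lemma is_derive_quadratic h c C : h c = 0 ->
  (forall x, `|h x| <= C * (x - c) ^+ 2) -> is_derive c 1 h 0.
Proof.
move=> hc hC.
have H : (fun t : R => t^-1 *: (h (t *: (1 : R) + c) - h c)) @ 0^' --> (0 : R).
  apply/cvgrPdist_le => /= e e0.
  have C1 : 0 < `|C| + 1 by rewrite ltr_wpDl.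
  near=> t.
  have t0 : t != 0 by near: t; exact: nbhs_dnbhs_neq.
  rewrite sub0r normrN hc subr0 [t *: _]mulr1 [_ *: _]/(_ * _) normrM normfV.
  rewrite ler_pdivrMl ?normr_gt0//; apply: le_trans (hC _) _.
  have -> : t + c - c = t by ring.
  rewrite -(real_normK (num_real t)) expr2 mulrA [leRHS]mulrC ler_wpM2r//.
  apply: (@le_trans _ _ ((`|C| + 1) * `|t|)).
    by rewrite ler_wpM2r// (le_trans (ler_norm _))// lerDl.
  rewrite mulrC -ler_pdivlMr//.
  by near: t; apply: dnbhs0_le; rewrite divr_gt0.
by apply: DeriveDef; [apply/cvg_ex; exists 0|apply: cvg_lim].
Unshelve. all: by end_near. Qed.

(* Up to the choice of [p] and [k], this family is closed under derivation. *)
Definition bump p k x := if (0 < x) && (x < 1) then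
  p.[x] * (x * (1 - x))^-1 ^+ k * expR (- (x * (1 - x))^-1) else 0.

Lemma pow_le_expR (k : nat) (t : R) : 0 <= t -> t ^+ k.+1 <= k.+1%:R ^+ k.+1 * expR t.
Proof.
move=> t0; have k0 : 0 < k.+1%:R :> R by rewrite ltr0n.
have -> : expR t = expR (t / k.+1%:R) ^+ k.+1.
  by rewrite -expRM_natl mulrC divfK// gt_eqF.
have H : t <= k.+1%:R * expR (t / k.+1%:R).
  rewrite mulrC -ler_pdivrMr//; apply: le_trans (expR_ge1Dx _).
  by rewrite lerDr.
by rewrite -exprMn; apply: lerXn2r; rewrite ?nnegrE//; apply: le_trans H.
Qed.

(** With [t = (x (1 - x))^-1], the exponential absorbs [k + 2] powers of [t]; the two in excess give
    the quadratic vanishing at 0 and 1. *)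
Lemma bump_bound p k : exists C, forall x, `|bump p k x| <= C * (x * (1 - x)) ^+ 2.
Proof.
have cp : continuous (fun x : R => `|p.[x]|).
  by move=> x; apply: cvg_norm; exact: continuous_horner.
have [c _ Hc] : exists2 c, c \in `[0, 1]%R &
    forall t, t \in `[0, 1]%R -> `|p.[t]| <= `|p.[c]|.
  by apply: EVT_max => //; exact: continuous_subspaceT.
have [N N0 HN] : exists2 N : R, 0 <= N & forall t, 0 <= t -> t ^+ k.+2 <= N * expR t.
  by exists (k.+2%:R ^+ k.+2); [exact: exprn_ge0|move=> t; exact: pow_le_expR].
exists (`|p.[c]| * N) => x; rewrite /bump; case: ifPn => [/andP[x0 x1]|_]; last first.
  by rewrite normr0; apply: mulr_ge0; [apply: mulr_ge0|apply: sqr_ge0].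
set y := x * (1 - x); have y0 : 0 < y by rewrite mulr_gt0// subr_gt0.
have z0 : 0 < y^-1 by rewrite invr_gt0.
rewrite !normrM (ger0_norm (expR_ge0 _)) (ger0_norm (exprn_ge0 _ (ltW z0))).
rewrite -!mulrA; apply: ler_pM => //; first by rewrite mulr_ge0 ?expR_ge0 ?exprn_ge0 ?ltW.
  by apply: Hc; rewrite in_itv /= !ltW.
have H := HN _ (ltW z0).
have -> : y^-1 ^+ k = y ^+ 2 * y^-1 ^+ k.+2.
  by rewrite -[k.+2]addn2 exprD exprVn [RHS]mulrCA -exprMn divff ?gt_eqF// expr1n mulr1.
rewrite -mulrA [leRHS]mulrC ler_pM2l ?exprn_gt0//.
by rewrite expRN ler_pdivrMr ?expR_gt0.
Qed.

(* Outside the open interval everything vanishes; at 0 and 1 the bound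
   [bump_bound] gives a zero derivative. *)
Lemma bump_derive p k x : is_derive x 1 (bump p k)
  (bump (p^`() * ('X * (1 - 'X)) ^+ 2 - k%:R *: (p * (1 - 2%:R *: 'X) * ('X * (1 - 'X)))
     + p * (1 - 2%:R *: 'X)) k.+2 x).
Proof.
have [C HC] := bump_bound p k.
have quad c : c = 0 \/ c = 1 -> is_derive c (1 : R) (bump p k) 0.
  move=> c01; apply: (@is_derive_quadratic _ _ C).
    by case: c01 => ->; rewrite /bump ltxx ?andbF.
  move=> z; have [/andP[z0 z1]|] := boolP ((0 < z) && (z < 1)); last first.
    move=> /negbTE zz; rewrite /bump zz normr0; apply: mulr_ge0; last exact: sqr_ge0.
    have := HC 2^-1; move=> /(le_trans (normr_ge0 _)).
    by rewrite pmulr_lge0// exprn_gt0//; lra.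
  apply: le_trans (HC z) _; apply: ler_wpM2l.
    have := HC 2^-1; move=> /(le_trans (normr_ge0 _)).
    by rewrite pmulr_lge0// exprn_gt0//; lra.
  have zz : 0 <= z * (1 - z) by apply: mulr_ge0; lra.
  have le_sqr (t : R) : 0 <= t -> z * (1 - z) <= t -> (z * (1 - z)) ^+ 2 <= t ^+ 2.
    by move=> t0 zt; rewrite lerXn2r ?nnegrE.
  case: c01 => ->; [rewrite subr0|rewrite -(sqrrN (z - 1)) opprB]; apply: le_sqr.
  - exact: ltW.
  - by rewrite ler_piMr; lra.
  - lra.
  - by rewrite ler_piMl; lra.
have zero : ~~ ((0 < x) && (x < 1)) -> is_derive x (1 : R) (bump p k) 0.
  rewrite negb_and -!leNgt !le_eqVlt => /orP[/orP[/eqP->|x0]|/orP[/eqP<-|x1]].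
  - by apply: quad; left.
  - apply: (@near_eq_is_derive _ _ _ (cst 0)) => //.
    near=> z; rewrite /bump /=; have -> // : (0 < z) = false.
    by apply/negbTE; rewrite -leNgt ltW//; near: z; exact: lt_nbhsl.
  - by apply: quad; right.
  - apply: (@near_eq_is_derive _ _ _ (cst 0)) => //.
    near=> z; rewrite /bump /=; have -> // : (z < 1) = false; last by rewrite andbF.
    by apply/negbTE; rewrite -leNgt ltW//; near: z; exact: lt_nbhsr.
rewrite {2}/bump; case: ifPn => [/andP[x0 x1]|/zero//].
set q := (p^`() * _ - _ + _).
have y0 : x * (1 - x) != 0 by rewrite mulf_neq0 ?gt_eqF// subr_gt0.
apply: (@near_eq_is_derive _ _ _ (fun x => p.[x] * (x * (1 - x))^-1 ^+ k * expR (- (x * (1 - x))^-1))).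
  near=> z; rewrite /bump; have -> // : 0 < z by near: z; exact: lt_nbhsr.
  by have -> // : z < 1 by near: z; exact: lt_nbhsl.
have dy : is_derive x (1 : R) (fun x => x * (1 - x)) (1 - 2 * x).
  by apply: is_derive_eq; rewrite /GRing.scale /=; ring.
have dz : is_derive x (1 : R) (fun x => (x * (1 - x))^-1) (- (x * (1 - x)) ^- 2 * (1 - 2 * x)).
  exact: (@is_deriveV R (fun x => x * (1 - x)) x _ _ y0 dy).
have de : is_derive x (1 : R) (fun x => expR (- (x * (1 - x))^-1))
    (expR (- (x * (1 - x))^-1) * - (- (x * (1 - x)) ^- 2 * (1 - 2 * x))).
  exact: (@is_derive1_comp R expR (fun x => - (x * (1 - x))^-1) x _ _ (is_derive_expR _) (is_deriveN dz)).
set z' := (- (x * (1 - x)) ^- 2 * (1 - 2 * x)) in dz de.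
have dzk : is_derive x (1 : R) (fun x => (x * (1 - x))^-1 ^+ k)
    (k%:R * (x * (1 - x))^-1 ^+ k.-1 * z').
  have -> : (fun x => (x * (1 - x))^-1 ^+ k) = (fun x : R => (x * (1 - x))^-1) ^+ k.
    by apply/funext => t; rewrite exprfctE.
  exact: is_deriveX.
have dp := is_derive_poly p x.
have dpz : is_derive x (1 : R) (fun x => p.[x] * (x * (1 - x))^-1 ^+ k) _ :=
  is_deriveM dp dzk.
have D : is_derive x (1 : R) (fun x => p.[x] * (x * (1 - x))^-1 ^+ k * expR (- (x * (1 - x))^-1)) _ :=
  is_deriveM dpz de.
apply: (is_derive_eq D).
have -> : q.[x] = p^`().[x] * (x * (1 - x)) ^+ 2 -
   k%:R * (p.[x] * (1 - 2 * x) * (x * (1 - x))) + p.[x] * (1 - 2 * x).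
  by rewrite /q !(hornerE, horner_exp); ring.
have scE (r s : R) : r *: (s : R^o) = r * s by [].
rewrite !scE.
have z'E : z' = - (x * (1 - x))^-1 ^+ 2 * (1 - 2 * x) by rewrite /z' exprVn.
rewrite z'E; clear D dpz dzk de z'E z' dz dp.
have -> : p^`().[x] = p^`().[x] * (x * (1 - x) * (x * (1 - x))^-1) ^+ 2.
  by rewrite divff// expr1n mulr1.
(* The predecessor in [k.-1] is harmless at [k = 0], where both sides vanish. *)
have -> : k%:R * (x * (1 - x))^-1 ^+ k.-1 = k%:R * (x * (1 - x)) * (x * (1 - x))^-1 ^+ k.
  case: k {HC quad zero q} => [|k]; first by rewrite !mul0r.
  by rewrite exprS -mulrA mulVKf.
rewrite -[k.+2]addn2 exprD.
set w := (x * (1 - x))^-1 ^+ k; set z := (x * (1 - x))^-1; set e := expR _.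
have -> : x * (1 - x) * z = 1 by rewrite /z divff.
have -> : (p^`().[x] * 1 ^+ 2 * (x * (1 - x)) ^+ 2 -
   k%:R * (p.[x] * (1 - 2 * x) * (x * (1 - x))) + p.[x] * (1 - 2 * x)) * (w * z ^+ 2) * e =
   (p^`().[x] * ((x * (1 - x)) * z) ^+ 2 -
   k%:R * (p.[x] * (1 - 2 * x) * (x * (1 - x))) * z ^+ 2 + p.[x] * (1 - 2 * x) * z ^+ 2) * w * e by ring.
have -> : x * (1 - x) * z = 1 by rewrite /z divff.
ring.
Unshelve. all: by end_near. Qed.

Lemma smooth_bump p k : smooth (bump p k).
Proof.
apply: (@smooth_class _ [set h | exists p k, h = bump p k]); last by exists p, k.
move=> _ [{}p [{}k ->]]; split; first by move=> x; case: (bump_derive p k x).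
eexists; exists k.+2; apply/funext => x; rewrite derive1E.
by have [_ ->] := bump_derive p k x.
Qed.

Lemma bump_out p k x : x <= 0 \/ 1 <= x -> bump p k x = 0.
Proof. by rewrite /bump => -[] x01; rewrite [X in if X then _ else _](_ : _ = false)//; apply/negbTE; rewrite negb_and -!leNgt x01 ?orbT. Qed.

Definition bump1 := bump 1 0.

Lemma bump1_ge0 x : 0 <= bump1 x.
Proof.
by rewrite /bump1 /bump; case: ifP => // _; rewrite hornerC expr0 !mul1r expR_ge0.
Qed.

Lemma bump1_gt0 x : 0 < x -> x < 1 -> 0 < bump1 x.
Proof.
by move=> x0 x1; rewrite /bump1 /bump x0 x1 hornerC expr0 !mul1r expR_gt0.
Qed.

Lemma bump1_le1 x : bump1 x <= 1.
Proof.
rewrite /bump1 /bump; case: ifP => // /andP[x0 x1].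
rewrite hornerC expr0 !mul1r expR_le1 oppr_le0 invr_ge0 mulr_ge0//; lra.
Qed.

(** The value of [c] is never computed. It is positive because otherwise the monotone primitive
    would be constant, forcing [bump1] to vanish identically. *)
Lemma smooth_step : exists P (c : R), [/\ prim P bump1, 0 < c,
  forall x, x <= 0 -> P x = 0, forall x, 1 <= x -> P x = c &
  forall x, 0 <= P x <= c].
Proof.
have cb : continuous bump1 by apply: smooth_continuous; exact: smooth_bump.
have [P0 P0b] := continuous_prim cb.
have Pb : prim (fun x => P0 x - P0 0) bump1.
  by apply: eq_prim (primB P0b (prim_cst (P0 0))) => // x; rewrite subr0.
have mono x y : x <= y -> P0 x <= P0 y.
  by move=> xy; apply: (prim_ge0 P0b) => // z _; exact: bump1_ge0.
have flat x y : x <= y -> (y <= 0 \/ 1 <= x) -> P0 x = P0 y.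
  move=> xy xy01; apply/eqP; rewrite eq_le mono// -subr_le0.
  have := prim_le P0b (prim_cst 0) xy; rewrite subrr; apply => z /andP[xz zy].
  rewrite /bump1 bump_out//; case: xy01 => [y0|x1]; [left; exact: le_trans y0|right; exact: le_trans xz].
have H x : x <= 0 -> P0 x - P0 0 = 0 by move=> x0; rewrite (flat x 0) ?subrr//; left.
have H1 x : 1 <= x -> P0 x - P0 0 = P0 1 - P0 0 by move=> x1; rewrite (flat 1 x)//; right.
exists (fun x => P0 x - P0 0), (P0 1 - P0 0); split => //; last first.
  move=> x; have [x0|/ltW x0] := leP x 0; first by rewrite H// lexx subr_ge0 mono.
  have [x1|/ltW x1] := leP 1 x; first by rewrite H1// lexx andbT subr_ge0 mono.
  by rewrite subr_ge0 lerD2r !mono.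
rewrite lt_neqAle subr_ge0 mono// andbT eq_sym; apply/negP => /eqP E.
have top t : P0 t <= P0 1.
  by have [/mono//|/ltW t1] := leP t 1; rewrite (flat 1 t)//; right.
have bot t : P0 0 <= P0 t.
  by have [/mono//|/ltW t1] := leP 0 t; rewrite (flat t 0)//; left.
have cst s t : s <= t -> P0 t <= P0 s.
  by move=> _; have := top t; have := bot s; lra.
have /(_ 2^-1) := prim_eq0 P0b cb bump1_ge0 cst.
apply/eqP; rewrite gt_eqF// bump1_gt0//; lra.
Qed.

End Bump.

(** * Weak derivatives *)

Section Weak.
Context {R : realType}.
Local Notation mu := (@lebesgue_measure R).
Implicit Types (a b h F v phi : R -> R) (x c S : R) (u : R -> R[i]).

Definition real_weak_derivative a a1 := forall phi, test_function phi ->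
  \int[mu]_x (a x * derive1 phi x) = - \int[mu]_x (a1 x * phi x).

Lemma Cintegral_real u (r : R -> R) : Cintegral (fun x => u x * ((r x)%:C)%C) =
  ((\int[mu]_x (complex.Re (u x) * r x)) +i* (\int[mu]_x (complex.Im (u x) * r x)))%C.
Proof.
congr Complex; apply: eq_Rintegral => x _; case: (u x) => y z /=; ring.
Qed.

Lemma weak_derivativeP (u v : R -> R[i]) : weak_derivative u v <->
  real_weak_derivative (fun x => complex.Re (u x)) (fun x => complex.Re (v x)) /\
  real_weak_derivative (fun x => complex.Im (u x)) (fun x => complex.Im (v x)).
Proof.
split=> [H|[H1 H2] phi tphi].
  by split=> phi tphi; have := H phi tphi; rewrite !Cintegral_real => -[].
by rewrite !Cintegral_real H1// H2.
Qed.

Lemma Rintegral_support h s t : (forall x, x < s \/ t < x -> h x = 0) ->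
  \int[mu]_x h x = \int[mu]_(x in `[s, t]) h x.
Proof.
move=> h0; rewrite [RHS]Rintegral_mkcond; apply: eq_Rintegral => x _.
rewrite /patch; case: ifPn => //; rewrite notin_setE /= in_itv /= => /negP.
by rewrite negb_and -!ltNge => /orP[?|?]; apply: h0; [left|right].
Qed.

Lemma test_function_smooth phi : test_function phi -> smooth phi.
Proof. by case. Qed.

Lemma derive1_support h S : (forall x, x < - S \/ S < x -> h x = 0) ->
  forall x, x < - S \/ S < x -> derive1 h x = 0.
Proof.
move=> Z x xS.
rewrite derive1E -[RHS](@derive_cst _ _ _ (0 : R) x 1); apply: near_eq_derive.
case: xS => xS; near=> y.
  by apply: Z; left; near: y; exact: lt_nbhsl.
by apply: Z; right; near: y; exact: lt_nbhsr.
Unshelve. all: by end_near. Qed.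

Lemma test_function_support phi : test_function phi ->
  exists2 S : R, 0 < S & forall x, x < - S \/ S < x -> phi x = 0 /\ derive1 phi x = 0.
Proof.
move=> [_ /compact_bounded[M [_ HM]]].
pose S := Num.max M 0 + 1.
have MS : M < S by rewrite ltr_pwDr// le_max lexx.
have S0 : 0 < S by rewrite ltr_pwDr// le_max lexx orbT.
have Z x : x < - S \/ S < x -> phi x = 0.
  move=> xS; apply: contrapT => px.
  have : closure [set x | phi x != 0] x by apply: subset_closure; exact/eqP.
  move=> /(HM S MS) H; have : `|x| <= S := H.
  by rewrite ler_norml; lra.
by exists S => // x xS; split; [exact: Z|exact: derive1_support xS].
Qed.

Lemma prim_weak_derivative a a1 : prim a a1 -> real_weak_derivative a a1.
Proof.
move=> aa phi tphi; have [S S0 HS] := test_function_support tphi.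
have sphi := test_function_smooth tphi.
have pphi := smooth_prim sphi.
(* One unit beyond [S], since the test function is only known to vanish strictly outside
   [[- S, S]]. *)
pose T := S + 1; have TT : - T <= T by rewrite /T; lra.
have out x : x < - T \/ T < x -> phi x = 0 /\ derive1 phi x = 0.
  by move=> xT; apply: HS; case: xT; rewrite /T; [left|right]; lra.
rewrite (@Rintegral_support (fun x => a x * derive1 phi x) (- T) T); last first.
  by move=> x /out[_ ->]; rewrite mulr0.
rewrite (@Rintegral_support (fun x => a1 x * phi x) (- T) T); last first.
  by move=> x /out[-> _]; rewrite mulr0.
have [_ /(_ _ _ TT)] := primM aa pphi.
have [-> _] : phi T = 0 /\ derive1 phi T = 0 by apply: HS; right; rewrite /T; lra.
have [-> _] : phi (- T) = 0 /\ derive1 phi (- T) = 0 by apply: HS; left; rewrite /T; lra.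
have ca := prim_continuous aa; have cphi := smooth_continuous sphi.
have cphi1 := smooth_continuous (smooth_derive1 sphi).
rewrite RintegralD//; first by rewrite !mulr0 subrr => /eqP; rewrite addrC addr_eq0 => /eqP.
  by have : loc (fun x => a1 x * phi x) by apply: eq_loc (locM cphi aa.1) => x; rewrite mulrC.
by have : loc (fun x => a x * derive1 phi x) by apply: loc_continuous; cont.
Qed.

End Weak.

(** * The lemma of du Bois-Reymond *)

Section DuBoisReymond.
Context {R : realType}.
Local Notation mu := (@lebesgue_measure R).
Implicit Types (a b h F v phi P V : R -> R) (x c S s t k : R).

Lemma continuous_affine h k s : continuous h -> continuous (fun x => h (k * (x - s))).
Proof.
move=> ch x; apply: (@continuous_comp _ _ _ (fun x => k * (x - s)) h); last exact: ch.
by have H : continuous (fun x : R => k * (x - s)); [cont|exact: H].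
Qed.

Lemma prim_affine F v k s : continuous v -> prim F v ->
  prim (fun x => F (k * (x - s))) (fun x => k * v (k * (x - s))).
Proof.
move=> cv Fv; apply: prim_derive; last first.
  by apply: continuousM_fun; [cont|exact: continuous_affine].
move=> x; have := is_derive_affine 1 (prim_is_derive (k * (x - s)) Fv cv).
by rewrite mul1r; congr is_derive; apply/funext => y; rewrite mul1r.
Qed.

Lemma continuous_bump1 : continuous (@bump1 R).
Proof. by apply: smooth_continuous; exact: smooth_bump. Qed.

Lemma test_function_step P c s t d : prim P (@bump1 R) ->
  (forall x, x <= 0 -> P x = 0) -> (forall x, 1 <= x -> P x = c) ->
  0 < d -> s <= t ->
  test_function (fun x => P (d^-1 * (x - s)) - P (d^-1 * (x - t))).
Proof.
move=> Pb P0 P1 d0 st; split.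
  have sP : smooth P by apply: prim_smooth Pb _; exact: smooth_bump.
  have := @smoothB R _ _ (@smooth_affine R P 1 d^-1 s sP) (@smooth_affine R P 1 d^-1 t sP).
  by congr smooth; apply/funext => x; rewrite !mul1r.
apply: (subclosed_compact _ (@segment_compact _ s (t + d))); first exact: closed_closure.
rewrite closureE; apply: smallest_sub; first exact: interval_closed.
move=> x /= /eqP nz; rewrite in_itv /=; apply/andP; split; rewrite leNgt; apply/negP => H.
  by apply: nz; rewrite !P0 ?subrr//; rewrite pmulr_rle0 ?invr_gt0//; lra.
by apply: nz; rewrite !P1 ?subrr//; rewrite ler_pdivlMl//; lra.
Qed.

Lemma loc_locally_integrable v : loc v -> locally_integrable [set: R] v.
Proof.
move=> lv; split; [exact: loc_measurable|exact: openT|].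
move=> K _ cK; have /compact_bounded[M [_ HM]] := cK.
pose S := M + 1; have MS : M < S by rewrite ltrDl.
have KS : K `<=` `[- S, S].
  move=> x /(HM S MS) H; have {}H : `|x| <= S := H.
  by rewrite /= in_itv /= -ler_norml.
have /integrableP[mv] := lv (- S) S; apply: le_lt_trans.
apply: ge0_subset_integral => //; first exact: compact_measurable.
by apply/measurable_EFinP; apply: measurableT_comp => //; apply/measurable_EFinP; exact: mv.
Qed.

(** The ball of radius [2 r], of length [4 r], contains [[s, s + r]]; an average at most [e / 4]
    over the ball thus bounds the one-sided integral by [e r]. *)
Lemma lebesgue_pt_prim a s V : loc a -> lebesgue_pt a s ->
  prim V (fun x => `|a x - a s|) -> forall e : R, 0 < e ->
  exists2 d : R, 0 < d & forall r : R, 0 < r -> r < d -> V (s + r) - V s <= e * r.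
Proof.
move=> la lpt Vv e e0.
have e4 : 0 < e / 4 by rewrite divr_gt0.
have : \forall r \near (0 : R)^'+, (davg a s r <= (e / 4)%:E)%E.
  have := lpt; rewrite /lebesgue_pt => /fine_cvgP[fin cv0].
  have cvn : \forall r \near (0 : R)^'+, `|fine (davg a s r)| <= e / 4.
    by move/cvgr0Pnorm_le : cv0; exact.
  near=> r.
  have finr : davg a s r \is a fin_num by near: r; exact: fin.
  rewrite -(fineK finr) lee_fin; apply: le_trans (ler_norm _) _.
  by near: r; exact: cvn.
move=> [d /= d0 Hd]; exists (d / 2); first by rewrite divr_gt0.
move=> r r0 rd.
have r20 : 0 < 2 * r by rewrite mulr_gt0.
have r2d : 2 * r < d by lra.
have := Hd (2 * r); rewrite /= sub0r normrN gtr0_norm// => /(_ r2d r20).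
rewrite /davg /iavg lebesgue_measure_ball ?(ltW r20)// => H.
have sr : s <= s + r by lra.
pose I := (\int[mu]_(y in ball s (2 * r)) `|((center (a s) \o a) y)%:E|)%E.
have HI : (I <= (e * r)%:E)%E.
  move: H; rewrite -/I inver mulrn_eq0 /= gt_eqF//= => H.
  have p0 : 0 < (2 * r *+ 2)^-1 by rewrite invr_gt0 mulrn_wgt0.
  have := lee_wpmul2l (_ : 0 <= (2 * r *+ 2)%:E)%E H.
  rewrite muleA -EFinM divff ?gt_eqF// ?mulrn_wgt0// mul1e -EFinM => /(_ _)/le_trans; apply.
    by rewrite lee_fin mulrn_wge0// ltW.
  by rewrite lee_fin le_eqVlt; apply/orP; left; apply/eqP; rewrite mulr2n; field.
rewrite -Vv.2// -lee_fin fineK; last exact: (integrable_fin_num _ (Vv.1 _ _)).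
apply: le_trans HI.
apply: (@le_trans _ _ (\int[mu]_(y in `[s, (s + r)%R]) `|((center (a s) \o a) y)%:E|)%E).
  rewrite le_eqVlt; apply/orP; left; apply/eqP; exact: eq_integral.
apply: ge0_subset_integral => //.
- exact: measurable_ball.
- by apply/measurable_EFinP; exact: measurable_funTS (loc_measurable Vv.1).
- move=> y /=; rewrite in_itv /= => /andP[sy yr].
  by rewrite /ball /= ltr_norml; lra.
Unshelve. all: by end_near. Qed.

(* The test function rises from 0 to [c] right after [s] and falls back to 0 right
   after [t]; its derivative approximates [c] times the difference of the Dirac
   masses at [s] and [t]. *)
Lemma du_bois_reymond_pt a a1 A1 s t : loc a -> prim A1 a1 ->
  real_weak_derivative a a1 -> s < t -> lebesgue_pt a s -> lebesgue_pt a t ->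
  a t - a s = A1 t - A1 s.
Proof.
move=> la Aa1 wa st ls lt'.
have [P [c [Pb c0 P0 P1 Pc]]] := @smooth_step R.
suff E (e : R) : 0 < e -> `|c * (a t - a s - (A1 t - A1 s))| <= (2 + 2 * c) * e.
  apply/eqP; rewrite -subr_eq0 -(mulrI_eq0 _ (lregP (lt0r_neq0 c0))) -normr_le0.
  apply/ler_addgt0Pl => /= e e0; rewrite addr0.
  have k0 : 0 < 2 + 2 * c by lra.
  have /E H : 0 < e / (2 + 2 * c) by rewrite divr_gt0.
  by apply: le_trans H _; rewrite mulrC divfK// gt_eqF.
move=> e0.
have lc k : loc (fun x => a x - k).
  by apply: locB => //; apply: loc_continuous; exact: continuous_cst_fun.
have [Vs Vsa] := loc_prim (loc_norm (lc (a s))).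
have [Vt Vta] := loc_prim (loc_norm (lc (a t))).
have [ds ds0 Hs] := lebesgue_pt_prim la ls Vsa e0.
have [dt dt0 Ht] := lebesgue_pt_prim la lt' Vta e0.
have [V Va1] := loc_prim (loc_norm Aa1.1).
have [d1 d10 HV1] := continuous_eps (prim_continuous Va1 (x:=s)) e0.
have [d2 d20 HV2] := continuous_eps (prim_continuous Va1 (x:=t)) e0.
(* [d] is small enough for both Lebesgue points, for the integral of [|a1|] over each ramp to stay
   below [e], and for the ramps to be disjoint. *)
pose d := Num.min (Num.min (Num.min ds dt) (Num.min d1 d2)) (t - s) / 2.
have d0 : 0 < d by rewrite divr_gt0// !lt_min ds0 dt0 d10 d20 subr_gt0.
have [dds [ddt [dd1 [dd2 dts]]]] : d < ds /\ d < dt /\ d < d1 /\ d < d2 /\ d < t - s.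
  have dm : d < Num.min (Num.min (Num.min ds dt) (Num.min d1 d2)) (t - s).
    rewrite /d in d0 *; lra.
  by move: dm; rewrite !lt_min => /andP[/andP[/andP[-> ->] /andP[-> ->]] ->].
pose k := d^-1; have k0 : 0 < k by rewrite invr_gt0.
have kd : k * d = 1 by rewrite mulVf ?gt_eqF.
pose phi x := P (k * (x - s)) - P (k * (x - t)).
have tphi : test_function phi by apply: test_function_step Pb P0 P1 _ _; rewrite ?ltW.
have cb := continuous_bump1.
have bs r := prim_affine k r cb Pb.
have dphi : derive1 phi = fun x => k * bump1 (k * (x - s)) - k * bump1 (k * (x - t)).
  apply/funext => x; rewrite derive1E.
  have cc : continuous (fun x => k * bump1 (k * (x - s)) - k * bump1 (k * (x - t))).
    have cs := @continuous_affine _ k s cb; have ct := @continuous_affine _ k t cb.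
    cont.
  by have [_ ->] := prim_is_derive x (primB (bs s) (bs t)) cc.
have lb r : loc (fun x => a x * (k * bump1 (k * (x - r)))).
  apply: eq_loc (locM (h := fun x => k * bump1 (k * (x - r))) _ la) => [x|]; first by rewrite mulrC.
  by have cr := @continuous_affine _ k r cb; cont.
have [Qs Qsa] := loc_prim (lb s); have [Qt Qta] := loc_prim (lb t).
(* Integrating [a] against the derivative of one ramp of width [d] gives [c * a r] up to [e]: this
   kernel is at most [k = 1 / d], and the integral of [|a - a r|] is at most [e d]. *)
have near r V0 (Q : R -> R) : prim V0 (fun x => `|a x - a r|) -> V0 (r + d) - V0 r <= e * d ->
    prim Q (fun x => a x * (k * bump1 (k * (x - r)))) ->
    `|Q (r + d) - Q r - c * a r| <= e.
  move=> V0a V0d Qa; have rr : r <= r + d by lra.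
  have := prim_norm_le (primB Qa (primZ (a r) (bs r))) (primZ k V0a) rr.
  have -> : k * (r + d - r) = 1 by rewrite -kd; ring.
  rewrite subrr mulr0 (P0 0)// (P1 1)// mulr0 subr0 => H.
  have -> : Q (r + d) - Q r - c * a r = Q (r + d) - a r * c - Q r by ring.
  apply: le_trans (H _) _.
    move=> x _; have -> : a x * (k * bump1 (k * (x - r))) - a r * (k * bump1 (k * (x - r))) =
      k * (bump1 (k * (x - r)) * (a x - a r)) by ring.
    rewrite normrM (gtr0_norm k0) (ler_wpM2l (ltW k0))// normrM ler_piMl//.
    by rewrite ger0_norm ?bump1_ge0// bump1_le1.
  rewrite -mulrBr; have := ler_wpM2l (ltW k0) V0d.
  by have -> : k * (e * d) = e by rewrite mulrCA kd mulr1.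
have Qs1 := near s Vs Qs Vsa (Hs d d0 dds) Qsa.
have Qt1 := near t Vt Qt Vta (Ht d d0 ddt) Qta.
have flat (Q : R -> R) r x y : prim Q (fun x => a x * (k * bump1 (k * (x - r)))) ->
    x <= y -> y <= r \/ r + d <= x -> Q y = Q x.
  move=> Qa xy xyr; apply/eqP; rewrite -subr_eq0 -normr_le0.
  apply: le_trans (prim_norm_le Qa (prim_cst 0) xy _) _; last by rewrite subrr.
  move=> z /andP[xz zy]; rewrite /bump1 bump_out ?mulr0 ?normr0//.
  case: xyr => H; [left|right].
    by rewrite pmulr_rle0//; lra.
  by rewrite -kd ler_pM2l//; lra.
have td : s <= t + d by lra.
have out x : x < s \/ t + d < x -> phi x = 0 /\ derive1 phi x = 0.
  move=> xs; rewrite dphi /bump1; case: xs => xs.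
    have H1 : k * (x - s) <= 0 by rewrite pmulr_rle0//; lra.
    have H2 : k * (x - t) <= 0 by rewrite pmulr_rle0//; lra.
    by rewrite /phi !P0// !bump_out ?mulr0 ?subrr//; left.
  have H1 : 1 <= k * (x - s) by rewrite -kd ler_pM2l//; lra.
  have H2 : 1 <= k * (x - t) by rewrite -kd ler_pM2l//; lra.
  by rewrite /phi !P1// !bump_out ?mulr0 ?subrr//; right.
have := wa phi tphi.
rewrite (@Rintegral_support R (fun x => a x * derive1 phi x) s (t + d)); last first.
  by move=> x /out[_ ->]; rewrite mulr0.
rewrite (@Rintegral_support R (fun x => a1 x * phi x) s (t + d)); last first.
  by move=> x /out[-> _]; rewrite mulr0.
have Qst : prim (fun x => Qs x - Qt x) (fun x => a x * derive1 phi x).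
  by apply: eq_prim (primB Qsa Qta) => // x; rewrite dphi; ring.
rewrite (Qst.2 _ _ td).
have cphi : continuous phi := prim_continuous (primB (bs s) (bs t)).
have [N Na] : exists N, prim N (fun x => a1 x * phi x).
  by apply: loc_prim; apply: eq_loc (locM cphi Aa1.1) => x; rewrite mulrC.
rewrite (Na.2 _ _ td).
have phic x : `|phi x| <= c /\ `|phi x - c| <= c.
  have kk : k * (x - t) <= k * (x - s) by rewrite ler_pM2l//; lra.
  have Pm : P (k * (x - t)) <= P (k * (x - s)).
    by apply: (prim_ge0 Pb) => // z _; exact: bump1_ge0.
  have := Pc (k * (x - s)); have := Pc (k * (x - t)); rewrite /phi !ler_norml.
  by move=> /andP[? ?] /andP[? ?]; split; lra.
have ssd : s <= s + d by lra.
have sdt : s + d <= t by lra.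
have ttd : t <= t + d by lra.
(* The integral of [a1 * phi] is split into the rising ramp, the plateau where [phi = c], and the
   falling ramp; each ramp contributes an error at most [c e]. *)
have N1 : `|N (s + d) - N s - c * (A1 (s + d) - A1 s)| <= c * e.
  have -> : N (s + d) - N s - c * (A1 (s + d) - A1 s) =
    (N (s + d) - c * A1 (s + d)) - (N s - c * A1 s) by ring.
  apply: le_trans (prim_norm_le (primB Na (primZ c Aa1)) (primZ c Va1) ssd _) _.
    move=> x _; have -> : a1 x * phi x - c * a1 x = (phi x - c) * a1 x by ring.
    by rewrite normrM ler_wpM2r//; exact: (phic x).2.
  rewrite -mulrBr ler_pM2l//.
  have : `|V s - V (s + d)| < e by apply: HV1; rewrite ltr_norml; lra.
  by rewrite ltr_norml; lra.
have N2 : N t - N (s + d) = c * (A1 t - A1 (s + d)).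
  apply/eqP; rewrite -subr_eq0 -normr_le0.
  have -> : N t - N (s + d) - c * (A1 t - A1 (s + d)) =
    (N t - c * A1 t) - (N (s + d) - c * A1 (s + d)) by ring.
  apply: le_trans (prim_norm_le (primB Na (primZ c Aa1)) (prim_cst 0) sdt _) _; last by rewrite subrr.
  move=> x /andP[x1 x2].
  have -> : phi x = c.
    rewrite /phi P1; last by rewrite -kd ler_pM2l//; lra.
    by rewrite P0 ?subr0// pmulr_rle0//; lra.
  by rewrite mulrC subrr normr0.
have N3 : `|N (t + d) - N t| <= c * e.
  apply: le_trans (prim_norm_le Na (primZ c Va1) ttd _) _.
    by move=> x _; rewrite normrM mulrC ler_wpM2r//; exact: (phic x).1.
  rewrite -mulrBr ler_pM2l//.
  have : `|V t - V (t + d)| < e by apply: HV2; rewrite ltr_norml; lra.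
  by rewrite ltr_norml; lra.
have F1 : Qs (t + d) = Qs (s + d) by apply: (flat _ s) => //; [lra|right].
have F2 : Qt t = Qt s by apply: (flat _ t) => //; [lra|left].
move: Qs1 Qt1 N1 N3; rewrite F1 !ler_norml; lra.
Qed.

(** [a - A1] takes the same value at all Lebesgue points of [a], which form a set of full measure.
    This provides the continuous representatives of elements of [H2]. *)
Lemma du_bois_reymond a a1 : loc a -> loc a1 -> real_weak_derivative a a1 ->
  exists2 F, prim F a1 & a = F %[ae mu].
Proof.
move=> la la1 wa; have [A1 Aa1] := loc_prim la1.
have leb := lebesgue_differentiation (loc_locally_integrable la).
have [s ls] : exists s, lebesgue_pt a s.
  apply: contrapT => no.
  have : mu [set: R] = 0.
    apply/negligibleP => //; move: leb; apply: negligibleS => x _ /=.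
    by move=> lx; apply: no; exists x.
  move=> mu0; have : (mu `[0%R, 1%R]%classic <= mu [set: R])%E.
    by apply: le_measure => //; rewrite inE.
  by rewrite mu0 lebesgue_measure_itv /= lte_fin ltr01 oppr0 adde0 lee_fin ler10.
exists (fun x => A1 x + (a s - A1 s)).
  by apply: eq_prim (primD Aa1 (prim_cst _)) => // x; rewrite addr0.
move: leb; apply: filterS => x lx _.
have [xs|sx|->] := ltgtP x s; last by ring.
  by have := du_bois_reymond_pt la Aa1 wa xs lx ls; lra.
by have := du_bois_reymond_pt la Aa1 wa sx ls lx; lra.
Qed.

End DuBoisReymond.

(** * The operator and its resolvent *)

Section Resolvent.
Local Open Scope complex_scope.
Context {R : realType}.
Local Notation mu := (@lebesgue_measure R).
Implicit Types (f a b : R -> R) (eps lam M F : R) (u v g h : R -> R[i]).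

Lemma complex_potential eps (y : R) (z : R[i]) : 'i / eps%:C * y%:C * z =
  Complex (- (y / eps * complex.Im z)) (y / eps * complex.Re z).
Proof.
rewrite -complexiE -fmorphV; case: z => s t; apply/eqP; rewrite eq_complex /=.
by apply/andP; split; apply/eqP; ring.
Qed.

Lemma complex_shift lam (z : R[i]) : 'i * lam%:C * z =
  Complex (- (lam * complex.Im z)) (lam * complex.Re z).
Proof.
rewrite -complexiE; case: z => s t; apply/eqP; rewrite eq_complex /=.
by apply/andP; split; apply/eqP; ring.
Qed.

Lemma ReD (y z : R[i]) : complex.Re (y + z) = complex.Re y + complex.Re z.
Proof. by case: y z => ? ? []. Qed.
Lemma ImD (y z : R[i]) : complex.Im (y + z) = complex.Im y + complex.Im z.
Proof. by case: y z => ? ? []. Qed.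
Lemma ReN (z : R[i]) : complex.Re (- z) = - complex.Re z.
Proof. by case: z. Qed.
Lemma ImN (z : R[i]) : complex.Im (- z) = - complex.Im z.
Proof. by case: z. Qed.
Lemma ReZ (r : R) (z : R[i]) : complex.Re (r%:C * z) = r * complex.Re z.
Proof. by case: z => s t /=; ring. Qed.
Lemma ImZ (r : R) (z : R[i]) : complex.Im (r%:C * z) = r * complex.Im z.
Proof. by case: z => s t /=; ring. Qed.

Definition complexE := (complex_potential, complex_shift, ReD, ImD, ReN, ImN, ReZ, ImZ).

Lemma L2_loc u : L2 u ->
  loc (fun x => complex.Re (u x)) /\ loc (fun x => complex.Im (u x)).
Proof.
move=> Lu; have [A mA] := L2_mass_le Lu.
by have [mr mi _] := Lu; exact: mass_le_components mr mi mA.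
Qed.

Lemma ae_mass_le a b c d A : measurable_fun [set: R] c -> measurable_fun [set: R] d ->
  a = c %[ae mu] -> b = d %[ae mu] -> mass_le a b A -> mass_le c d A.
Proof.
move=> mc md ac bd [U Uu UA]; exists U => //.
apply: ae_prim Uu.
  by apply: measurable_funD; exact: measurable_funX.
move: ac bd; apply: filterS2 => x + + _ => -> // -> //.
Qed.

Lemma continuous_quotient f eps lam : continuous f ->
  continuous (fun x => f x / eps - lam).
Proof. by move=> cf; cont. Qed.

(** [du_bois_reymond], applied to [u1], [u2] and to [u], [u1], gives representatives that are
    genuine primitives; [u2] is then replaced by its expression through the equation, valid almost
    everywhere. *)
Lemma resolvent_system f eps lam g u : continuous f ->
  resolvent (Heps f eps) ('i * lam%:C) g u ->
  exists a a1 b b1 A,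
  [/\ system 0 (fun x => f x / eps - lam) (fun x => complex.Re (g x))
        (fun x => complex.Im (g x)) a a1 b b1,
      mass_le a b A, (fun x => complex.Re (u x)) = a %[ae mu] &
      (fun x => complex.Im (u x)) = b %[ae mu]].
Proof.
move=> cf [Lg [h [_ [_ [u2 [u1 [Lu Lu1 Lu2 wu wu1]] hE]]] gE]].
have [wur wui] := (weak_derivativeP _ _).1 wu.
have [wu1r wu1i] := (weak_derivativeP _ _).1 wu1.
have [lur lui] := L2_loc Lu; have [lu1r lu1i] := L2_loc Lu1.
have [lu2r lu2i] := L2_loc Lu2.
have [a1 a12 ra1] := du_bois_reymond lu1r lu2r wu1r.
have [b1 b12 ib1] := du_bois_reymond lu1i lu2i wu1i.
have [a ar ra] := du_bois_reymond lur lu1r wur.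
have [b bi ib] := du_bois_reymond lui lu1i wui.
have [A mA] := L2_mass_le Lu.
have [mgr mgi _] := Lg.
have ma := prim_measurable ar; have mb := prim_measurable bi.
have cq : continuous (fun x => f x / eps - lam) by exact: continuous_quotient.
have ca := prim_continuous ar; have cb := prim_continuous bi.
have ae : \forall x \ae mu, [/\ g x = h x - 'i * lam%:C * u x,
    h x = - u2 x + (x ^+ 2)%:C * u x + 'i / eps%:C * (f x)%:C * u x,
    complex.Re (u x) = a x & complex.Im (u x) = b x].
  near=> y; split; near: y.
  - by move: gE; apply: filterS => y; exact.
  - by move: hE; apply: filterS => y; exact.
  - by move: ra; apply: filterS => y; exact.
  - by move: ib; apply: filterS => y; exact.
exists a, a1, b, b1, A; split => //; last exact: ae_mass_le ra ib mA.
split.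
- exact: ae_prim (prim_measurable a12) ra1 ar.
- exact: ae_prim (prim_measurable b12) ib1 bi.
- apply: ae_prim a12.
    by apply: measurable_funB => //; apply: continuous_measurable_fun; cont.
  move: ae; apply: filterS => x [gx hx ux vx] _.
  by rewrite gx hx !complexE /= ux vx; ring.
- apply: ae_prim b12.
    by apply: measurable_funB => //; apply: continuous_measurable_fun; cont.
  move: ae; apply: filterS => x [gx hx ux vx] _.
  by rewrite gx hx !complexE /= ux vx; ring.
Unshelve. all: by end_near. Qed.

Lemma mass_le_L2_pair a b A : measurable_fun [set: R] a -> measurable_fun [set: R] b ->
  mass_le a b A -> L2 (fun x => Complex (a x) (b x)).
Proof. by move=> ma mb mA; exact: (@mass_le_L2 R (fun x => Complex (a x) (b x)) A). Qed.

Lemma mass_le_comb a b c d A B (k1 k2 : R -> R) : mass_le a b A -> mass_le c d B ->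
  measurable_fun [set: R] k1 -> measurable_fun [set: R] k2 ->
  (forall x, k1 x ^+ 2 + k2 x ^+ 2 <=
    2 * (a x ^+ 2 + b x ^+ 2) + 2 * (c x ^+ 2 + d x ^+ 2)) ->
  mass_le k1 k2 (2 * A + 2 * B).
Proof. by move=> mA mB m1 m2 H; exact: (mass_le_dom mA mB). Qed.

(** The point is membership in the domain: [regularity] puts [x^2 u] in L2, boundedness of [f] does
    so for [q u], and the equation then for the second derivative. *)
Lemma system_resolvent f eps lam F g a a1 b b1 A : continuous f ->
  (forall x, `|f x| <= F) -> L2 g ->
  system 0 (fun x => f x / eps - lam) (fun x => complex.Re (g x))
    (fun x => complex.Im (g x)) a a1 b b1 ->
  mass_le a b A ->
  resolvent (Heps f eps) ('i * lam%:C) g (fun x => Complex (a x) (b x)).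
Proof.
move=> cf fF Lg sys mA; have [aa bb aa1 bb1] := sys.
have [mgr mgi _] := Lg; have [B mB] := L2_mass_le Lg.
set q := (fun x => f x / eps - lam) in sys aa1 bb1.
have cq : continuous q by exact: continuous_quotient.
have [Q qQ] : exists Q : R, forall x, `|q x| <= Q.
  exists (F * `|eps^-1| + `|lam|) => x; apply: le_trans (ler_normB _ _) _.
  by rewrite lerD2r normrM ler_wpM2r.
have ca := prim_continuous aa; have cb := prim_continuous bb.
have ca1 := prim_continuous aa1; have cb1 := prim_continuous bb1.
have mes (k : R -> R) : continuous k -> measurable_fun [set: R] k by exact: continuous_measurable_fun.
have mA1 := energy_derivative sys (lexx 0) mA mB.
have [Mx Mxp] : exists N : R -> R, prim N (fun x => x ^+ 4 * (a x ^+ 2 + b x ^+ 2)).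
  by apply: continuous_prim; cont.
have mX : mass_le (fun x => x ^+ 2 * a x) (fun x => x ^+ 2 * b x) (16 * A + 2 * B).
  exists Mx; last exact: regularity sys (lexx 0) mA mB Mxp.
  by apply: eq_prim Mxp => // x; ring.
have Q2 x : q x ^+ 2 <= Q ^+ 2.
  by rewrite -(real_normK (num_real (q x))) lerXn2r ?nnegrE// (le_trans _ (qQ x)).
have mq : mass_le (fun x => - (q x * b x)) (fun x => q x * a x) (Q ^+ 2 * A).
  apply: (mass_le_scale mA (sqr_ge0 Q)); [by apply: mes; cont|by apply: mes; cont|].
  move=> x; have := ler_wpM2r (addr_ge0 (sqr_ge0 (a x)) (sqr_ge0 (b x))) (Q2 x).
  lra.
have cxq : continuous (fun x : R => x ^+ 2 * a x - q x * b x) by cont.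
have cxq' : continuous (fun x : R => x ^+ 2 * b x + q x * a x) by cont.
pose w x := x ^+ 2 * a x - q x * b x - complex.Re (g x).
pose w' x := x ^+ 2 * b x + q x * a x - complex.Im (g x).
have mw : measurable_fun [set: R] w by apply: measurable_funB => //; exact: mes.
have mw' : measurable_fun [set: R] w' by apply: measurable_funB => //; exact: mes.
pose u x := Complex (a x) (b x).
have Lu : L2 u by apply: mass_le_L2_pair mA; exact: mes.
have Lu1 : L2 (fun x => Complex (a1 x) (b1 x)) by apply: mass_le_L2_pair mA1; exact: mes.
have Lu2 : L2 (fun x => Complex (w x) (w' x)).
  have m2 : mass_le (fun x => x ^+ 2 * a x - q x * b x) (fun x => x ^+ 2 * b x + q x * a x)
      (2 * (16 * A + 2 * B) + 2 * (Q ^+ 2 * A)).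
    apply: mass_le_comb mX mq _ _ _; [exact: mes|exact: mes|].
    move=> x; have := sqr_ge0 (x ^+ 2 * a x + q x * b x).
    have := sqr_ge0 (x ^+ 2 * b x - q x * a x); lra.
  apply: (mass_le_L2_pair mw mw' (mass_le_comb m2 mB mw mw' _)) => x; rewrite /w /w'.
  have := sqr_ge0 (x ^+ 2 * a x - q x * b x + complex.Re (g x)).
  have := sqr_ge0 (x ^+ 2 * b x + q x * a x + complex.Im (g x)); lra.
have aw : prim a1 w by apply: eq_prim aa1 => // x; rewrite addr0.
have bw : prim b1 w' by apply: eq_prim bb1 => // x; rewrite addr0.
have H2u : H2_with u (fun x => Complex (w x) (w' x)).
  exists (fun x => Complex (a1 x) (b1 x)); split => //.
    by apply/weak_derivativeP; split; exact: prim_weak_derivative.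
  by apply/weak_derivativeP; split; exact: prim_weak_derivative.
pose h x := g x + 'i * lam%:C * u x.
have hE x : h x = - Complex (w x) (w' x) + (x ^+ 2)%:C * u x + 'i / eps%:C * (f x)%:C * u x.
  rewrite /h !complexE; apply/eqP; rewrite eq_complex.
  by apply/andP; split; apply/eqP; rewrite !complexE /= /w /w' /q; ring.
have Lh : L2 h.
  have cl : mass_le (fun x => - (lam * b x)) (fun x => lam * a x) (lam ^+ 2 * A).
    apply: (mass_le_scale mA (sqr_ge0 lam)); [by apply: mes; cont|by apply: mes; cont|].
    by move=> x; rewrite le_eqVlt; apply/orP; left; apply/eqP; ring.
  have hr : (fun x => complex.Re (h x)) = (fun x => complex.Re (g x) + - (lam * b x)).
    by apply/funext => x; rewrite /h !complexE.
  have hi : (fun x => complex.Im (h x)) = (fun x => complex.Im (g x) + lam * a x).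
    by apply/funext => x; rewrite /h !complexE.
  have m1 : measurable_fun [set: R] (fun x => complex.Re (h x)).
    by rewrite hr; apply: measurable_funD => //; apply: mes; cont.
  have m2 : measurable_fun [set: R] (fun x => complex.Im (h x)).
    by rewrite hi; apply: measurable_funD => //; apply: mes; cont.
  apply: (mass_le_L2 m1 m2 (mass_le_comb mB cl m1 m2 _)) => x.
  rewrite /h !complexE /=.
  have := sqr_ge0 (complex.Re (g x) + (lam * b x)).
  have := sqr_ge0 (complex.Im (g x) - (lam * a x)); lra.
split => //; exists h; last first.
  by apply: aeW => x _; rewrite /h addrK.
split; last first.
  by split => //; exists (fun x => Complex (w x) (w' x)) => //; apply: aeW => x _; exact: hE.
split; first by exists (fun x => Complex (w x) (w' x)).
have -> : (fun x => (x ^+ 2)%:C * u x) = (fun x => Complex (x ^+ 2 * a x) (x ^+ 2 * b x)).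
  by apply/funext => x; apply/eqP; rewrite eq_complex !complexE !eqxx.
by apply: mass_le_L2_pair mX; apply: mes; cont.
Qed.

End Resolvent.

(** * Bounds on [Psi] *)

Section PsiBounds.
Local Open Scope complex_scope.
Context {R : realType}.
Local Notation mu := (@lebesgue_measure R).
Implicit Types (f a b : R -> R) (eps lam M F : R) (u v g h : R -> R[i]).

(** An essential bound violated at one point would, by continuity, be violated on an interval around
    it, which has positive measure. *)
Lemma continuous_Linfty_bounded f : f \in Lfun mu +oo%E -> continuous f ->
  exists F, forall x, `|f x| <= F.
Proof.
move=> /andP[_]; rewrite inE /= /finite_norm => + cf.
have muT : (0 < mu [set: R])%E.
  apply: (@lt_le_trans _ _ (mu `[0%R, 1%R]%classic)).
    by rewrite lebesgue_measure_itv /= lte_fin ltr01 oppr0 adde0 lte_fin ltr01.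
  by apply: le_measure => //; rewrite inE.
rewrite Lnorm.unlock muT => fin.
have [F fF] : exists F, \forall x \ae mu, `|f x| <= F.
  have := @ess_supr_bounded _ _ R mu (fun x => `|f x|) fin.
  by [].
exists F => x; rewrite leNgt; apply/negP => Fx.
have e0 : 0 < `|f x| - F by rewrite subr_gt0.
have [d d0 Hd] := continuous_eps (cf x) e0.
have big y : `|x - y| < d -> F < `|f y|.
  move=> /Hd fxy; have : `|f x| <= `|f x - f y| + `|f y|.
    by rewrite -{1}(subrK (f y) (f x)) ler_normD.
  lra.
have : mu `[(x - d / 2)%R, (x + d / 2)%R]%classic = 0.
  apply/negligibleP => //; move: fF; apply: negligibleS => y /=.
  rewrite in_itv /= => /andP[y1 y2]; apply/negP; rewrite -ltNge.
  by apply: big; rewrite ltr_norml; lra.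
rewrite lebesgue_measure_itv /= lte_fin.
clear fin muT; case: ltP => [_ /(congr1 fine) /= |H _]; lra.
Qed.

Lemma L2norm_ge0 u : (0 <= L2norm u)%E.
Proof. by rewrite L2norm_integral poweR_ge0. Qed.

Lemma L2_zero : L2 (fun _ : R => 0 : R[i]).
Proof.
apply: (@mass_le_L2 _ _ 0) => //=.
exact: mass_le_zero.
Qed.

Lemma L2norm_zero : L2norm (fun _ : R => 0 : R[i]) = 0%E.
Proof.
apply/eqP; rewrite eq_le L2norm_ge0 andbT.
by apply: mass_le_L2norm => //=; rewrite expr0n; exact: mass_le_zero.
Qed.

Lemma mass_le_eq0 a b : continuous a -> continuous b -> mass_le a b 0 ->
  forall x, a x = 0 /\ b x = 0.
Proof.
move=> ca cb [U Uu U0] x.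
have /(_ x) : forall x, a x ^+ 2 + b x ^+ 2 = 0.
  apply: prim_eq0 Uu _ _ _; first by cont.
    by move=> y; nonneg.
  by move=> s t st; have := U0 s t st; rewrite subr_le0.
by move=> /eqP; rewrite paddr_eq0 ?sqr_ge0// !sqrf_eq0 => /andP[/eqP -> /eqP ->].
Qed.

Lemma resolvent_bound f F M : continuous f -> (forall x, `|f x| <= F) ->
  (forall m, (f @^-1` [set m])° = set0) -> 2 <= M ->
  exists2 eps0 : R, 0 < eps0 & forall eps lam, 0 < eps -> eps < eps0 ->
    bounded_operator (resolvent (Heps f eps) ('i * lam%:C)) /\
    (0 <= opnorm (resolvent (Heps f eps) ('i * lam%:C)%R) <= (M^-1)%:E)%E.
Proof.
move=> cf fF f0 M2; have M1 : 1 <= M by lra.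
have M0 : 0 < M by lra.
have [eps0 eps00 H] := resolvent_estimate cf f0 M1.
exists eps0 => // eps lam e0 ee0.
set S := resolvent _ _.
have surj g : L2 g -> exists u, S g u.
  move=> Lg; have [B mB] := L2_mass_le Lg; have [l1 l2] := L2_loc Lg.
  have slv : solvable 0 (fun x => f x / eps - lam).
    (* The estimate serves at [p = 1] here for existence, and at [p = 0] below for the bound and for
       uniqueness. *)
    apply: (solvable_resolvent cf fF M2 e0) => h1 h2 a a1 b b1 A D sys mA mD.
    exact: (H eps lam 1 h1 h2 a a1 b b1 A D e0 ee0 ler01 sys mA mD).
  have [a [a1 [b [b1 [A [sys mA]]]]]] := slv _ _ _ l1 l2 mB.
  by exists (fun x => Complex (a x) (b x)); exact: system_resolvent cf fF Lg sys mA.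
have bound g u : S g u -> (L2norm g <= 1)%E -> (L2norm u <= (M^-1)%:E)%E.
  move=> Sgu g1; have [[mr mi _] _] := Sgu.
  have [a [a1 [b [b1 [A [sys mA ra ib]]]]]] := resolvent_system cf Sgu.
  have mg := L2norm_mass_le mr mi g1; rewrite expr1n in mg.
  have mu' := H eps lam 0 _ _ _ _ _ _ _ _ e0 ee0 (lexx 0) sys mA mg.
  apply: mass_le_L2norm; first by rewrite invr_ge0 ltW.
  have [_ [h [[[u2 [u1 [[mur mui _] _ _ _ _]]] _] _] _]] := Sgu.
  rewrite exprVn; rewrite mul1r in mu'.
  by apply: ae_mass_le mu' => //; [move: ra|move: ib]; apply: filterS => x + _ => ->.
have opM : (opnorm S <= (M^-1)%:E)%E.
  by apply: ge_ereal_sup => _ [g [u [Sgu g1 ->]]]; exact: bound Sgu g1.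
split; last first.
  (* Nonnegativity will be needed to invert in the extended reals; the datum 0 shows that the set of
     norms is not empty. *)
  rewrite opM andbT; have [u Su] := surj _ L2_zero.
  apply: le_trans (L2norm_ge0 u) _; apply: ereal_sup_ubound.
  by exists (fun=> 0), u; split => //; rewrite L2norm_zero lee01.
split => //; last by apply: le_lt_trans opM _; rewrite ltry.
move=> g u v Su Sv.
have [a [a1 [b [b1 [A [sys mA ra ib]]]]]] := resolvent_system cf Su.
have [c [c1 [d [d1 [D [sys' mD rc id_]]]]]] := resolvent_system cf Sv.
have sys0 : system 0 (fun x => f x / eps - lam) (fun=> 0) (fun=> 0)
    (fun x => a x - c x) (fun x => a1 x - c1 x)
    (fun x => b x - d x) (fun x => b1 x - d1 x).
  by apply: eq_system (system_sub sys sys') => x; rewrite subrr.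
have [aa bb _ _] := sys; have [cc dd _ _] := sys'.
have cac := prim_continuous (primB aa cc); have cbd := prim_continuous (primB bb dd).
have mAD : mass_le (fun x => a x - c x) (fun x => b x - d x) (2 * A + 2 * D).
  apply: mass_le_comb mA mD _ _ _; [exact: continuous_measurable_fun|exact: continuous_measurable_fun|].
  by move=> x; have := sqr_ge0 (a x + c x); have := sqr_ge0 (b x + d x); lra.
(* Two solutions for the same [g] differ by a solution with zero data, whose mass is 0 by the
   estimate itself. *)
have := H eps lam 0 _ _ _ _ _ _ _ _ e0 ee0 (lexx 0) sys0 mAD (mass_le_zero (lexx 0)).
rewrite mul0r => /(mass_le_eq0 cac cbd) E.
have ac x : a x = c x by have [/eqP + _] := E x; rewrite subr_eq0 => /eqP.
have bd x : b x = d x by have [_ /eqP] := E x; rewrite subr_eq0 => /eqP.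
have ae : \forall x \ae mu, [/\ complex.Re (u x) = a x, complex.Im (u x) = b x,
    complex.Re (v x) = c x & complex.Im (v x) = d x].
  near=> y; split; near: y.
  - by move: ra; apply: filterS => y; exact.
  - by move: ib; apply: filterS => y; exact.
  - by move: rc; apply: filterS => y; exact.
  - by move: id_; apply: filterS => y; exact.
move: ae; apply: filterS => x [ux ux' vx vx'] _.
by apply/eqP; rewrite eq_complex ux ux' vx vx' ac bd !eqxx.
Unshelve. all: by end_near. Qed.

Lemma Psi_ge f F M : continuous f -> (forall x, `|f x| <= F) ->
  (forall m, (f @^-1` [set m])° = set0) -> 2 <= M ->
  exists2 eps0 : R, 0 < eps0 & forall eps, 0 < eps -> eps < eps0 ->
    (M%:E <= Psi f eps)%E.
Proof.
move=> cf fF f0 M2; have [eps0 eps00 H] := resolvent_bound cf fF f0 M2.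
exists eps0 => // eps e0 ee0; rewrite /Psi /=.
have M0 : 0 < M by lra.
set s := ereal_sup _.
have rn lam : resolvent_norm (Heps f eps) ('i * lam%:C) =
    opnorm (resolvent (Heps f eps) ('i * lam%:C)).
  by rewrite /resolvent_norm; case: asboolP => // /(_ (H eps lam e0 ee0).1).
have s1 : (s <= (M^-1)%:E)%E.
  by apply: ge_ereal_sup => _ [lam _ <-]; rewrite rn; case/andP: (H eps lam e0 ee0).2.
have s0 : (0 <= s)%E.
  apply: (@le_trans _ _ (resolvent_norm (Heps f eps) ('i * (0%R)%:C)%R)).
    by rewrite rn; case/andP: (H eps 0 e0 ee0).2.
  by apply: ereal_sup_ubound; exists 0.
have -> : M%:E = ((M^-1)%:E)^-1%E by rewrite inver invr_eq0 gt_eqF// invrK.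
by rewrite lee_pV2// inE /= ?lee_fin ?invr_ge0 ?(ltW M0).
Qed.

Lemma mass_le_support a S : continuous a ->
  (forall x, x < - S \/ S < x -> a x = 0) -> exists A, mass_le a (fun=> 0) A.
Proof.
move=> ca aS.
have [U Uu] : exists U, prim U (fun x => a x ^+ 2 + 0 ^+ 2).
  by apply: continuous_prim; cont.
pose T := `|S| + 1; have ST : S < T by rewrite /T; have := ler_norm S; lra.
have T0 : 0 < T by rewrite /T; have := normr_ge0 S; lra.
have u0 x : 0 <= a x ^+ 2 + 0 ^+ 2 by nonneg.
have mono s t : s <= t -> U s <= U t by move=> st; exact: (prim_ge0 Uu).
have out s t : s <= t -> (t <= - T \/ T <= s) -> U t - U s <= 0.
  move=> st stT; have := prim_le Uu (prim_cst 0) st; rewrite subrr; apply => x /andP[sx xt].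
  rewrite aS ?expr0n ?addr0//; case: stT => H; [left|right]; lra.
exists (U T - U (- T)), U => //.
apply: (growth_le_sym Uu u0) => V V1.
have [VT|/ltW TV] := leP V T.
  have := mono V T VT; have : U (- T) <= U (- V) by apply: mono; lra.
  lra.
have : U V - U T <= 0 by apply: out => //; right.
have : U (- T) - U (- V) <= 0 by apply: out; [lra|left].
lra.
Qed.

Lemma Psi_le f F m : continuous f -> (forall x, `|f x| <= F) ->
  (f @^-1` [set m])° !=set0 ->
  exists M, forall eps, 0 < eps -> (Psi f eps <= M%:E)%E.
Proof.
move=> cf fF [x0 [d /= d0 Hd]].
pose k := d^-1; have k0 : 0 < k by rewrite invr_gt0.
have sb : smooth (fun x => 1 * bump1 (k * (x - x0))).
  by apply: smooth_affine; exact: smooth_bump.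
set w := (fun x => _) in sb.
(* The bump lives on [(x0, x0 + d)], inside the ball where [f = m]. *)
have fw x : f x * w x = m * w x.
  have [/andP[z0 z1]|z01] := boolP ((0 < k * (x - x0)) && (k * (x - x0) < 1)); last first.
    rewrite /w /bump1 bump_out ?mulr0//.
    by move: z01; rewrite negb_and -!leNgt => /orP[?|?]; [left|right].
  suff -> : f x = m by [].
  apply: Hd; rewrite /= ltr_norml.
  move: z0 z1; rewrite pmulr_rgt0// /k ltr_pdivrMl// mulr1; lra.
have ww1 := smooth_prim sb; have w1w2 := smooth_prim (smooth_derive1 sb).
have cw := smooth_continuous sb.
have cw2 := smooth_continuous (smooth_derive1 (smooth_derive1 sb)).
pose g x := x ^+ 2 * w x - derive1 (derive1 w) x.
have cg : continuous g by rewrite /g; cont.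
pose S := `|x0| + d.
have wS x : x < - S \/ S < x -> w x = 0.
  rewrite /S => xS; have := ler_norm x0; have := ler_norm (- x0); rewrite normrN => ? ?.
  rewrite /w /bump1 bump_out ?mulr0//; case: xS => xS.
    by left; rewrite pmulr_rle0//; lra.
  by right; rewrite /k ler_pdivlMl// mulr1; lra.
have w2S := derive1_support (derive1_support wS).
have gS x : x < - S \/ S < x -> g x = 0.
  by move=> xS; rewrite /g wS// w2S// mulr0 subrr.
have [B mB] := mass_le_support cg gS.
have [A mA] := mass_le_support cw wS.
have B0 : 0 <= B by have [? _ /growth_le_ge0] := mB.
(* Normalisation of the data: [c^2 B <= 1] as [B <= (B + 1)^2]. *)
pose c := (B + 1)^-1; have c0 : 0 < c by rewrite invr_gt0; lra.
have cB : c ^+ 2 * B <= 1.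
  rewrite exprVn ler_pdivrMl; last by rewrite exprn_gt0//; lra.
  have := sqr_ge0 B; lra.
pose u x := Complex (c * w x) 0; pose G x := Complex (c * g x) (0 : R).
have mG : mass_le (fun x => c * g x) (fun=> 0) (c ^+ 2 * B).
  apply: (mass_le_scale mB (sqr_ge0 c)) => //.
    by apply: continuous_measurable_fun; cont.
  by move=> x; rewrite le_eqVlt; apply/orP; left; apply/eqP; ring.
have mu' : mass_le (fun x => c * w x) (fun=> 0) (c ^+ 2 * A).
  apply: (mass_le_scale mA (sqr_ge0 c)) => //.
    by apply: continuous_measurable_fun; cont.
  by move=> x; rewrite le_eqVlt; apply/orP; left; apply/eqP; ring.
have LG : L2 G.
  apply: mass_le_L2_pair mG => //; apply: continuous_measurable_fun; cont.
have Lu : L2 u.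
  apply: mass_le_L2_pair mu' => //; apply: continuous_measurable_fun; cont.
have G1 : (L2norm G <= 1)%E.
  by apply: (@mass_le_L2norm _ G 1) => //; rewrite expr1n; exact: mass_leW mG.
have [mur mui ufin] := Lu.
(* The inverse of this norm is the final bound, so it must not vanish; the bump is positive at
   [x0 + d / 2]. *)
have Lgt0 : (0 < L2norm u)%E.
  rewrite lt_neqAle L2norm_ge0 andbT; apply/negP => /eqP L0.
  have := @L2norm_mass_le _ u 0 mur mui; rewrite -L0 lexx expr0n => /(_ isT) m0.
  have cu : continuous (fun x => c * w x) by cont.
  have [+ _] := mass_le_eq0 cu (@continuous_cst_fun R 0) m0 (x0 + d / 2).
  apply/eqP; rewrite gt_eqF// mulr_gt0// /w mul1r.
  have -> : k * (x0 + d / 2 - x0) = 2^-1 by rewrite /k; field; lra.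
  by apply: bump1_gt0; lra.
have Lfin : L2norm u \is a fin_num by rewrite ge0_fin_numE// ltW.
have L0 : 0 < fine (L2norm u) by rewrite fine_gt0// Lgt0.
exists (fine (L2norm u))^-1 => eps e0.
have res : resolvent (Heps f eps) ('i * (m / eps)%:C) G u.
  apply: (@system_resolvent _ f eps (m / eps) F G _ (fun x => c * derive1 w x) _ (fun=> 0)) => //; last exact: mu'.
  split.
  - exact: primZ.
  - exact: prim_cst.
  - by apply: eq_prim (primZ c w1w2) => // x; rewrite /= /g; ring.
  - apply: eq_prim (prim_cst 0) => // x /=.
    have -> : (f x / eps - m / eps) * (c * w x) = c / eps * (f x * w x - m * w x) by ring.
    by rewrite fw; ring.
rewrite /Psi /=; set s := ereal_sup _.
have Ls : (L2norm u <= s)%E.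
  apply: (@le_trans _ _ (resolvent_norm (Heps f eps) ('i * (m / eps)%:C))); last first.
    by apply: ereal_sup_ubound; exists (m / eps).
  (* If the resolvent is not a bounded operator, its norm is [+oo] by convention and the lower bound
     is trivial. *)
  rewrite /resolvent_norm; case: asboolP => _; last by rewrite leey.
  by apply: ereal_sup_ubound; exists G, u.
have -> : ((fine (L2norm u))^-1)%:E = (L2norm u)^-1%E.
  by rewrite -[in RHS](fineK Lfin) inver gt_eqF.
by rewrite lee_pV2// inE /= ?L2norm_ge0// (le_trans _ Ls)// L2norm_ge0.
Qed.

End PsiBounds.

Theorem proposition1p4 (R : realType) (f : R -> R)
    (f_Linfty : f \in Lfun (@lebesgue_measure R) +oo%E)
    (f_continuous : continuous f) :
  ((forall m : R, (f @^-1` [set m])° = set0) ->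
     Psi f eps @[eps --> (0 : R)^'+] --> +oo%E) /\
  ((exists m : R, (f @^-1` [set m])° !=set0) ->
     exists M : R, forall eps : R, 0 < eps -> (Psi f eps <= M%:E)%E).
Proof.
have [F fF] := continuous_Linfty_bounded f_Linfty f_continuous.
split=> [f0|[m]]; last exact: Psi_le fF.
apply/cvgeyPge => A.
(* [Psi_ge] asks for [M >= 2], whence the added 2. *)
have A2 : 2 <= `|A| + 2 by rewrite lerDr.
have [eps0 eps00 H] := Psi_ge f_continuous fF f0 A2.
near=> eps.
apply: (@le_trans _ _ (`|A| + 2)%:E).
  by rewrite lee_fin (le_trans (ler_norm _))// lerDl.
apply: H; first by near: eps; exact: nbhs_right_gt.
by near: eps; exact: nbhs_right_lt.
Unshelve. all: by end_near. Qed.
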